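(* Assume that $X$ and $Y$ are real random variables whose joint distribution function satisfies $F_{X,Y}=F_XF_Y$ (i.e. $X$ and $Y$ are independent) and is fixed (not depending on $n$) and continuous. Let $(X_1,Y_1),\ldots,(X_n,Y_n)$ be independent copies of $(X,Y)$, let $\xi_n$ be Chatterjee's rank correlation of this sample, and let $\tilde\xi_b$ be Chatterjee's rank correlation computed on a standard bootstrap sample of size $n$. Then the following two statements hold. (i) (variance inconsistency) Neither $n\,\mathrm{E}[(\tilde\xi_b-\xi_n)^2\mid \mathbf X,\mathbf Y]$ nor $n\,\mathrm{Var}[\tilde\xi_b\mid \mathbf X,\mathbf Y]$ converges to $2/5$ in probability as $n\to\infty$. (ii) (distribution inconsistency) There exists a sequence of measurable events $[\mathcal E_n]_{n=1}^\infty$ (with $\mathcal E_n$ a measurable set of values of $(X_1,Y_1,\ldots,X_n,Y_n)$), satisfying $$\liminf_{n\to\infty}\mathrm P\big((X_1,Y_1,\ldots,X_n,Y_n)\in\mathcal E_n\big)>0,$$ such that, conditional on $(X_1,Y_1,\ldots,X_n,Y_n)\in\mathcal E_n$, neither the distribution of $\sqrt n(\tilde\xi_b-\xi_n)$ nor the distribution of $\sqrt n(\tilde\xi_b-\mathrm E[\tilde\xi_b\mid\mathbf X,\mathbf Y])$ converges to $N(0,2/5)$.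
   Context: Write $(\mathbf X,\mathbf Y)=\{(X_i,Y_i)\}_{i=1}^n$ for the original sample. Since the marginal distributions are continuous, almost surely there are no ties among the $X_i$ nor among the $Y_i$. Let $R_i=\sum_{j=1}^n \mathbf 1(Y_j\le Y_i)$, let $[1],\ldots,[n]$ be the rearrangement of $1,\ldots,n$ with $X_{[1]}<\cdots<X_{[n]}$, and set $$\xi_n=1-\frac{3}{n^2-1}\sum_{i=1}^{n-1}\big|R_{[i+1]}-R_{[i]}\big|.$$ Bootstrap: conditionally on $(\mathbf X,\mathbf Y)$, the bootstrap sample $\{(X_{b,i},Y_{b,i})\}_{i=1}^n$ consists of $n$ independent uniform draws with replacement from $\{(X_i,Y_i)\}_{i=1}^n$. Let $[1]_b,\ldots,[n]_b$ be a rearrangement of $1,\ldots,n$ such that $X_{b,[1]_b}\le\cdots\le X_{b,[n]_b}$, with ties broken in an arbitrary way. Let $R_{b,i}=\sum_{j=1}^n\mathbf 1(Y_{b,j}\le Y_{b,i})$ and $L_{b,i}=\sum_{j=1}^n\mathbf 1(Y_{b,j}\ge Y_{b,i})$, and set $$\tilde\xi_b=1-\frac{n}{2\sum_{i=1}^nL_{b,i}(n-L_{b,i})}\sum_{i=1}^{n-1}\big|R_{b,[i+1]_b}-R_{b,[i]_b}\big|.$$ If all bootstrap observations coincide (so that both sums are $0$), set $\tilde\xi_b=1$. $\mathrm E[\cdot\mid\mathbf X,\mathbf Y]$ and $\mathrm{Var}[\cdot\mid\mathbf X,\mathbf Y]$ denote conditional expectation and variance given the original sample. *)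

(* Defs.v *)
From HB Require Import structures.
From mathcomp Require Import all_boot all_order all_algebra all_fingroup.
From mathcomp Require Import all_classical all_reals all_analysis.

Set Implicit Arguments.
Unset Strict Implicit.
Unset Printing Implicit Defensive.

Import Order.TTheory GRing.Theory Num.Theory.
Import numFieldNormedType.Exports.

Local Open Scope classical_set_scope.
Local Open Scope ring_scope.

Section Chatterjee.
Context {R : realType} {n : nat}.
Implicit Types (x y : 'I_n -> R) (s : 'S_n).

Definition arranges x s := forall i j : 'I_n, (i <= j)%N -> x (s i) <= x (s j).

Definition lrank y (i : 'I_n) : nat := \sum_(j < n) (y j <= y i)%R.
Definition urank y (i : 'I_n) : nat := \sum_(j < n) (y i <= y j)%R.

(* The pairs (i, j) with j = i + 1 are the consecutive positions. *)
Definition rank_variation y s : R :=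
  \sum_(i < n) \sum_(j < n | j == i.+1 :> nat)
    `|(lrank y (s j))%:R - (lrank y (s i))%:R|.

Definition chatterjee y s : R :=
  1 - 3%:R / (n%:R ^+ 2 - 1) * rank_variation y s.

Definition chatterjee_ties x y s : R :=
  if [forall i, forall j, (x i == x j) && (y i == y j)] then 1
  else 1 - n%:R / (2%:R * \sum_(i < n) (urank y i)%:R * (n%:R - (urank y i)%:R))
           * rank_variation y s.

End Chatterjee.

Section Probability.
Context {R : realType}.

Definition joint_cdf d (T : measurableType d) (P : probability T R)
    (X Y : {RV P >-> R}) (z : R * R) : \bar R :=
  P (X @^-1` `]-oo, z.1] `&` Y @^-1` `]-oo, z.2]).

Definition same_law d0 d d' (T0 : measurableType d0) (T : measurableType d)
    (S : measurableType d') (P0 : probability T0 R) (P : probability T R)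
    (Z0 : T0 -> S) (Z : T -> S) :=
  forall A : set S, measurable A -> P (Z @^-1` A) = P0 (Z0 @^-1` A).

Definition mutually_independent d d' (T : measurableType d)
    (S : measurableType d') (P : probability T R) (Z : nat -> T -> S) :=
  forall (I : seq nat) (A : nat -> set S), uniq I ->
    (forall i, measurable (A i)) ->
    P (\bigcap_(i in [set` I]) (Z i @^-1` A i)) =
    (\prod_(i <- I) P (Z i @^-1` A i))%E.

(* [g] is a version of the conditional expectation of [f] given [Z]. *)
Definition cond_exp_version d d' (T : measurableType d) (S : measurableType d')
    (P : probability T R) (Z : T -> S) (f g : T -> R) :=
  [/\ forall B : set R, measurable B ->
        preimage_set_system setT Z measurable (g @^-1` B),
      P.-integrable setT (EFin \o g) &
      forall A : set S, measurable A ->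
        (\int[P]_(w in Z @^-1` A) (g w)%:E =
         \int[P]_(w in Z @^-1` A) (f w)%:E)%E].

Definition cvg_in_probability d (T : measurableType d) (P : probability T R)
    (W : nat -> T -> R) (c : R) :=
  forall e : R, 0 < e ->
    P [set w | e <= `|W n w - c|] @[n --> \oo] --> 0%E.

Definition cond_prob d (T : measurableType d) (P : probability T R)
    (A E : set T) : R := fine (P (A `&` E)) / fine (P E).

(* Convergence in distribution to [Q] of the law of [W n] under
   [P( . | E n)]. *)
Definition cvg_in_law_given d (T : measurableType d) (P : probability T R)
    (E : nat -> set T) (W : nat -> T -> R) (Q : probability (measurableTypeR R) R) :=
  forall t : R, {for t, continuous (fun u : R => fine (Q `]-oo, u]%classic))} ->
    cond_prob P [set w | W n w <= t] (E n) @[n --> \oo] -->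
    fine (Q `]-oo, t]%classic).

End Probability.

Section Bootstrap.
Context {R : realType} {d : measure_display} {T : measurableType d}
  {P : probability T R}.
Variables X Y : nat -> {RV P >-> R}.

(* The observations are numbered from 0. *)
Definition sample (n : nat) (w : T) : n.-tuple (R * R) :=
  [tuple (X i w, Y i w) | i < n].

Definition xi_n (srt : forall n, T -> 'S_n) (n : nat) (w : T) : R :=
  chatterjee (fun i : 'I_n => Y i w) (srt n w).

(* [J n w i] is the index of the observation drawn at the [i]-th draw. *)
Variable J : forall n, T -> {ffun 'I_n -> 'I_n}.

(* The conditional law of the [n] drawn indices given the sample is that of
   [n] independent uniform draws. *)
Definition bootstrap_draws :=
  forall n (s : {ffun 'I_n -> 'I_n}),
    measurable (J n @^-1` [set s]) /\
    forall A : set (n.-tuple (R * R)), measurable A ->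
      (P (J n @^-1` [set s] `&` sample n @^-1` A) =
       (\prod_(i < n) (n%:R^-1 : R))%:E * P (sample n @^-1` A))%E.

Definition Xb n (w : T) (i : 'I_n) : R := X (J n w i) w.
Definition Yb n (w : T) (i : 'I_n) : R := Y (J n w i) w.

Definition xi_b (bsrt : forall n, T -> 'S_n) (n : nat) (w : T) : R :=
  chatterjee_ties (@Xb n w) (@Yb n w) (bsrt n w).

End Bootstrap.

(* Main.v *)
Require Import Defs.
From HB Require Import structures.
From mathcomp Require Import all_boot all_order all_algebra all_fingroup.
From mathcomp Require Import ring lra zify.

Set Implicit Arguments.
Unset Strict Implicit.
Unset Printing Implicit Defensive.

Import Order.TTheory GRing.Theory Num.Theory.

Local Open Scope ring_scope.

(** The first halves hold because the bootstrap statistic is not even consistent.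
    The [n] draws miss a given observation with probability
    [k n = (n - 1)^n / n^n], which tends to [exp (-1)].  Given the draws, the
    distinct observations drawn form blocks of tied pairs, and the orders of these
    blocks in X and in Y are independent uniform permutations.  Up to ties,
    [xi_b = 1 - 3 S / n^2] where [S] is the rank variation; computing the first two
    moments of [S] over the permutations and then over the draws shows that
    [n E (xi_b - k n)^2] has limit superior at most [3/5 - 8/5 exp (-2) < 2/5].
    As [xi_n] tends to 0 in mean square, [xi_b - xi_n] stays close to [exp (-1)],
    which excludes any convergence at scale [sqrt n].

    A conditional mean is a better approximation than the constant [k n], so
    [n E (xi_b - m n)^2 <= 399/1000] eventually.  This contradicts the convergence
    of [n v n] to [2/5], and, by Fatou's lemma applied to the tails, the
    convergence in law of [sqrt n (xi_b - m n)] to a law with second moment [2/5].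
    No conditioning is needed: every event [E n] may be the whole space. *)

(** * Sums over permutations *)

(** With [q = k n], three contributions to [n E (xi_b - k n)^2] make up [3/5 - 8/5 q^2]. For draws
    with [D] distinct values and sum of squared multiplicities [Q], the variance of [S] is at most
    about [(n^2 D + D^2 Q) / 45]; the factor [9 / n^4] and the scale [n] turn it into
    [(D/n) / 5 + (D/n)^2 (Q/n) / 5], where [D/n] is close to [1 - q] and [Q/n] has mean at most 2.
    The third contribution is the fluctuation of the conditional mean of [S], that is, the variance
    of [D] over [n], about [q - 2 q^2]. In the total the terms linear in [q] cancel. The margin
    below [2/5] is thin (the value is [0.39608] at [q = 0.357]), so leading coefficients are kept
    exact and cross terms are split with very unequal weights. Two obstacles shape the rest. The
    normalisation of [xi_b] is random and small for degenerate draws, so the ratio is controlled for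
    every arrangement and not only on average. The tie-breaking [bsrt] may depend on the whole
    outcome, so its effect is eliminated before a conditional mean is computed. *)

Lemma perm_extend (T : finType) m (f g : 'I_m -> T) :
  injective f -> injective g -> exists s : {perm T}, forall i, s (f i) = g i.
Proof.
elim: m f g => [|m IH] f g fI gI; first by exists 1%g => -[].
have widI : injective (widen_ord (leqnSn m)).
  by move=> i j /(congr1 val) /= /val_inj.
have [s sP] := IH (f \o widen_ord (leqnSn m)) (g \o widen_ord (leqnSn m))
  (inj_comp fI widI) (inj_comp gI widI).
(* The permutation found for the first [m] points is corrected at the last one; by injectivity of
   [f] and [g] the transposition fixes the earlier values. *)
exists (s * tperm (s (f ord_max)) (g ord_max))%g => i; rewrite permM.
have [->|ineq] := eqVneq i ord_max; first by rewrite tpermL.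
have [j ->] : exists j, i = widen_ord (leqnSn m) j.
  have im : (i < m)%N.
    by have := ltn_ord i; rewrite ltnS leq_eqVlt => /orP[/eqP e|//]; move: ineq => /eqP[]; apply: val_inj.
  by exists (Ordinal im); apply: val_inj.
have := sP j => /= sj; rewrite sj tpermD //; rewrite -?sj.
  by rewrite (inj_eq perm_inj) (inj_eq fI) eq_sym -val_eqE /= neq_ltn ltn_ord.
by rewrite sj (inj_eq gI) eq_sym -val_eqE /= neq_ltn ltn_ord.
Qed.

Lemma perm_extend_seq (T : finType) (s t : seq T) : uniq s -> uniq t ->
  size s = size t -> exists g : {perm T}, map g s = t.
Proof.
case: s => [|x s] us ut sz; first by exists 1%g; case: t sz ut.
have fI : injective (fun i : 'I_(size (x :: s)) => nth x (x :: s) i).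
  by move=> i j /eqP; rewrite nth_uniq // => /eqP/val_inj.
have gI : injective (fun i : 'I_(size (x :: s)) => nth x t i).
  by move=> i j /eqP; rewrite nth_uniq -?sz // => /eqP/val_inj.
have [g gP] := perm_extend fI gI.
exists g; apply: (@eq_from_nth _ x) => [|i]; rewrite size_map // => il.
by rewrite (nth_map x) //; exact: (gP (Ordinal il)).
Qed.

Section PermSums.
Variables (R : realFieldType).

(* Summing over all permutations depends on the entries only through their
   coincidence pattern, hence is polynomial in the indicators of equality. *)
Lemma sum_perm_const m (D : nat) (F : seq 'I_D -> R) :
  exists a, forall s : seq 'I_D, uniq s -> size s = m ->
    \sum_(g : 'S_D) F (map g s) = a.
Proof.
have [/existsP[t ut]|no] := boolP [exists t : m.-tuple 'I_D, uniq t].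
  exists (\sum_(g : 'S_D) F (map g t)) => s us sm.
  have [h <-] := perm_extend_seq ut us (etrans (size_tuple t) (esym sm)).
  rewrite [RHS](reindex_inj (mulgI h)); apply: eq_bigr => g _ /=.
  by rewrite -map_comp; congr F; apply: eq_map => i /=; rewrite permM.
exists 0 => s us sm; case/negP: no; apply/existsP.
by exists (tcast sm (in_tuple s)); rewrite val_tcast.
Qed.

Lemma sum_perm_cst n (c : R) : \sum_(g : 'S_n) c = n`!%:R * c.
Proof. by rewrite big_const iter_addr_0 -card_Sn mulr_natl. Qed.

End PermSums.

Section ConsecutiveSum.
Variable R : realFieldType.

Definition consecutive_sum m (F : 'I_m -> 'I_m -> R) : R :=
  \sum_(i < m) \sum_(j < m | j == i.+1 :> nat) F i j.

Lemma consecutive_sumE m (F : 'I_m.+1 -> 'I_m.+1 -> R) : consecutive_sum F =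
  \sum_(k < m) F (widen_ord (leqnSn _) k) (lift ord0 k).
Proof.
rewrite /consecutive_sum big_ord_recr /= [X in _ + X]big1 ?addr0 => [|j]; last first.
  by move=> /eqP e; have := ltn_ord j; rewrite e ltnn.
apply: eq_bigr => k _; apply: big_pred1 => j /=.
by rewrite -val_eqE.
Qed.

End ConsecutiveSum.

(** * Moments of a sum along a path through randomly permuted points *)

Section EdgeMoments.
Variables (R : realFieldType) (d : nat).
Notation D := d.+2.
Variable h : 'I_D -> 'I_D -> R.
Hypothesis hC : forall i j, h i j = h j i.
Hypothesis h0 : forall i, h i i = 0.

Let A p q r s : R := \sum_(g : 'S_D) h (g p) (g q) * h (g r) (g s).

(** Two edges coincide, share one vertex or are disjoint, and [a2], [a3], [a4] are the values of the
    sum in these cases. The four indicators add up to 2, 1 or 0 accordingly and the products single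
    out coincidence, so the right side interpolates the three values. *)
Lemma sum_perm_edges : exists a2 a3 a4 : R, forall p q r s, p != q -> r != s ->
  A p q r s = a4 + (a3 - a4) * ((p == r)%:R + (p == s)%:R + (q == r)%:R + (q == s)%:R)
   + (a2 - 2 * a3 + a4) * ((p == r)%:R * (q == s)%:R + (p == s)%:R * (q == r)%:R).
Proof.
have [a2 E2] := sum_perm_const 2 (fun l : seq 'I_D =>
  if l is [:: p; q] then h p q * h p q else 0 : R).
have [a3 E3] := sum_perm_const 3 (fun l : seq 'I_D =>
  if l is [:: p; q; r] then h p q * h q r else 0 : R).
have [a4 E4] := sum_perm_const 4 (fun l : seq 'I_D =>
  if l is [:: p; q; r; s] then h p q * h r s else 0 : R).
exists a2, a3, a4 => p q r s pq rs.
have {}E2 u v : u != v -> A u v u v = a2.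
  by move=> uv; rewrite -(E2 [:: u; v]) //= mem_seq1 uv.
have {}E3 u v w : u != v -> v != w -> u != w -> A u v v w = a3.
  by move=> uv vw uw; rewrite -(E3 [:: u; v; w]) //= !inE negb_or uv vw uw.
have AC1 u v w z : A u v w z = A v u w z.
  by apply: eq_bigr => g _; rewrite (hC (g u)).
have AC2 u v w z : A u v w z = A u v z w.
  by apply: eq_bigr => g _; rewrite (hC (g w)).
have [epr|npr] := eqVneq p r.
  subst r; have -> : (p == s) = false by apply/negbTE.
  rewrite (eq_sym q p) (negbTE pq).
  have [<-|nqs] := eqVneq q s; first by rewrite E2 //; rewrite ?mulr1n ?mulr0n /=; ring.
  by rewrite AC1 E3 // 1?eq_sym //; rewrite ?mulr1n ?mulr0n /=; ring.
have [eps|nps] := eqVneq p s.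
  subst s; rewrite (eq_sym q p) (negbTE pq).
  have [eqr|nqr] := eqVneq q r; first by rewrite -eqr AC2 E2 //; rewrite ?mulr1n ?mulr0n /=; ring.
  by rewrite AC1 AC2 E3 // 1?eq_sym //; rewrite ?mulr1n ?mulr0n /=; ring.
have [eqr|nqr] := eqVneq q r.
  by subst r; rewrite (negbTE rs) E3 // ?mulr1n ?mulr0n; ring.
have [eqs|nqs] := eqVneq q s.
  by subst s; rewrite AC2 E3 //; rewrite ?mulr1n ?mulr0n /=; ring.
have -> : A p q r s = a4.
  by rewrite -(E4 [:: p; q; r; s]) //= !inE !negb_or pq npr nps nqr nqs rs.
rewrite ?mulr0n; ring.
Qed.

Let H := \sum_i \sum_j h i j.
Let Q := \sum_i \sum_j h i j ^+ 2.
Let B := \sum_i (\sum_j h i j) ^+ 2.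

Let S (g : 'S_D) := consecutive_sum (fun i j => h (g i) (g j)).

(** By symmetry all ordered pairs of distinct positions have the same total, and for each [g] the
    [D (D - 1)] of them add up to [H] because the diagonal vanishes. *)
Lemma sum_perm_single p q : p != q ->
  (D%:R * (D%:R - 1)) * \sum_(g : 'S_D) h (g p) (g q) = D`!%:R * H.
Proof.
have [a E] := sum_perm_const 2 (fun l : seq 'I_D =>
  if l is [:: p; q] then h p q else 0 : R).
have {}E u v : u != v -> \sum_(g : 'S_D) h (g u) (g v) = a.
  by move=> uv; rewrite -(E [:: u; v]) //= mem_seq1 uv.
move=> pq; rewrite E //.
have -> : D`!%:R * H = \sum_(g : 'S_D) H.
  by rewrite sum_perm_cst.
have HE (g : 'S_D) : H = \sum_i \sum_(j | j != i) h (g i) (g j).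
  rewrite /H (reindex_inj (@perm_inj _ g)); apply: eq_bigr => i _.
  rewrite (reindex_inj (@perm_inj _ g)) (bigD1 i) //= h0 add0r.
  by apply: eq_bigr.
rewrite (eq_bigr _ (fun g _ => HE g)) exchange_big /=.
under [RHS]eq_bigr => i _.
  rewrite exchange_big /=.
  under eq_bigr => j ji do rewrite E 1?eq_sym //.
  rewrite sumr_const cardC1 card_ord /=.
  over.
rewrite sumr_const card_ord -mulrnA -[a *+ _]mulr_natl natrM -[D%:R]natr1 addrK.
by congr (_ * a); rewrite mulrC.
Qed.

Lemma sum_perm_S : \sum_(g : 'S_D) S g = D`!%:R * (H / D%:R).
Proof.
rewrite /S (eq_bigr _ (fun g _ => consecutive_sumE _)) exchange_big /=.
have D0 : (D%:R : R) != 0 by rewrite pnatr_eq0.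
have D1 : (D%:R - 1 : R) != 0 by rewrite -natr1 addrK pnatr_eq0.
have DE : d.+1%:R = D%:R - 1 :> R by rewrite -[D%:R]natr1 addrK.
have := sum_perm_single.
move: D`!%:R D%:R D0 D1 DE => M N N0 N1 DE E.
have {}E (k : 'I_d.+1) : \sum_(g : 'S_D) h (g (widen_ord (leqnSn _) k)) (g (lift ord0 k))
   = M * H / (N * (N - 1)).
  rewrite -(@E (widen_ord (leqnSn _) k) (lift ord0 k)).
    by field; rewrite N0 N1.
  by rewrite -val_eqE /= /bump leq0n add1n neq_ltn ltnSn.
rewrite (eq_bigr _ (fun k _ => E k)) sumr_const card_ord -mulr_natr DE.
by field; rewrite N0 N1.
Qed.

(** The unknowns [a2], [a3], [a4] are never computed. Counting pairs of edges expresses [Q], [B] and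
    [H^2] through them ([EQ], [EB], [EH]), and the second moment of the path likewise ([ES]). In
    [H^2 - 2 B] the multiple of [a2] cancels and that of [a3] is halved, which leaves exactly the
    share of the distinct pairs of edges of a path. *)
Lemma sum_perm_S2 : \sum_(g : 'S_D) S g ^+ 2 =
  D`!%:R * (Q / D%:R + (H ^+ 2 - 2 * B) / (D%:R * (D%:R - 1))).
Proof.
have [a2 [a3 [a4 AE]]] := sum_perm_edges.
have D0 : (D%:R : R) != 0 by rewrite pnatr_eq0.
have D1 : (D%:R - 1 : R) != 0 by rewrite -natr1 addrK pnatr_eq0.
pose N : R := D%:R; rewrite -/N in D0 D1 *.
have DE : d.+1%:R = N - 1 :> R by rewrite /N -[D%:R]natr1 addrK.
pose M : R := D`!%:R; rewrite -/M.
have cst (c : R) : \sum_(g : 'S_D) c = M * c by exact: sum_perm_cst.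
move: M cst => M cst.
have sumC1 (c : R) (q : 'I_D) : \sum_(s | s != q) c = (N - 1) * c.
  by rewrite sumr_const cardC1 card_ord /= -mulr_natl DE.
have sum1 (c : R) : \sum_(s : 'I_D) c = N * c.
  by rewrite sumr_const card_ord -mulr_natl.
have ind1 (p q : 'I_D) : p != q -> \sum_(s | s != q) (p == s)%:R = 1 :> R.
  move=> pq; rewrite (bigD1 p) //= eqxx big1 ?addr0 // => s /andP[_ sp].
  by rewrite eq_sym (negbTE sp).
have ind0 (q : 'I_D) : \sum_(s | s != q) (q == s)%:R = 0 :> R.
  by rewrite big1 // => s sq; rewrite eq_sym (negbTE sq).
have indE (p q : 'I_D) : \sum_(s | s != q) (p == s)%:R = 1 - (p == q)%:R :> R.
  by have [->|pq] := eqVneq p q; rewrite ?ind0 ?ind1 // ?mulr1n ?mulr0n ?subrr ?subr0.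
have indT (p : 'I_D) : \sum_s (p == s)%:R = 1 :> R.
  by rewrite (bigD1 p) //= eqxx big1 ?addr0 // => s /negbTE; rewrite eq_sym => ->.
have EQ : N * (N - 1) * a2 = M * Q.
  rewrite -cst.
  have QE (g : 'S_D) : Q = \sum_i \sum_(j | j != i) h (g i) (g j) * h (g i) (g j).
    rewrite /Q (reindex_inj (@perm_inj _ g)); apply: eq_bigr => i _.
    rewrite (reindex_inj (@perm_inj _ g)) (bigD1 i) //= h0 expr0n add0r.
    by apply: eq_bigr => j _; rewrite expr2.
  rewrite (eq_bigr _ (fun g _ => QE g)) exchange_big /=.
  under [RHS]eq_bigr => i _.
    rewrite exchange_big /=.
    under eq_bigr => j ji.
      have ij : i != j by rewrite eq_sym.
      rewrite -/(A i j i j) AE // !eqxx [j == i]eq_sym (negbTE ij).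
      over.
    rewrite sumC1; over.
  rewrite sum1; rewrite ?mulr1n ?mulr0n /=; ring.
have EB : N * (N - 1) * ((N - 2) * a3 + a2) = M * B.
  rewrite -cst.
  have BE (g : 'S_D) : B =
      \sum_i \sum_(j | j != i) \sum_(k | k != i) h (g i) (g j) * h (g i) (g k).
    rewrite /B (reindex_inj (@perm_inj _ g)); apply: eq_bigr => i _.
    rewrite expr2 (reindex_inj (@perm_inj _ g)) (bigD1 i) //= h0 add0r.
    rewrite mulr_suml; apply: eq_bigr => j _.
    by rewrite mulr_sumr.
  rewrite (eq_bigr _ (fun g _ => BE g)) exchange_big /=.
  under [RHS]eq_bigr => i _.
    rewrite exchange_big /=.
    under eq_bigr => j ji.
      rewrite exchange_big /=.
      have ij : i != j by rewrite eq_sym.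
      under eq_bigr => k ki.
        have ik : i != k by rewrite eq_sym.
        rewrite -/(A i j i k) AE // !eqxx (negbTE ji) (negbTE ik).
        over.
      rewrite big_split /= -mulr_sumr /= big_split /= -mulr_sumr !big_split /=.
      rewrite -!mulr_sumr !sumC1 ind1 //.
      over.
    rewrite sumC1; over.
  rewrite sum1; rewrite ?mulr1n ?mulr0n /=; ring.
have EH : N * (N - 1) * (2 * a2 + 4 * (N - 2) * a3 + (N - 2) * (N - 3) * a4)
    = M * H ^+ 2.
  rewrite -cst.
  have HE (g : 'S_D) : H = \sum_i \sum_(j | j != i) h (g i) (g j).
    rewrite /H (reindex_inj (@perm_inj _ g)); apply: eq_bigr => i _.
    rewrite (reindex_inj (@perm_inj _ g)) (bigD1 i) //= h0 add0r.
    by apply: eq_bigr.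
  have HHE (g : 'S_D) : H ^+ 2 = \sum_i \sum_(j | j != i)
     \sum_k \sum_(l | l != k) h (g i) (g j) * h (g k) (g l).
    rewrite expr2 {1}(HE g) mulr_suml; apply: eq_bigr => i _.
    rewrite mulr_suml; apply: eq_bigr => j _.
    rewrite (HE g) mulr_sumr; apply: eq_bigr => k _.
    by rewrite mulr_sumr.
  rewrite (eq_bigr _ (fun g _ => HHE g)) exchange_big /=.
  under [RHS]eq_bigr => i _.
    rewrite exchange_big /=.
    under eq_bigr => j ji.
      rewrite exchange_big /=.
      have ij : i != j by rewrite eq_sym.
      have U : \sum_(k < D) \sum_(g : 'S_D) \sum_(l < D | l != k)
          h (g i) (g j) * h (g k) (g l)
         = 2 * a2 + 4 * (N - 2) * a3 + (N - 2) * (N - 3) * a4.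
        under eq_bigr => k _.
          rewrite exchange_big /=.
          under eq_bigr => l lk.
            have kl : k != l by rewrite eq_sym.
            rewrite -/(A i j k l) AE //.
            over.
          over.
        have inner (k : 'I_D) :
          \sum_(l < D | l != k) (a4 + (a3 - a4) *
             ((i == k)%:R + (i == l)%:R + (j == k)%:R + (j == l)%:R) +
            (a2 - 2 * a3 + a4) * ((i == k)%:R * (j == l)%:R +
             (i == l)%:R * (j == k)%:R)) =
          (N - 1) * a4 + (a3 - a4) * 2 +
            ((a3 - a4) * (N - 2) + (a2 - 2 * a3 + a4)) * ((i == k)%:R + (j == k)%:R).
          rewrite big_split /= big_split /= -!mulr_sumr !big_split /=.
          rewrite -!mulr_sumr -!mulr_suml !indE !sumC1.
          have [ik|ik] := eqVneq i k; have [jk|jk] := eqVneq j k;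
            rewrite ?mulr1n ?mulr0n /=; try ring.
          by rewrite ik jk eqxx in ij.
        under eq_bigr => k _ do rewrite inner.
        rewrite big_split /= sum1 -mulr_sumr big_split /= !indT; ring.
      rewrite U; over.
    rewrite sumC1; over.
  rewrite sum1; rewrite ?mulr1n ?mulr0n /=; ring.
(* Among the ordered pairs of edges of a path, [N - 1] coincide, [2 (N - 2)] are neighbours and the
   remaining [(N - 2) (N - 3)] are disjoint. *)
have ES : \sum_(g : 'S_D) S g ^+ 2 =
    (N - 1) * a2 + 2 * (N - 2) * a3 + (N - 2) * (N - 3) * a4.
  pose w (k : 'I_d.+1) : 'I_D := widen_ord (leqnSn _) k.
  pose l (k : 'I_d.+1) : 'I_D := lift ord0 k.
  have SE (g : 'S_D) : S g ^+ 2 =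
      \sum_k \sum_k' h (g (w k)) (g (l k)) * h (g (w k')) (g (l k')).
    rewrite /S consecutive_sumE expr2 mulr_suml; apply: eq_bigr => k _.
    by rewrite mulr_sumr.
  rewrite (eq_bigr _ (fun g _ => SE g)) exchange_big /=.
  have wl k : w k != l k.
    by rewrite -val_eqE /= /bump leq0n add1n neq_ltn ltnSn.
  under eq_bigr => k _.
    rewrite exchange_big /=.
    under eq_bigr => k' _.
      rewrite -/(A (w k) (l k) (w k') (l k')) AE //.
      have -> : (w k == w k') = (k == k') by rewrite -!val_eqE.
      have -> : (l k == l k') = (k == k') by rewrite (inj_eq lift_inj).
      have -> : (w k == l k') = (k == k'.+1 :> nat) by rewrite -!val_eqE.
      have -> : (l k == w k') = (k.+1 == k' :> nat) by rewrite -!val_eqE.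
      have -> : (k == k')%:R * (k == k')%:R +
         (k == k'.+1 :> nat)%:R * (k.+1 == k' :> nat)%:R = (k == k')%:R :> R.
        have [->|_] := eqVneq k k'; first by rewrite ltn_eqF //= mul0r addr0 mulr1.
        rewrite /= mul0r add0r; case: eqP => [->|_]; last by rewrite /= mul0r.
        by rewrite gtn_eqF /= ?mulr0 // leqnSn.
      over.
    over.
  have sumd (c : R) : \sum_(s : 'I_d.+1) c = (N - 1) * c.
    by rewrite sumr_const card_ord -mulr_natl DE.
  have i1 (k : 'I_d.+1) : \sum_(k' < d.+1) (k == k')%:R = 1 :> R.
    by rewrite (bigD1 k) //= eqxx big1 ?addr0 // => s /negbTE; rewrite eq_sym => ->.
  have i2 : \sum_(k < d.+1) \sum_(k' < d.+1) (k.+1 == k' :> nat)%:R = N - 2 :> R.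
    rewrite big_ord_recr /= [X in _ + X]big1 ?addr0 => [|k' _]; last first.
      by rewrite gtn_eqF // ltn_ord.
    under eq_bigr => k _.
      rewrite (bigD1 (lift ord0 k)) //= /bump leq0n add1n eqxx big1 ?addr0; last first.
        by move=> k' /negbTE; rewrite -val_eqE /= /bump leq0n add1n eq_sym => ->.
      over.
    by rewrite sumr_const card_ord /N -[D]addn2 natrD addrK.
  have i3 : \sum_(k < d.+1) \sum_(k' < d.+1) (k == k'.+1 :> nat)%:R = N - 2 :> R.
    by rewrite exchange_big /= -i2; do 2!apply: eq_bigr => ? _; rewrite eq_sym.
  under eq_bigr => k _ do
    rewrite 2!big_split /= -!mulr_sumr !big_split /= !i1 sumd.
  rewrite !big_split /= -!mulr_sumr !big_split /= i2 i3 !sumd; rewrite ?mulr1n ?mulr0n /=; ring.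
have -> : M * (Q / N + (H ^+ 2 - 2 * B) / (N * (N - 1))) =
  (M * Q) / N + (M * H ^+ 2 - 2 * (M * B)) / (N * (N - 1)) by ring.
clearbody N; by rewrite ES -EQ -EH -EB; field; rewrite D0 D1.
Qed.

End EdgeMoments.

(** * Power sums and sums of distances *)

Section PowerSums.
Variable R : realFieldType.

Lemma sum_ord_pow1 m : \sum_(j < m) (j%:R : R) = m%:R * (m%:R - 1) / 2.
Proof.
elim: m => [|m IH]; first by rewrite big_ord0; ring.
by rewrite big_ord_recr /= IH -natr1; field.
Qed.

Lemma sum_ord_pow2 m :
  \sum_(j < m) (j%:R ^+ 2 : R) = m%:R * (m%:R - 1) * (2 * m%:R - 1) / 6.
Proof.
elim: m => [|m IH]; first by rewrite big_ord0; ring.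
by rewrite big_ord_recr /= IH -natr1; field.
Qed.

Lemma sum_ord_pow3 m :
  \sum_(j < m) (j%:R ^+ 3 : R) = (m%:R * (m%:R - 1)) ^+ 2 / 4.
Proof.
elim: m => [|m IH]; first by rewrite big_ord0; ring.
by rewrite big_ord_recr /= IH -natr1; field.
Qed.

Lemma sum_ord_pow4 m : \sum_(j < m) (j%:R ^+ 4 : R) =
  m%:R * (m%:R - 1) * (2 * m%:R - 1) * (3 * m%:R ^+ 2 - 3 * m%:R - 1) / 30.
Proof.
elim: m => [|m IH]; first by rewrite big_ord0; ring.
by rewrite big_ord_recr /= IH -natr1; field.
Qed.

(** A common normal form: the polynomial sums below are rewritten as quartics in [j], with zero
    coefficients where needed, so that one evaluation serves for all. *)
Lemma sum_ord_quartic m (a b c e f : R) :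
  \sum_(j < m) (a + b * j%:R + c * j%:R ^+ 2 + e * j%:R ^+ 3 + f * j%:R ^+ 4) =
  a * m%:R + b * (m%:R * (m%:R - 1) / 2)
  + c * (m%:R * (m%:R - 1) * (2 * m%:R - 1) / 6)
  + e * ((m%:R * (m%:R - 1)) ^+ 2 / 4)
  + f * (m%:R * (m%:R - 1) * (2 * m%:R - 1) * (3 * m%:R ^+ 2 - 3 * m%:R - 1) / 30).
Proof.
rewrite !big_split /= -!mulr_sumr sum_ord_pow1 sum_ord_pow2 sum_ord_pow3.
by rewrite sum_ord_pow4 sumr_const card_ord [a * m%:R]mulr_natr.
Qed.

Definition distR (i j : nat) : R := `|i%:R - j%:R|.

Lemma distRE i j : (i <= j)%N -> distR i j = j%:R - i%:R.
Proof. by move=> ij; rewrite /distR distrC ger0_norm // subr_ge0 ler_nat. Qed.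

Lemma distRC i j : distR i j = distR j i.
Proof. exact: distrC. Qed.

Lemma sum_distR m (i : nat) : (i < m)%N -> \sum_(k < m) distR i k =
  i%:R ^+ 2 - (m%:R - 1) * i%:R + m%:R * (m%:R - 1) / 2.
Proof.
elim: m => // m IH; rewrite ltnS leq_eqVlt big_ord_recr /= => /orP[/eqP->|im].
  rewrite distRE // subrr addr0 (eq_bigr (fun k : 'I_m => m%:R + (- 1) * k%:R
      + 0 * k%:R ^+ 2 + 0 * k%:R ^+ 3 + 0 * k%:R ^+ 4 : R)); last first.
    by move=> k _; rewrite distRC distRE ?(ltnW (ltn_ord k)) //; ring.
  by rewrite sum_ord_quartic -natr1; field.
by rewrite IH // distRE ?(ltnW im) // -natr1; field.
Qed.

Lemma sum2_distR m :
  \sum_(i < m) \sum_(j < m) distR i j = m%:R * (m%:R ^+ 2 - 1) / 3.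
Proof.
under eq_bigr => i _ do rewrite (sum_distR (ltn_ord i)).
rewrite (eq_bigr (fun i : 'I_m => m%:R * (m%:R - 1) / 2 + (- (m%:R - 1)) * i%:R
   + 1 * i%:R ^+ 2 + 0 * i%:R ^+ 3 + 0 * i%:R ^+ 4 : R)); last first.
  by move=> i _; ring.
by rewrite sum_ord_quartic; field.
Qed.

Lemma sum2_distR2 m :
  \sum_(i < m) \sum_(j < m) distR i j ^+ 2 = m%:R ^+ 2 * (m%:R ^+ 2 - 1) / 6.
Proof.
have E (i : 'I_m) : \sum_(j < m) distR i j ^+ 2 =
   m%:R * (m%:R - 1) * (2 * m%:R - 1) / 6 + (- (m%:R * (m%:R - 1))) * i%:R
   + m%:R * i%:R ^+ 2 + 0 * i%:R ^+ 3 + 0 * i%:R ^+ 4.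
  rewrite (eq_bigr (fun j : 'I_m => i%:R ^+ 2 + (- 2 * i%:R) * j%:R
   + 1 * j%:R ^+ 2 + 0 * j%:R ^+ 3 + 0 * j%:R ^+ 4 : R)); last first.
    by move=> j _; rewrite /distR real_normK ?num_real //; ring.
  by rewrite sum_ord_quartic; field.
by rewrite (eq_bigr _ (fun i _ => E i)) sum_ord_quartic; field.
Qed.

Lemma sum_sum_distR_sqr m : \sum_(i < m) (\sum_(j < m) distR i j) ^+ 2 =
  m%:R * (m%:R ^+ 2 - 1) * (7 * m%:R ^+ 2 - 8) / 60.
Proof.
under eq_bigr => i _ do rewrite (sum_distR (ltn_ord i)).
rewrite (eq_bigr (fun i : 'I_m => (m%:R * (m%:R - 1) / 2) ^+ 2
   + (- (m%:R * (m%:R - 1) ^+ 2)) * i%:R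
   + ((m%:R - 1) ^+ 2 + m%:R * (m%:R - 1)) * i%:R ^+ 2
   + (- 2 * (m%:R - 1)) * i%:R ^+ 3 + 1 * i%:R ^+ 4 : R)); last first.
  by move=> i _; field.
by rewrite sum_ord_quartic; field.
Qed.

(** The weight [2 j (m - j)] counts the ordered pairs of positions separated by the gap before
    position [j], hence the same total as in [sum2_distR]. *)
Lemma sum_straddle m :
  \sum_(j < m) (2 * j%:R * (m%:R - j%:R) : R) = m%:R * (m%:R ^+ 2 - 1) / 3.
Proof.
rewrite (eq_bigr (fun i : 'I_m => 0 + (2 * m%:R) * i%:R + (- 2) * i%:R ^+ 2
   + 0 * i%:R ^+ 3 + 0 * i%:R ^+ 4 : R)); last by move=> i _; ring.
by rewrite sum_ord_quartic; field.
Qed.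

Lemma sum_straddle_sqr m : \sum_(j < m) ((2 * j%:R * (m%:R - j%:R)) ^+ 2 : R) =
  2 * m%:R * (m%:R ^+ 4 - 1) / 15.
Proof.
rewrite (eq_bigr (fun i : 'I_m => 0 + 0 * i%:R + (4 * m%:R ^+ 2) * i%:R ^+ 2
   + (- 8 * m%:R) * i%:R ^+ 3 + 4 * i%:R ^+ 4 : R)); last by move=> i _; ring.
by rewrite sum_ord_quartic; field.
Qed.

End PowerSums.

(** * Second moments of permuted block sizes *)

Section BlockMoments.
Variables (R : realFieldType) (d : nat).
Notation D := d.+2.
Variable x : 'I_D -> R.

Let n1 := \sum_k x k.
Let q2 := \sum_k x k ^+ 2.

(** Entries in random order are exchangeable, so their second moments take two values, [z] off the
    diagonal and [z + u] on it. The sign of [u] comes from the mean square of the difference of two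
    entries; it later permits a term to be dropped. *)
Lemma sum_perm_products : exists z u : R, [/\ 0 <= u,
  forall j j', \sum_(t : 'S_D) x (t j) * x (t j') = D`!%:R * (z + u * (j == j')%:R),
  z = (n1 ^+ 2 - q2) / (D%:R * (D%:R - 1)) &
  u = (q2 * D%:R - n1 ^+ 2) / (D%:R * (D%:R - 1))].
Proof.
have [a1 E1] := sum_perm_const 1 (fun l : seq 'I_D =>
  if l is [:: p] then x p * x p else 0 : R).
have [a2 E2] := sum_perm_const 2 (fun l : seq 'I_D =>
  if l is [:: p; q] then x p * x q else 0 : R).
have {}E1 j : \sum_(t : 'S_D) x (t j) * x (t j) = a1.
  by rewrite -(E1 [:: j]).
have {}E2 j j' : j != j' -> \sum_(t : 'S_D) x (t j) * x (t j') = a2.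
  by move=> jj; rewrite -(E2 [:: j; j']) //= mem_seq1 jj.
pose M : R := D`!%:R.
have M0 : 0 < M by rewrite ltr0n fact_gt0.
have cst (c : R) : \sum_(g : 'S_D) c = M * c by exact: sum_perm_cst.
have EQ : D%:R * a1 = M * q2.
  rewrite -cst.
  have QE (t : 'S_D) : q2 = \sum_j x (t j) * x (t j).
    by rewrite /q2 (reindex_inj (@perm_inj _ t)).
  rewrite (eq_bigr _ (fun t _ => QE t)) exchange_big /=.
  by rewrite (eq_bigr _ (fun j _ => E1 j)) sumr_const card_ord mulr_natl.
have EN : D%:R * (a1 + (D%:R - 1) * a2) = M * n1 ^+ 2.
  rewrite -cst.
  have NE (t : 'S_D) : n1 ^+ 2 = \sum_j \sum_j' x (t j) * x (t j').
    rewrite expr2 {1}/n1 (reindex_inj (@perm_inj _ t)) mulr_suml.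
    apply: eq_bigr => j _.
    by rewrite /n1 (reindex_inj (@perm_inj _ t)) mulr_sumr.
  rewrite (eq_bigr _ (fun t _ => NE t)) exchange_big /=.
  under [RHS]eq_bigr => j _.
    rewrite exchange_big /= (bigD1 j) //= E1.
    under eq_bigr => j' jj do rewrite E2 1?eq_sym //.
    rewrite sumr_const cardC1 card_ord /= -[a2 *+ _]mulr_natl.
    over.
  by rewrite sumr_const card_ord -[RHS]mulr_natl -[D%:R]natr1 addrK.
have a12 : a2 <= a1.
  have p0 : (0 : 'I_D) != 1 by [].
  have : 0 <= \sum_(t : 'S_D) (x (t 0) - x (t 1)) ^+ 2.
    by apply: sumr_ge0 => t _; exact: sqr_ge0.
  under eq_bigr => t _.
    rewrite (_ : _ ^+ 2 = x (t 0) * x (t 0) + x (t 1) * x (t 1)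
       + (- 2) * (x (t 0) * x (t 1))); last by ring.
    over.
  rewrite !big_split /= -mulr_sumr !E1 E2 //; lra.
have D0 : (D%:R : R) != 0 by rewrite pnatr_eq0.
have D1 : (D%:R - 1 : R) != 0 by rewrite -natr1 addrK pnatr_eq0.
exists (a2 / M), ((a1 - a2) / M); split.
- by rewrite divr_ge0 ?subr_ge0 // ltW.
- move=> j j'; rewrite -/M; have [<-|jj] := eqVneq j j'.
    by rewrite E1 /=; field; rewrite gt_eqF.
  by rewrite E2 //=; field; rewrite gt_eqF.
- move: D%:R EQ EN D0 D1 => N EQ EN N0 N1.
  rewrite (_ : n1 ^+ 2 = N * (a1 + (N - 1) * a2) / M); last first.
    by rewrite EN; field; rewrite gt_eqF.
  rewrite (_ : q2 = N * a1 / M); last by rewrite EQ; field; rewrite gt_eqF.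
  by field; rewrite N0 N1 gt_eqF.
move: D%:R EQ EN D0 D1 => N EQ EN N0 N1.
rewrite (_ : n1 ^+ 2 = N * (a1 + (N - 1) * a2) / M); last first.
  by rewrite EN; field; rewrite gt_eqF.
rewrite (_ : q2 = N * a1 / M); last by rewrite EQ; field; rewrite gt_eqF.
by field; rewrite N0 N1 gt_eqF.
Qed.

End BlockMoments.

(** * Rank variation of randomly arranged blocks *)

Section BlockVariation.
Variable R : realFieldType.

Definition csum m (y : 'I_m -> R) (k : 'I_m) : R := \sum_(j < m | (j <= k)%N) y j.

(** The rank variation of tied data: [x k] is the size of block [k], [t] lists the blocks by
    increasing Y, and [a] sends a position in the X order to one in the Y order. The cumulative sum
    is the common [lrank] of a block. *)
Definition block_variation m (x : 'I_m -> R) (t a : 'S_m) : R :=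
  consecutive_sum (fun i j => `|csum (x \o t) (a j) - csum (x \o t) (a i)|).

(** Tells whether the block at [j] counts in the difference of the cumulative sums at [k] and [l].
    It makes distances of ranks linear in the block sizes. *)
Definition between (j k l : nat) : bool := (k < j <= l)%N || (l < j <= k)%N.

Lemma betweenE j k l :
  (between j k l)%:R = (k < j)%:R * (j <= l)%:R + (l < j)%:R * (j <= k)%:R :> R.
Proof.
rewrite /between; case: (ltnP k j) => kj; case: (ltnP l j) => lj;
  by rewrite ?andbF ?orbF /= ?mul0r ?mul1r ?addr0 ?add0r ?kj ?lj //.
Qed.

Lemma csum_dist m (y : 'I_m -> R) k l : (forall j, 0 <= y j) ->
  `|csum y k - csum y l| = \sum_j y j * (between j k l)%:R.
Proof.
move=> y0; wlog kl : k l / (k <= l)%N.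
  move=> W; case: (leqP k l) => [|/ltnW] kl; first exact: W.
  rewrite distrC W //; apply: eq_bigr => j _; congr (_ * _%:R).
  by rewrite /between orbC.
have -> : csum y k - csum y l = - \sum_j y j * (between j k l)%:R.
  rewrite /csum big_mkcond [in X in _ - X]big_mkcond /= -sumrB -sumrN.
  apply: eq_bigr => j _; rewrite betweenE.
  case: (leqP j k) => jk; case: (leqP j l) => jl; rewrite /=; try ring.
  by have := leq_ltn_trans (leq_trans jk kl) jl; rewrite ltnn.
by rewrite normrN ger0_norm // sumr_ge0 // => j _; rewrite mulr_ge0 ?ler0n.
Qed.

Lemma sum_ord_ltn m (j : nat) : (j <= m)%N -> \sum_(k < m) (k < j)%:R = j%:R :> R.
Proof.
move=> jm; transitivity (\sum_(k < m | (k < j)%N) (1 : R)).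
  by rewrite [RHS]big_mkcond; apply: eq_bigr => k _; case: ltnP.
by rewrite (big_ord_narrow jm) sumr_const card_ord.
Qed.

Lemma sum_ord_geq m (j : nat) : (j <= m)%N ->
  \sum_(k < m) (j <= k)%:R = m%:R - j%:R :> R.
Proof.
move=> jm; rewrite -[X in _ = _ - X](sum_ord_ltn jm).
have -> : m%:R = \sum_(k < m) 1 :> R by rewrite sumr_const card_ord.
rewrite -sumrB; apply: eq_bigr => k _; rewrite leqNgt.
by case: (_ < _)%N => /=; ring.
Qed.

Lemma sum_between_pairs m (j : nat) : (j <= m)%N ->
  \sum_(k < m) \sum_(l < m) (between j k l)%:R = 2 * j%:R * (m%:R - j%:R) :> R.
Proof.
move=> jm.
have E (k : 'I_m) : \sum_(l < m) (between j k l)%:R =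
    (k < j)%:R * (m%:R - j%:R) + (j <= k)%:R * j%:R :> R.
  under eq_bigr => l _ do rewrite betweenE.
  rewrite big_split /= -mulr_sumr -mulr_suml sum_ord_geq // sum_ord_ltn //; ring.
rewrite (eq_bigr _ (fun k _ => E k)) big_split /= -!mulr_suml.
rewrite sum_ord_geq // sum_ord_ltn //; ring.
Qed.

Lemma sum_between m (k l : 'I_m) :
  \sum_(j < m) (between j k l)%:R = distR R k l :> R.
Proof.
have c1 (i : 'I_m) : csum (fun=> 1) i = i.+1%:R.
  rewrite /csum -(@sum_ord_ltn m i.+1) // big_mkcond /=.
  by apply: eq_bigr => j _; rewrite ltnS; case: leqP.
(* Unit sizes turn [csum_dist] into a count, the cumulative sum at [i] being [i + 1]. *)
have := @csum_dist m (fun=> 1) k l (fun=> ler01).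
rewrite !c1 /distR -!natr1 => E; rewrite -(eq_bigr _ (fun j _ => mul1r _)) -E.
by congr `|_|; ring.
Qed.

End BlockVariation.

Section BlockVariationMoments.
Variable R : realFieldType.

Lemma sum_perm_entry m (x : 'I_m -> R) j :
  m%:R * \sum_(t : 'S_m) x (t j) = m`!%:R * \sum_k x k.
Proof.
have [a E] := sum_perm_const 1 (fun l : seq 'I_m =>
  if l is [:: p] then x p else 0 : R).
have {}E i : \sum_(t : 'S_m) x (t i) = a by rewrite -(E [:: i]).
rewrite -sum_perm_cst E mulr_natl -[X in a *+ X](card_ord m) -sumr_const.
rewrite -(eq_bigr _ (fun i _ => E i)) exchange_big; apply: eq_bigr => t _ /=.
by rewrite [RHS](reindex_inj (@perm_inj _ t)).
Qed.

Lemma sum_perm_bilinear m (x c e : 'I_m -> R) (M z u : R) :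
  (forall j j', \sum_(t : 'S_m) x (t j) * x (t j') = M * (z + u * (j == j')%:R)) ->
  \sum_(t : 'S_m) (\sum_j x (t j) * c j) * (\sum_j x (t j) * e j) =
  M * (z * ((\sum_j c j) * (\sum_j e j)) + u * \sum_j c j * e j).
Proof.
move=> P.
transitivity (\sum_j \sum_j' (M * (z + u * (j == j')%:R)) * (c j * e j')).
  rewrite (eq_bigr (fun t : 'S_m => \sum_j \sum_j'
     x (t j) * x (t j') * (c j * e j'))); last first.
    move=> t _; rewrite mulr_suml; apply: eq_bigr => j _.
    by rewrite mulr_sumr; apply: eq_bigr => j' _; ring.
  rewrite exchange_big; apply: eq_bigr => j _.
  rewrite exchange_big; apply: eq_bigr => j' _.
  by rewrite -mulr_suml P.
rewrite (_ : (\sum_j c j) * _ = \sum_j \sum_j' c j * e j'); last first.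
  by rewrite mulr_suml; apply: eq_bigr => j _; rewrite mulr_sumr.
rewrite !mulr_sumr -big_split mulr_sumr; apply: eq_bigr => j _ /=.
rewrite (bigD1 j) //= [X in z * X](bigD1 j) //= eqxx mulr1.
rewrite [X in _ + X](eq_bigr (fun j' => M * (z * (c j * e j')))); last first.
  by move=> j' /negbTE; rewrite eq_sym => -> /=; ring.
by rewrite -!mulr_sumr /=; ring.
Qed.

(** The left side bounds the variance of the block variation. The part [(n^2 N + N^2 q) / 45] is
    sharp: for [N] blocks of size one it is [2 N^3 / 45], which the factors [9 / N^4] and [N] turn
    into the classical [2/5]. The term [2 N q] absorbs what is of lower order. *)
Lemma block_moment_coefficients (N n q u z : R) : 2 <= N -> 0 <= q ->
  z = (n ^+ 2 - q) / (N * (N - 1)) -> u = (q * N - n ^+ 2) / (N * (N - 1)) ->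
  (z * (N ^+ 2 * (N ^+ 2 - 1) / 6) + u * (N * (N ^+ 2 - 1) / 3)) / N
  + (z * (N * (N ^+ 2 - 1) / 3) ^+ 2 + u * (2 * N * (N ^+ 4 - 1) / 15)
     - 2 * (z * (N * (N ^+ 2 - 1) * (7 * N ^+ 2 - 8) / 60))) / (N * (N - 1))
  - (n * (N ^+ 2 - 1) / (3 * N)) ^+ 2
  <= (n ^+ 2 * N + N ^+ 2 * q) / 45 + 2 * N * q.
Proof.
move=> N2 q0 -> ->.
have N0 : 0 < N by lra.
have N1 : 0 < N - 1 by lra.
rewrite -subr_ge0.
set E := (X in 0 <= X).
(* [K1] and [K2] are the coefficients of [n^2] and [q] in the difference of the two sides over a
   common denominator. In [m = N - 2] all their coefficients are positive. *)
pose K1 := 17 / 30 * N ^+ 3 + 11 / 30 * N ^+ 2 - 16 / 45 * N - 1 / 9.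
pose K2 := (14 / 9 * N ^+ 4 - 223 / 90 * N ^+ 3 + 17 / 90 * N ^+ 2 + 4 / 15 * N).
have -> : E = (n ^+ 2 * K1 + q * K2) / (N ^+ 2 * (N - 1)).
  by rewrite /E /K1 /K2; field; rewrite !gt_eqF.
apply: divr_ge0; last by rewrite mulr_ge0 ?exprn_ge0 // ltW.
have K10 : 0 <= K1.
  rewrite /K1; have [m [m0 ->]] : exists m, 0 <= m /\ N = m + 2 by exists (N - 2); split; lra.
  rewrite (_ : _ - _ = 17 / 30 * m ^+ 3 + 113 / 30 * m ^+ 2 + 356 / 45 * m + 233 / 45); last by field.
  have m2 := exprn_ge0 2 m0; have m3 := exprn_ge0 3 m0; lra.
have K20 : 0 <= K2.
  rewrite /K2; have [m [m0 ->]] : exists m, 0 <= m /\ N = m + 2 by exists (N - 2); split; lra.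
  rewrite (_ : _ + _ = 14 / 9 * m ^+ 4 + 299 / 30 * m ^+ 3 + 2039 / 90 * m ^+ 2 + 316 / 15 * m + 286 / 45); last by field.
  have m2 := exprn_ge0 2 m0; have m3 := exprn_ge0 3 m0; have m4 := exprn_ge0 4 m0; lra.
by apply: addr_ge0; apply: mulr_ge0 => //; exact: sqr_ge0.
Qed.

(** Variance plus squared bias about an arbitrary centre. The sum over [a] is a path sum, settled by
    [sum_perm_S] and [sum_perm_S2]; there [H] is linear and [Q], [B] are quadratic in the permuted
    sizes, so the sum over [t] needs only [sum_perm_products]. *)
Lemma block_variation_sqdev m (x : 'I_m -> R) (kappa : R) :
  (forall k, 0 <= x k) ->
  \sum_(t : 'S_m) \sum_(a : 'S_m) (block_variation x t a - kappa) ^+ 2 <=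
  m`!%:R ^+ 2 *
  (((\sum_k x k) ^+ 2 * m%:R + m%:R ^+ 2 * \sum_k x k ^+ 2) / 45
   + 2 * m%:R * (\sum_k x k ^+ 2)
   + ((\sum_k x k) * (m%:R ^+ 2 - 1) / (3 * m%:R) - kappa) ^+ 2).
Proof.
move=> x0; set n1 := \sum_k x k; set q2 := \sum_k x k ^+ 2.
have q20 : 0 <= q2 by apply: sumr_ge0 => k _; exact: sqr_ge0.
case: m => [|[|d]] in x x0 n1 q2 q20 *.
- rewrite (eq_bigr (fun=> \sum_(a : 'S_0) kappa ^+ 2)) => [|t _]; last first.
    apply: eq_bigr => a _.
    by rewrite /block_variation /consecutive_sum big_ord0 sub0r sqrrN.
  rewrite !sum_perm_cst fact0 !mulr0 invr0 !mulr0 expr0n expr1n /= !mul1r.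
  by rewrite !mul0r !addr0 mul0r !add0r sqrrN.
- rewrite (eq_bigr (fun=> \sum_(a : 'S_1) kappa ^+ 2)) => [|t _]; last first.
    apply: eq_bigr => a _; rewrite /block_variation /consecutive_sum big_ord1 big1 ?sub0r ?sqrrN //.
    by move=> j; rewrite [j]ord1.
  rewrite !sum_perm_cst factS fact0 !mul1r expr1n subrr mulr0 mul0r sub0r sqrrN.
  rewrite !mul1r mulr1 lerDr.
  have := sqr_ge0 n1; lra.
have [z [u [u0 P zE uE]]] := sum_perm_products x.
rewrite -/n1 -/q2 in zE uE.
pose M : R := d.+2`!%:R; rewrite -/M.
have cst (c : R) : \sum_(g : 'S_d.+2) c = M * c by exact: sum_perm_cst.
have M0 : 0 < M by rewrite ltr0n fact_gt0.
pose N : R := d.+2%:R; rewrite -/N in zE uE *.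
have N2 : 2 <= N by rewrite ler_nat.
pose h (t : 'S_d.+2) k l : R := `|csum (x \o t) k - csum (x \o t) l|.
have hE t k l : h t k l = \sum_j x (t j) * (between j k l)%:R.
  by rewrite /h csum_dist // => j; exact: x0.
pose H t : R := \sum_i \sum_j h t i j.
pose Q t : R := \sum_i \sum_j h t i j ^+ 2.
pose B t : R := \sum_i (\sum_j h t i j) ^+ 2.
have HE t : H t = \sum_j x (t j) * (2 * j%:R * (N - j%:R)).
  rewrite /H (eq_bigr (fun i : 'I_d.+2 => \sum_(j < d.+2) \sum_(l < d.+2)
     x (t j) * (between j i l)%:R)).
    rewrite exchange_big; apply: eq_bigr => j _ /=.
    rewrite -(@sum_between_pairs R d.+2 j (ltnW (ltn_ord j))) mulr_sumr.
    by apply: eq_bigr => i _; rewrite mulr_sumr.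
  move=> i _; rewrite exchange_big; apply: eq_bigr => l _.
  exact: hE.
have inner t : \sum_(a : 'S_d.+2) (block_variation x t a - kappa) ^+ 2 =
    M * (Q t / N + (H t ^+ 2 - 2 * B t) / (N * (N - 1)) - 2 * kappa * (H t / N)
         + kappa ^+ 2).
  have hC i j : h t i j = h t j i by exact: distrC.
  have h0 i : h t i i = 0 by rewrite /h subrr normr0.
  have bvE a : block_variation x t a = consecutive_sum (fun i j => h t (a i) (a j)).
    by do 2!apply: eq_bigr => ? _; exact: distrC.
  have S1 := sum_perm_S h0; have S2 := sum_perm_S2 hC h0.
  rewrite (eq_bigr (fun a : 'S_d.+2 =>
    consecutive_sum (fun i j => h t (a i) (a j)) ^+ 2
    + ((- 2 * kappa) * consecutive_sum (fun i j => h t (a i) (a j))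
    + kappa ^+ 2))); last by move=> a _; rewrite bvE; ring.
  rewrite big_split big_split /= -mulr_sumr S1 S2 cst -/M -/N -/(H t) -/(Q t) -/(B t).
  by ring.
rewrite (eq_bigr _ (fun t _ => inner t)) -mulr_sumr.
have EH : \sum_(t : 'S_d.+2) H t = M * (n1 * (N ^+ 2 - 1) / 3).
  rewrite (eq_bigr _ (fun t _ => HE t)) exchange_big /=.
  have N0 : N != 0 by rewrite gt_eqF // (lt_le_trans _ N2) // ltr0n.
  rewrite (eq_bigr (fun j : 'I_d.+2 => (M * n1 / N) * (2 * j%:R * (N - j%:R)))).
    by rewrite -mulr_sumr sum_straddle -/N; clearbody N; field.
  move=> j _; rewrite -mulr_suml; congr (_ * _).
  by apply: (mulfI N0); rewrite sum_perm_entry -/n1 -/M; clearbody N; field.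
have EH2 : \sum_(t : 'S_d.+2) H t ^+ 2 =
    M * (z * (N * (N ^+ 2 - 1) / 3) ^+ 2 + u * (2 * N * (N ^+ 4 - 1) / 15)).
  under eq_bigr => t _ do rewrite HE expr2.
  rewrite (sum_perm_bilinear _ _ P) -expr2 sum_straddle -/N.
  by rewrite (eq_bigr _ (fun j _ => esym (expr2 _))) sum_straddle_sqr.
have EQ : \sum_(t : 'S_d.+2) Q t =
    M * (z * (N ^+ 2 * (N ^+ 2 - 1) / 6) + u * (N * (N ^+ 2 - 1) / 3)).
  rewrite exchange_big -(sum2_distR2 R d.+2) -(sum2_distR R d.+2) !mulr_sumr.
  rewrite -big_split mulr_sumr; apply: eq_bigr => k _.
  rewrite exchange_big !mulr_sumr -big_split mulr_sumr; apply: eq_bigr => l _ /=.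
  under eq_bigr => t _ do rewrite hE expr2.
  rewrite (sum_perm_bilinear _ _ P) -expr2 sum_between; congr (_ * (_ + _ * _)).
  rewrite -sum_between; apply: eq_bigr => j _.
  by rewrite -natrM mulnb andbb.
(* [B] enters with a minus sign, so a lower bound is enough and the nonnegative part carrying [u] is
   discarded. *)
have EB : M * (z * (N * (N ^+ 2 - 1) * (7 * N ^+ 2 - 8) / 60))
    <= \sum_(t : 'S_d.+2) B t.
  rewrite exchange_big -(sum_sum_distR_sqr R d.+2) !mulr_sumr ler_sum // => i _ /=.
  rewrite (eq_bigr (fun t : 'S_d.+2 =>
    (\sum_(j < d.+2) x (t j) * \sum_(k < d.+2) (between j i k)%:R) *
    (\sum_(j < d.+2) x (t j) * \sum_(k < d.+2) (between j i k)%:R))); last first.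
    move=> t _; rewrite -expr2; congr (_ ^+ 2).
    rewrite (eq_bigr _ (fun k _ => hE t i k)) exchange_big.
    by apply: eq_bigr => j _; rewrite mulr_sumr.
  rewrite (sum_perm_bilinear _ _ P) -expr2 ler_pM2l // exchange_big /=.
  rewrite (eq_bigr _ (fun k _ => sum_between R i k)) lerDl mulr_ge0 // sumr_ge0 // => j _.
  by rewrite -expr2 sqr_ge0.
rewrite expr2 -[M * M * _]mulrA ler_pM2l // !big_split /= -mulr_suml.
rewrite EQ -!mulr_suml sumrB sumrN -!mulr_sumr -!mulr_suml EH EH2 cst.
set BB := \sum_t B t in EB *.
have := block_moment_coefficients N2 q20 zE uE.
move: EB; clearbody BB N M.
set b := z * (N * _ * _ / 60); move=> EB C.
have N1 : 0 < N * (N - 1) by rewrite mulr_gt0; lra.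
have EB' : (M * b - BB) / (N * (N - 1)) <= 0 by rewrite pmulr_lle0 ?invr_gt0 // subr_le0.
have C' := ler_wpM2l (ltW M0) C.
have C2 := lerD (lerD C' EB') (lerD EB' (lexx (M * (n1 * (N ^+ 2 - 1) / (3 * N) - kappa) ^+ 2))).
apply: (le_trans _ (le_trans C2 _)); last by rewrite le_eqVlt; apply/orP; left; apply/eqP; ring.
rewrite le_eqVlt; apply/orP; left; apply/eqP.
by field; rewrite !gt_eqF //; lra.
Qed.

End BlockVariationMoments.

(** * Occupancy moments of uniform draws *)

Section UniformDraws.
Variables (R : realFieldType) (n : nat).
Local Notation draws := {ffun 'I_n -> 'I_n}.
Implicit Types s : draws.

Definition multiplicity s (i : 'I_n) : nat := \sum_(a < n) (s a == i).
Definition missed s : nat := \sum_(i < n) (multiplicity s i == 0%N).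
Definition sum_sqr_mult s : nat := \sum_(i < n) multiplicity s i ^ 2.

Lemma sum_draws_prod (g : 'I_n -> 'I_n -> R) :
  \sum_(s : draws) \prod_a g a (s a) = \prod_a \sum_j g a j.
Proof. by rewrite bigA_distr_bigA. Qed.

Lemma sum_draws_cst (c : R) : \sum_(s : draws) c = n%:R ^+ n * c.
Proof. by rewrite sumr_const card_ffun card_ord -natrX mulr_natl. Qed.

Lemma multiplicity_eq0 s i :
  (multiplicity s i == 0%N)%:R = \prod_a (s a != i)%:R :> R.
Proof.
rewrite /multiplicity sum_nat_eq0; case: forallP => [h|/forallP].
  by rewrite big1 // => a _; move: (h a); case: (s a == i).
rewrite negb_forall => /existsP[a]; rewrite /= eqb0 negbK => e.
by rewrite (bigD1 a) //= e mul0r.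
Qed.

Lemma sum_draws_missed : \sum_(s : draws) (missed s)%:R = n%:R * (n%:R - 1) ^+ n :> R.
Proof.
under eq_bigr => s _ do rewrite natr_sum.
rewrite exchange_big /= (eq_bigr (fun=> (n%:R - 1) ^+ n)); last first.
  move=> i _; under eq_bigr => s _ do rewrite multiplicity_eq0.
  rewrite (sum_draws_prod (fun a j => (j != i)%:R)) prodr_const card_ord; congr (_ ^+ _).
  rewrite (eq_bigr (fun j => 1 - (j == i)%:R)); last first.
    by move=> j _; case: eqP => _ /=; rewrite ?subrr ?subr0.
  rewrite sumrB sumr_const card_ord; congr (_ - _).
  by rewrite (bigD1 i) //= eqxx big1 ?addr0 // => j /negbTE ->.
by rewrite sumr_const card_ord mulr_natl.
Qed.

Lemma sum_draws_missed2 : \sum_(s : draws) (missed s)%:R ^+ 2 =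
  n%:R * (n%:R - 1) ^+ n + n%:R * (n%:R - 1) * (n%:R - 2) ^+ n :> R.
Proof.
rewrite (eq_bigr (fun s : draws => \sum_i \sum_j
  (multiplicity s i == 0%N)%:R * (multiplicity s j == 0%N)%:R)); last first.
  move=> s _; rewrite expr2 natr_sum mulr_suml; apply: eq_bigr => i _.
  by rewrite mulr_sumr.
rewrite exchange_big -sum_draws_missed.
under [X in _ = X + _]eq_bigr => s _ do rewrite natr_sum.
rewrite [X in _ = X + _]exchange_big /=.
have -> : n%:R * (n%:R - 1) * (n%:R - 2) ^+ n =
   \sum_(i < n) \sum_(j < n | j != i) (n%:R - 2) ^+ n :> R.
  rewrite (eq_bigr (fun=> (n%:R - 1) * (n%:R - 2) ^+ n)).
    by rewrite sumr_const card_ord -mulrA mulr_natl.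
  move=> i _; rewrite sumr_const cardC1 card_ord -[LHS]mulr_natl; congr (_ * _).
  by case: n i => [[]//|m _]; rewrite -natr1 addrK.
rewrite -big_split; apply: eq_bigr => i _ /=.
rewrite exchange_big (bigD1 i) //=; congr (_ + _).
  by apply: eq_bigr => s _; rewrite -natrM mulnb andbb.
apply: eq_bigr => j ji.
under eq_bigr => s _ do rewrite !multiplicity_eq0 -big_split /=.
rewrite (sum_draws_prod (fun a k => (k != i)%:R * (k != j)%:R)) prodr_const card_ord.
congr (_ ^+ _).
rewrite (eq_bigr (fun k => 1 - (k == i)%:R - (k == j)%:R)); last first.
  move=> k _; have [->|ki] := eqVneq k i; first by rewrite eq_sym (negbTE ji) /=; ring.
  by case: eqP => _ /=; ring.
have id1 (u : 'I_n) : \sum_k (k == u)%:R = 1 :> R.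
  by rewrite (bigD1 u) //= eqxx big1 ?addr0 // => k /negbTE ->.
by rewrite !sumrB sumr_const card_ord !id1; ring.
Qed.

(** The sum of squared multiplicities counts ordered pairs of draws with equal outcome: the [n]
    diagonal pairs always agree, the others with frequency [1/n]. *)
Lemma sum_draws_sqr_mult :
  \sum_(s : draws) (sum_sqr_mult s)%:R <= 2 * n%:R * n%:R ^+ n :> R.
Proof.
have [nn0|npos] := posnP n.
  apply: (@le_trans _ _ 0); last by rewrite !mulr_ge0 ?exprn_ge0 ?ler0n.
  apply: sumr_le0 => s _; rewrite /sum_sqr_mult big1 // => i.
  by have := ltn_ord i; rewrite {2}nn0.
have n0 : 0 < n%:R :> R by rewrite ltr0n.
have pair (a b : 'I_n) : \sum_(s : draws) (s a == s b)%:R =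
    (a == b)%:R * n%:R ^+ n + (a != b)%:R * (n%:R ^+ n / n%:R) :> R.
  have [->|ab] := eqVneq a b.
    under eq_bigr => s _ do rewrite eqxx.
    by rewrite sum_draws_cst /=; ring.
  have g1 (i : 'I_n) : \sum_(s : draws) (s a == i)%:R * (s b == i)%:R = n%:R ^+ n / n%:R ^+ 2 :> R.
    have ba : b != a by rewrite eq_sym.
    (* Only the draws [a] and [b] are constrained, so the indicator is a product over the
       coordinates. *)
    pose g (c j : 'I_n) : R := if (c == a) || (c == b) then (j == i)%:R else 1.
    have ga j : g a j = (j == i)%:R by rewrite /g eqxx.
    have gb j : g b j = (j == i)%:R by rewrite /g eqxx orbT.
    have gc c j : (c != a) && (c != b) -> g c j = 1.
      by move=> /andP[ca cb]; rewrite /g (negbTE ca) (negbTE cb).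
    rewrite (eq_bigr (fun s : draws => \prod_c g c (s c))); last first.
      move=> s _; rewrite (bigD1 a) //= (bigD1 b) //= ga gb.
      by rewrite big1 ?mulr1 // => c /gc ->.
    have id1 : \sum_k (k == i)%:R = 1 :> R.
      by rewrite (bigD1 i) //= eqxx big1 ?addr0 // => k /negbTE ->.
    have sa : \sum_j g a j = 1 by rewrite -id1; apply: eq_bigr => j _; exact: ga.
    have sb : \sum_j g b j = 1 by rewrite -id1; apply: eq_bigr => j _; exact: gb.
    rewrite sum_draws_prod (bigD1 a) //= [X in _ * X](bigD1 b) //= sa sb !mul1r.
    rewrite (eq_bigr (fun=> n%:R)); last first.
      move=> c abc; rewrite (eq_bigr (fun=> 1)); last by move=> j _; exact: gc.
      by rewrite sumr_const card_ord.
    rewrite prodr_const.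
    have -> : #|[pred c : 'I_n | (c != a) && (c != b)]| = n.-2.
      have := @cardC 'I_n [pred k | k \in [:: a; b]].
      rewrite card_ord (card_uniqP _) ?/= ?inE ?ab // => {}E.
      rewrite -[X in X.-2]E; apply: eq_card => k; by rewrite !inE negb_or.
    have n2 : (1 < n)%N.
      by clear -ab; case: (n) a b ab => [[]//|[|//]] a b; rewrite !ord1.
    have nE : n = (2 + n.-2)%N by lia.
    rewrite [X in _ = _ ^+ X / _]nE exprD; field.
    by rewrite gt_eqF.
  rewrite (eq_bigr (fun s : {ffun 'I_n -> 'I_n} =>
      \sum_i (s a == i)%:R * (s b == i)%:R)); last first.
    move=> s _; rewrite (bigD1 (s a)) //= eqxx mul1r big1 ?addr0 => [|i].
      by rewrite eq_sym.
    by rewrite eq_sym => /negbTE ->; rewrite mul0r.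
  rewrite exchange_big (eq_bigr _ (fun i _ => g1 i)) sumr_const card_ord -[LHS]mulr_natl /=.
  by field; rewrite gt_eqF.
have -> : \sum_(s : draws) (sum_sqr_mult s)%:R = \sum_a \sum_b \sum_(s : draws) (s a == s b)%:R :> R.
  rewrite [RHS](eq_bigr (fun a => \sum_(s : draws) \sum_b (s a == s b)%:R)); last first.
    by move=> a _; rewrite exchange_big.
  rewrite exchange_big; apply: eq_bigr => s _ /=.
  rewrite natr_sum (eq_bigr (fun i => \sum_a \sum_b (s a == i)%:R * (s b == i)%:R)).
    rewrite exchange_big; apply: eq_bigr => a _ /=.
    rewrite exchange_big; apply: eq_bigr => b _ /=.
    rewrite (bigD1 (s a)) //= eqxx mul1r big1 ?addr0 => [|i].
      by rewrite eq_sym.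
    by rewrite eq_sym => /negbTE ->; rewrite mul0r.
  move=> i _; rewrite natrX /multiplicity natr_sum expr2 mulr_suml.
  by apply: eq_bigr => a _; rewrite mulr_sumr.
have W0 : 0 <= n%:R ^+ n :> R by rewrite exprn_ge0 ?ler0n.
apply: (@le_trans _ _ (\sum_(a < n) \sum_(b < n) ((a == b)%:R * n%:R ^+ n + n%:R ^+ n / n%:R))).
  rewrite ler_sum // => a _; rewrite ler_sum // => b _; rewrite pair lerD2l.
  by rewrite ler_piMl ?divr_ge0 ?ler0n // -[1]/(1%:R) ler_nat leq_b1.
rewrite le_eqVlt; apply/orP; left; apply/eqP.
under eq_bigr => a _.
  rewrite big_split /= -mulr_suml (bigD1 a) //= eqxx big1 => [|b /negbTE]; last first.
    by rewrite eq_sym => ->.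
  rewrite sumr_const card_ord addr0 mul1r -[X in _ + X]mulr_natl.
  over.
rewrite sumr_const card_ord -[LHS]mulr_natl; field.
by rewrite gt_eqF.
Qed.

(** The ratio [k^4 / 2^k] is largest at [k = 6], where it is [20.25]. *)
Lemma leq_pow4_exp2 k : (k ^ 4 <= 21 * 2 ^ k)%N.
Proof.
case: (leqP k 8) => [|k8]; first by do 9!case: k => [//|k].
elim: k k8 => // k IH; rewrite ltnS leq_eqVlt => /orP[/eqP <-//|k8].
have {}IH := IH k8; rewrite (expnS 2).
have : (k.+1 ^ 4 <= 2 * k ^ 4)%N by rewrite !expnS !expn0; nia.
lia.
Qed.

(** Cauchy-Schwarz leads to fourth powers of multiplicities. These are dominated by the exponential
    moment in base 2, which factors over the draws into [(n + 1)^n]. *)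
Lemma sum_draws_sqr_mult2 : \sum_(s : draws) (sum_sqr_mult s)%:R ^+ 2
  <= 21 * n%:R ^+ 2 * (n%:R + 1) ^+ n :> R.
Proof.
have mgf (i : 'I_n) : \sum_(s : draws) 2 ^+ multiplicity s i = (n%:R + 1) ^+ n :> R.
  rewrite (eq_bigr (fun s : {ffun 'I_n -> 'I_n} => \prod_a 2 ^+ (s a == i))).
    rewrite (sum_draws_prod (fun a j => 2 ^+ (j == i))) prodr_const card_ord; congr (_ ^+ _).
    rewrite (eq_bigr (fun j => 1 + (j == i)%:R)); last first.
      by move=> j _; case: eqP => _ /=; rewrite ?expr1 ?expr0; ring.
    rewrite big_split /= sumr_const card_ord; congr (_ + _).
    by rewrite (bigD1 i) //= eqxx big1 ?addr0 // => j /negbTE ->.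
  by move=> s _; rewrite /multiplicity prodrXr.
apply: (@le_trans _ _ (\sum_(s : draws) n%:R * \sum_i (21 * 2 ^+ multiplicity s i))).
  rewrite ler_sum // => s _.
  have cs : (sum_sqr_mult s)%:R ^+ 2 <=
      n%:R * \sum_i (multiplicity s i)%:R ^+ 4 :> R.
    rewrite /sum_sqr_mult natr_sum.
    set f := fun i => (multiplicity s i ^ 2)%:R : R.
    have : 0 <= \sum_i \sum_j (f i - f j) ^+ 2.
      by apply: sumr_ge0 => i _; apply: sumr_ge0 => j _; exact: sqr_ge0.
    rewrite (eq_bigr (fun i => \sum_j (f i ^+ 2 + f j ^+ 2 + (- 2) * (f i * f j)))); last first.
      by move=> i _; apply: eq_bigr => j _; ring.
    rewrite (eq_bigr (fun i => n%:R * f i ^+ 2 + \sum_j f j ^+ 2 + (- 2) * (f i * \sum_j f j))); last first.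
      move=> i _; rewrite !big_split /= sumr_const card_ord -[X in X + _ + _]mulr_natl.
      by rewrite -!mulr_sumr.
    rewrite !big_split /= -!mulr_sumr sumr_const card_ord -mulr_suml -[X in _ + X + _]mulr_natl.
    rewrite [X in n%:R * X](eq_bigr (fun i => (multiplicity s i)%:R ^+ 4)); last first.
      by move=> i _; rewrite /f natrX; ring.
    move: (\sum_i _ ^+ 4) => S4; move: (\sum_i f i) => S2; lra.
  apply: le_trans cs _; rewrite ler_wpM2l ?ler0n // ler_sum // => i _.
  by rewrite -!natrX -natrM ler_nat leq_pow4_exp2.
rewrite -mulr_sumr exchange_big /= (eq_bigr (fun=> 21 * (n%:R + 1) ^+ n)); last first.
  by move=> i _; rewrite -mulr_sumr mgf.
rewrite sumr_const card_ord -[X in _ * X]mulr_natl le_eqVlt; apply/orP; left; apply/eqP; ring.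
Qed.

End UniformDraws.

(** * Averaging the error bound over the draws *)

Section DrawsBound.
Variable R : realFieldType.

Lemma bernoulli_ineq (x : R) k : 0 <= x -> 1 + k%:R * x <= (1 + x) ^+ k.
Proof.
move=> x0; elim: k => [|k IH]; first by rewrite mul0r addr0.
rewrite exprS -natr1; apply: le_trans (ler_wpM2l _ IH); last lra.
have : 0 <= k%:R * x ^+ 2 by rewrite mulr_ge0 ?ler0n ?sqr_ge0.
rewrite mulrDl mulrDr mulr1 mul1r; lra.
Qed.

(** The misses of two observations are negatively correlated, and the gain [n / (n + 1)] is
    indispensable: it supplies half of the [- 2 q^2] in the variance of the number missed. Indeed
    [(n - 2) / n] is the square of [(n - 1) / n] divided by [1 + 1 / (n (n - 2))], and Bernoulli's
    inequality bounds the power of the divisor from below. *)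
Lemma two_missed_ratio n : (3 <= n)%N ->
  (n%:R - 2) ^+ n / n%:R ^+ n <=
  ((n%:R - 1) ^+ n / n%:R ^+ n) ^+ 2 * (n%:R / (n%:R + 1)) :> R.
Proof.
move=> n3; have N3 : 3 <= n%:R :> R by rewrite ler_nat.
have N0 : 0 < n%:R :> R by lra.
have N2 : 0 < n%:R - 2 :> R by lra.
have y0 : 0 <= (n%:R * (n%:R - 2))^-1 :> R.
  by rewrite invr_ge0 mulr_ge0 //; exact: ltW.
have := bernoulli_ineq n y0.
have -> : 1 + (n%:R * (n%:R - 2))^-1 = (n%:R - 1) ^+ 2 / (n%:R * (n%:R - 2)) :> R.
  by field; rewrite !gt_eqF.
rewrite -!exprVn -!exprMn.
have -> : (n%:R - 2) / n%:R = ((n%:R - 1) / n%:R) ^+ 2 /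
    ((n%:R - 1) ^+ 2 / (n%:R * (n%:R - 2))) :> R.
  by field; rewrite !gt_eqF //; lra.
set c : R := _ ^+ 2 / (_ * _) => cB; set a : R := (n%:R - 1) / n%:R.
have c0 : 0 < c ^+ n.
  by rewrite exprn_gt0 // divr_gt0 ?mulr_gt0 //; lra.
rewrite exprMn exprVn exprAC ler_wpM2l ?sqr_ge0 //.
have NC : (n%:R + 1) / n%:R <= c ^+ n :> R.
  apply: le_trans cB; rewrite -subr_ge0.
  have -> : 1 + n%:R * (n%:R * (n%:R - 2))^-1 - (n%:R + 1) / n%:R =
     2 / (n%:R * (n%:R - 2)) :> R by field; rewrite !gt_eqF.
  by rewrite divr_ge0 ?mulr_ge0 ?ltW.
rewrite -[_^-1]mul1r ler_pdivrMr //.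
apply: (@le_trans _ _ (n%:R / (n%:R + 1) * ((n%:R + 1) / n%:R))).
  rewrite le_eqVlt; apply/orP; left; apply/eqP; field.
  by rewrite !gt_eqF //; lra.
by rewrite ler_wpM2l // divr_ge0 //; lra.
Qed.

(** Separates the number of distinct values from the multiplicities. Afterwards only [N - D],
    [(N - D - N q)^2], [Q] and [Q^2] occur, whose averages are under control. *)
Lemma draws_pointwise_bound (N D q Q : R) : 1 <= N -> 1 <= D <= N -> 0 <= q <= 1 ->
  0 <= Q ->
  N * ((1 + 1 / 1000) * (9 / N ^+ 4) *
     ((N ^+ 2 * D + D ^+ 2 * Q) / 45 + 2 * D * Q
       + (N * (D ^+ 2 - 1) / (3 * D) - N ^+ 2 * (1 - q) / 3) ^+ 2)
    + (1 + 1000) * (100 * Q ^+ 2 / N ^+ 4)) <=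
  (1 + 1 / 1000) * ((1 - (N - D) / N) / 5 + (1 - q) ^+ 2 / 5 * (Q / N)
    + (1 + 2 / 1000) * ((N - D - N * q) ^+ 2 / N)
    + 18 * (Q / N ^+ 2) + 40 * (Q ^+ 2 / N ^+ 3) + 1001 / N)
  + 1001 * 100 * (Q ^+ 2 / N ^+ 3).
Proof.
move=> N1 /andP[D1 DN] /andP[q0 q1] Q0; set Z := N - D.
have N0 : 0 < N by lra.
have D0 : 0 < D by lra.
pose w := D - N * (1 - q).
have wE : w = - (Z - N * q) by rewrite /w /Z; ring.
(* The bias is [N / 3] times [w - 1 / D], and [1 / D] is at most 1. *)
have h1 : (N * (D ^+ 2 - 1) / (3 * D) - N ^+ 2 * (1 - q) / 3) ^+ 2 <=
    N ^+ 2 / 9 * ((1 + 1 / 1000) * w ^+ 2 + 1001).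
  have -> : N * (D ^+ 2 - 1) / (3 * D) - N ^+ 2 * (1 - q) / 3 = N / 3 * (w - D^-1).
    by rewrite /w; field; rewrite gt_eqF.
  rewrite exprMn (_ : (N / 3) ^+ 2 = N ^+ 2 / 9); last by field.
  rewrite ler_wpM2l ?divr_ge0 ?sqr_ge0 //.
  have : 0 <= D^-1 <= 1 by rewrite invr_ge0 (ltW D0) invf_le1.
  move: D^-1 => y /andP[y0 y1].
  have := sqr_ge0 (w / 1000 + y).
  have : 1001 * y ^+ 2 <= 1001.
    by rewrite ler_piMr //; rewrite expr_le1.
  nra.
(* Here [D^2 - N^2 (1 - q)^2 = v w] with [v <= 2 N]. The product [v w Q] is split so that [w^2]
   receives only the weight [5/1000]; the large weight falls on [Q^2], which is of lower order. *)
have h2 : D ^+ 2 * Q <= N ^+ 2 * (1 - q) ^+ 2 * Q + N ^+ 2 * w ^+ 2 * (5 / 1000)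
   + 200 * Q ^+ 2.
  pose v := D + N * (1 - q).
  have v0 : 0 <= v by rewrite /v addr_ge0 ?mulr_ge0 ?subr_ge0 // ltW.
  have vN : v <= 2 * N.
    have : 0 <= N * q by rewrite mulr_ge0 // ltW.
    by rewrite /v; lra.
  have v2 : v ^+ 2 <= 4 * N ^+ 2.
    have -> : 4 * N ^+ 2 = (2 * N) ^+ 2 by ring.
    by rewrite ler_pXn2r ?nnegrE //; lra.
  have := sqr_ge0 (v * w / 20 - 20 * Q).
  have : v ^+ 2 * w ^+ 2 <= 4 * N ^+ 2 * w ^+ 2 by rewrite ler_wpM2r ?sqr_ge0.
  have -> : D ^+ 2 * Q = N ^+ 2 * (1 - q) ^+ 2 * Q + v * w * Q by rewrite /v /w; ring.
  have -> : (v * w / 20 - 20 * Q) ^+ 2 =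
     v ^+ 2 * w ^+ 2 / 400 - 2 * (v * w * Q) + 400 * Q ^+ 2 by field.
  lra.
have h3 : 2 * D * Q <= 2 * N * Q by rewrite ler_wpM2r // ler_pM2l.
rewrite (_ : (Z - N * q) ^+ 2 = w ^+ 2); last by rewrite wE sqrrN.
have -> : 1 - Z / N = D / N by rewrite /Z; field; rewrite gt_eqF.
move: (N * (D ^+ 2 - 1) / (3 * D) - N ^+ 2 * (1 - q) / 3) h1 => T h1.
have c0 : 0 <= 9 / N ^+ 4 by rewrite divr_ge0 // exprn_ge0 // ltW.
have c1 : 0 <= N * (1 + 1 / 1000) * (9 / N ^+ 4).
  by rewrite mulr_ge0 // mulr_ge0; lra.
have H := ler_wpM2l c1 (lerD (lerD (ler_wpM2r (_ : 0 <= 45^-1)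
   (lerD (lexx (N ^+ 2 * D)) h2)) h3) h1).
rewrite -subr_ge0; set G := (X in 0 <= X).
have {}H := H _; rewrite -subr_ge0 in H.
apply: (le_trans (H _)); first by lra.
rewrite -subr_ge0 /G.
set G' := (X in 0 <= X).
have -> : G' = 0 by rewrite /G'; field; rewrite gt_eqF.
by [].
Qed.

Lemma missed_lt n (s : {ffun 'I_n -> 'I_n}) : (0 < n)%N -> (missed s < n)%N.
Proof.
case: n s => // n s _; rewrite /missed -[X in (_ < X)%N]card_ord -sum1_card.
rewrite (bigD1 (s ord0)) //= [X in (_ < X)%N](bigD1 (s ord0)) //= ltnS.
have -> : multiplicity s (s ord0) == 0%N = false.
  by rewrite /multiplicity (bigD1 ord0) //= eqxx.
by rewrite add0n leq_sum // => i _; exact: leq_b1.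
Qed.

(* The factors [1 + 1 / 1000] and [1 + 1000] come from
   [(a + b) ^+ 2 <= (1 + t) * a ^+ 2 + (1 + t^-1) * b ^+ 2], which separates the
   leading part of [xi_b] from the correction due to ties. *)
Definition draw_bound n (s : {ffun 'I_n -> 'I_n}) : R :=
  let N := n%:R in let D := N - (missed s)%:R in let Q := (sum_sqr_mult s)%:R in
  (1 + 1 / 1000) * (9 / N ^+ 4) *
     ((N ^+ 2 * D + D ^+ 2 * Q) / 45 + 2 * D * Q
       + (N * (D ^+ 2 - 1) / (3 * D)
          - N ^+ 2 * (1 - (N - 1) ^+ n / N ^+ n) / 3) ^+ 2)
    + (1 + 1000) * (100 * Q ^+ 2 / N ^+ 4).

(** [dl] stands for [1/n]. The room between [0.39608], the main part at [q = 0.357], and [0.399]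
    absorbs the terms in [dl <= 10^-12] and the factors close to 1. For the factor of [T], the
    square of [q - 1/4] provides [q - 2 q^2 <= 1/8]. *)
Lemma draws_constant_bound (q T dl : R) : 357 / 1000 <= q -> 0 <= dl ->
  1000 * (1000 * (1000 * (1000 * dl))) <= 1 -> T <= q - 2 * q ^+ 2 + 2 * dl ->
  (1 + 1 / 1000) * ((1 / 5 + 1001 * dl) - q / 5 + 2 / 5 * (1 - q) ^+ 2 + 36 * dl
    + (1 + 2 / 1000) * T) + ((1 + 1 / 1000) * 40 + 1001 * 100) * (84 * dl)
  <= 399 / 1000.
Proof.
move=> q0 d1 d2 TE.
have h1 : 0 <= q - 357 / 1000 by rewrite subr_ge0.
have h2 : 0 <= q + 357 / 1000 by lra.
have := mulr_ge0 h1 h2; have := sqr_ge0 (q - 1 / 4).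
lra.
Qed.

(* The leading terms add up to [3/5 - 8/5 q^2] where [q] is close to [exp (-1)],
   and [exp 2 < 8]. *)
Lemma sum_draw_bound n : 1000 * (1000 * (1000 * 1000)) <= n%:R :> R ->
  357 / 1000 <= (n%:R - 1) ^+ n / n%:R ^+ n :> R ->
  (n%:R + 1) ^+ n <= 4 * n%:R ^+ n :> R ->
  \sum_(s : {ffun 'I_n -> 'I_n}) n%:R * draw_bound s <= n%:R ^+ n * (399 / 1000).
Proof.
move=> Nbig; set q : R := _ ^+ n / _ => qlb ub.
have N3 : 3 <= n%:R :> R by lra.
have N1 : 1 <= n%:R :> R by lra.
have n3 : (3 <= n)%N by rewrite -(ler_nat R).
have n0 : (0 < n)%N by rewrite (leq_trans _ n3).
have N0 : 0 < n%:R :> R by lra.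
have W0 : 0 < n%:R ^+ n :> R by rewrite exprn_gt0.
have q0 : 0 <= q by apply: le_trans qlb; lra.
have q1 : q <= 1.
  by rewrite ler_pdivrMr // mul1r lerXn2r ?nnegrE //; lra.
have rb := two_missed_ratio n3; rewrite -/q in rb.
have S1 := sum_draws_missed R n; have S2 := sum_draws_missed2 R n.
have Q1 := sum_draws_sqr_mult R n; have Q2 := sum_draws_sqr_mult2 R n.
have qE : (n%:R - 1) ^+ n = q * n%:R ^+ n by rewrite /q mulfVK // gt_eqF.
set r := (n%:R - 2) ^+ n / n%:R ^+ n in rb.
have rE : (n%:R - 2) ^+ n = r * n%:R ^+ n by rewrite /r mulfVK // gt_eqF.
rewrite qE in S1; rewrite qE rE in S2.
(* Coefficients of the pointwise bound, in which the draws appear only through [missed s],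
   [sum_sqr_mult s] and their squares. *)
pose A0 : R := (1 + 1 / 1000) * (1 / 5 + 1001 / n%:R).
pose A1 : R := - (1 + 1 / 1000) / 5 / n%:R.
pose A2 : R := (1 + 1 / 1000) * ((1 - q) ^+ 2 / 5 / n%:R + 18 / n%:R ^+ 2).
pose A3 : R := (1 + 1 / 1000) * (1 + 2 / 1000) / n%:R.
pose A4 : R := ((1 + 1 / 1000) * 40 + 1001 * 100) / n%:R ^+ 3.
apply: (@le_trans _ _ (\sum_(s : {ffun 'I_n -> 'I_n})
   (A0 + A1 * (missed s)%:R + A2 * (sum_sqr_mult s)%:R
    + A3 * ((missed s)%:R ^+ 2 + (- 2 * n%:R * q) * (missed s)%:R + (n%:R * q) ^+ 2)
    + A4 * (sum_sqr_mult s)%:R ^+ 2))).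
  rewrite ler_sum // => s _.
  have := @draws_pointwise_bound n%:R (n%:R - (missed s)%:R) q (sum_sqr_mult s)%:R.
  have DN : 1 <= (n%:R : R) - (missed s)%:R <= n%:R.
    apply/andP; split; last by rewrite lerBlDr lerDl ler0n.
    rewrite lerBrDr -[1]/(1%:R) -natrD ler_nat add1n.
    exact: missed_lt.
  rewrite N1 DN q0 q1 ler0n => /(_ isT isT isT isT); rewrite -/(draw_bound s) => H.
  apply: (le_trans H); rewrite le_eqVlt; apply/orP; left; apply/eqP.
  by rewrite /A0 /A1 /A2 /A3 /A4; field; rewrite gt_eqF.
have A20 : 0 <= A2.
  by rewrite /A2 mulr_ge0 ?addr_ge0 ?divr_ge0 ?sqr_ge0 ?exprn_ge0 // ltW.
have A30 : 0 <= A3 by rewrite /A3 divr_ge0 ?mulr_ge0 ?addr_ge0 ?divr_ge0 // ltW.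
have A40 : 0 <= A4.
  by rewrite /A4 mulr_ge0 ?invr_ge0 ?exprn_ge0 ?(ltW N0) //; clear; lra.
have Q2' : \sum_(s : {ffun 'I_n -> 'I_n}) (sum_sqr_mult s)%:R ^+ 2
   <= 84 * n%:R ^+ 2 * n%:R ^+ n :> R.
  apply: (le_trans Q2); rewrite (_ : 84 = 21 * 4); last by ring.
  have -> : 21 * 4 * n%:R ^+ 2 * n%:R ^+ n = 21 * n%:R ^+ 2 * (4 * n%:R ^+ n) :> R by ring.
  by rewrite ler_wpM2l // mulr_ge0 // sqr_ge0.
have {}Q1 := ler_wpM2l A20 Q1; have {}Q2 := ler_wpM2l A40 Q2'.
have rq : r <= q ^+ 2 - q ^+ 2 / (n%:R + 1).
  apply: (le_trans rb); rewrite le_eqVlt; apply/orP; left; apply/eqP.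
  by field; rewrite gt_eqF // addr_gt0.
have key : A0 + A1 * (n%:R * q) + A2 * (2 * n%:R)
    + A3 * (n%:R * q + n%:R * (n%:R - 1) * r - (n%:R * q) ^+ 2)
    + A4 * (84 * n%:R ^+ 2) <= 399 / 1000.
  have [dl d0 dub] : exists2 dl : R, dl = n%:R^-1 &
      (0 <= dl) && (1000 * (1000 * (1000 * (1000 * dl))) <= 1).
    exists n%:R^-1 => //; rewrite invr_ge0 ltW //=.
    by rewrite !mulrA ler_pdivrMr // mul1r -!mulrA.
  have {dub} [d1 d2] := andP dub.
  (* The left side is the variance of the number missed, divided by [n]. The bound [rq] is used
     through [(n - 1) (1 - 1 / (n + 1)) = n - 2 + 2 / (n + 1)]. *)
  have h3 : q + (n%:R - 1) * r - n%:R * q ^+ 2 <= q - 2 * q ^+ 2 + 2 * dl.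
    have n1 : 0 <= n%:R - 1 :> R by rewrite subr_ge0.
    have := ler_wpM2l n1 rq.
    have -> : (n%:R - 1) * (q ^+ 2 - q ^+ 2 / (n%:R + 1)) =
      (n%:R - 2) * q ^+ 2 + 2 * q ^+ 2 / (n%:R + 1).
      by field; rewrite gt_eqF //; apply: addr_gt0.
    have : 2 * q ^+ 2 / (n%:R + 1) <= 2 * dl.
      rewrite d0 ler_pM //; first by rewrite mulr_ge0 ?sqr_ge0.
        by rewrite invr_ge0 addr_ge0 // ltW.
        by rewrite ler_piMr // expr_le1.
      by rewrite lef_pV2 ?posrE ?addr_gt0 // lerDl.
    move=> a b; clear -a b; clearbody q r; lra.
  rewrite /A0 /A1 /A2 /A3 /A4.
  rewrite [X in X <= _](_ : _ = (1 + 1 / 1000) * ((1 / 5 + 1001 * dl) - q / 5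
    + 2 / 5 * (1 - q) ^+ 2 + 36 * dl
    + (1 + 2 / 1000) * (q + (n%:R - 1) * r - n%:R * q ^+ 2))
    + ((1 + 1 / 1000) * 40 + 1001 * 100) * (84 * dl)); last first.
    by rewrite d0; field; rewrite gt_eqF.
  exact: draws_constant_bound.
have := ler_wpM2r (ltW W0) key.
clear -S1 S2 Q1 Q2; clearbody A0 A1 A2 A3 A4 q r.
rewrite !big_split /= -!mulr_sumr !big_split /= -!mulr_sumr !sum_draws_cst S1 S2.
move: (\sum_s _) (\sum_s _) Q1 Q2 => X1 X2 Q1 Q2.
clear -Q1 Q2; move: (n%:R ^+ n) Q1 Q2 => W Q1 Q2; lra.
Qed.

End DrawsBound.

(** * The correction due to ties *)

Section LatticePath.
Variable R : realFieldType.

(** Steps that stand still contribute nothing, and each edge from [k] to [k + 1] is crossed exactly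
    once. *)
Lemma sum_lattice_path (f : nat -> R) (r : nat -> nat) m :
  (forall k, (k < m)%N -> r k.+1 = r k \/ r k.+1 = (r k).+1) ->
  (r 0 <= r m)%N /\ \sum_(k < m) `|f (r k.+1) - f (r k)| =
  \sum_(r 0%N <= k < r m) `|f k.+1 - f k|.
Proof.
elim: m => [|m IH] H; first by rewrite big_ord0 big_geq.
have [|le IHe] := IH; first by move=> k km; apply: H; rewrite (leq_trans km).
rewrite big_ord_recr /= IHe; have [|->|->] := H m; first by [].
  by rewrite subrr normr0 addr0.
by rewrite big_nat_recr //= (leq_trans le).
Qed.

(** Observations listed by increasing X, with ties in any order, run through the blocks one after
    another: steps inside a block vanish and every change of block leads to the next one. *)
Lemma sum_monotone_surjection n D (rho : 'I_n -> 'I_D) (f : 'I_D -> R) :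
  (forall i j : 'I_n, (i <= j)%N -> (rho i <= rho j)%N) ->
  (forall k, exists i, rho i = k) ->
  consecutive_sum (fun i j => `|f (rho j) - f (rho i)|) =
  consecutive_sum (fun k l => `|f l - f k|).
Proof.
case: n rho => [|n] rho mono surj.
  case: D rho f mono surj => [|D] rho f mono surj; first by rewrite /consecutive_sum !big_ord0.
  by have [[]] := surj ord0.
case: D rho f mono surj => [|D] rho f mono surj; first by case: (rho ord0).
rewrite !consecutive_sumE.
pose r k : nat := rho (inord k).
pose g k : R := f (inord k).
have r0 : r 0%N = 0%N.
  have [i iE] := surj ord0; have := mono (inord 0) i.
  by rewrite inordK // iE leqn0 => /(_ isT)/eqP.
have rn : r n = D.
  have [i iE] := surj ord_max.
  have le : (i <= (inord n : 'I_n.+1))%N by rewrite inordK // -ltnS ltn_ord.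
  have := mono _ _ le; rewrite iE /= => h; apply/eqP.
  by rewrite eqn_leq h andbT -ltnS ltn_ord.
have step k : (k < n)%N -> r k.+1 = r k \/ r k.+1 = (r k).+1.
  move=> kn.
  have le : (r k <= r k.+1)%N.
    by apply: mono; rewrite !inordK // ?leqnSn // ltnS ltnW.
  have [le1|gt1] := leqP (r k.+1) (r k).+1.
    by move: le; rewrite leq_eqVlt => /orP[/eqP->|h]; [left|right; apply/eqP; rewrite eqn_leq le1].
  (* Had the path jumped, the value [r k + 1] would be attained neither up to [k] nor after it,
     against surjectivity. *)
  have kD : ((r k).+1 < D.+1)%N by apply: leq_trans gt1 _; rewrite -ltnS ltnW // ltnS ltn_ord.
  have [i iE] := surj (Ordinal kD).
  have [ik|ki] := leqP i k.
    have le2 : (i <= (inord k : 'I_n.+1))%N by rewrite inordK // ltnS ltnW.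
    by have := mono _ _ le2; rewrite iE /= /r ltnn.
  have le2 : ((inord k.+1 : 'I_n.+1) <= i)%N by rewrite inordK // ltnS.
  by have := mono _ _ le2; rewrite iE /= leqNgt -/(r _) gt1.
have [_ E] := sum_lattice_path g step.
rewrite r0 rn big_mkord in E.
have fg (i : 'I_D.+1) : f i = g i by rewrite /g inord_val.
transitivity (\sum_(k < n) `|g (r k.+1) - g (r k)|).
  apply: eq_bigr => k _; rewrite !fg; congr `|g _ - g _|.
    by rewrite /r; congr (nat_of_ord (rho _)); apply: val_inj; rewrite /= inordK // ltnS.
  by rewrite /r; congr (nat_of_ord (rho _)); apply: val_inj; rewrite /= inordK // ltnS ltnW.
rewrite E; apply: eq_bigr => k _; congr `|f _ - f _|.
  by apply: val_inj; rewrite /= inordK // ltnS.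
by apply: val_inj; rewrite /= inordK // ltnS ltnW.
Qed.

End LatticePath.

(** * The denominator of [xi_b] and the replacement of [n / (2 M)] by [3 / n^2] *)

Section Denominator.
Variable R : realFieldType.

(** A discrete integral of [c (n - c)] from 0 to [c m]: the terms in [w k ^+ 2] are the exact errors
    of the left Riemann sum on each step. *)
Lemma sum_square_mass (w : nat -> R) m (n : R) :
  let c k := \sum_(j < k) w j in
  \sum_(k < m) (w k * (c k * (n - c k)) + w k ^+ 2 * (n / 2 - c k - w k / 3)) =
  n * c m ^+ 2 / 2 - c m ^+ 3 / 3.
Proof.
move=> c; elim: m => [|m IH]; first by rewrite /c !big_ord0; ring.
rewrite big_ord_recr /= IH; have -> : c m.+1 = c m + w m by rewrite /c big_ord_recr.
by field.
Qed.

Definition mass_below m (y : 'I_m -> R) (k : 'I_m) : R := csum y k - y k.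

(** The sum of [L (n - L)] from the denominator of [xi_b], grouped by blocks: [n - L] is the mass
    strictly below the block. *)
Definition mass_form m (y : 'I_m -> R) : R :=
  \sum_k y k * (mass_below y k * ((\sum_j y j) - mass_below y k)).

Lemma mass_belowE m (y : 'I_m -> R) k :
  mass_below y k = \sum_(j < m | (j < k)%N) y j.
Proof.
rewrite /mass_below /csum (bigD1 k) //= [LHS]addrC addKr; apply: eq_bigl => j.
by rewrite ltn_neqAle andbC.
Qed.

Lemma mass_below_ge0 m (y : 'I_m -> R) k : (forall j, 0 <= y j) -> 0 <= mass_below y k.
Proof. by move=> y0; rewrite mass_belowE; exact: sumr_ge0. Qed.

Lemma mass_below_total m (y : 'I_m -> R) k : (forall j, 0 <= y j) ->
  mass_below y k + y k <= \sum_j y j.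
Proof.
move=> y0; rewrite /mass_below subrK /csum [leRHS](bigID (fun j : 'I_m => (j <= k)%N)) /=.
by rewrite lerDl sumr_ge0.
Qed.

(** In the error terms of [sum_square_mass] the bracket lies between [- n / 2] and [n / 2], since
    the mass up to and including a block is at most the total [n]. *)
Lemma mass_form_approx m (y : 'I_m -> R) : (forall j, 0 <= y j) ->
  `|mass_form y - (\sum_j y j) ^+ 3 / 6| <= (\sum_j y j) * (\sum_j y j ^+ 2) / 2.
Proof.
move=> y0; set n := \sum_j y j.
case: m y y0 @n => [|m] y y0 n.
  by rewrite /mass_form /n !big_ord0 expr0n /= mul0r subrr normr0 !mul0r.
pose w k : R := y (inord k).
have wE (k : 'I_m.+1) : w k = y k by rewrite /w inord_val.
have cE (k : 'I_m.+1) : \sum_(j < k) w j = mass_below y k.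
  rewrite mass_belowE (big_ord_narrow (ltnW (ltn_ord k))).
  by apply: eq_bigr => j _; rewrite -wE.
have nE : \sum_(j < m.+1) w j = n by apply: eq_bigr => j _; exact: wE.
have := sum_square_mass w m.+1 n; rewrite /= nE.
under eq_bigr => k _ do rewrite cE wE.
rewrite big_split /= -/(mass_form y) => E.
have -> : mass_form y - n ^+ 3 / 6 =
   - \sum_(k < m.+1) y k ^+ 2 * (n / 2 - mass_below y k - y k / 3).
  move: E; rewrite -/n -/(mass_form y); set Z := \sum_k _ * (_ - _) => E.
  have -> : mass_form y = n * n ^+ 2 / 2 - n ^+ 3 / 3 - Z by rewrite -E /mass_form -/n; ring.
  by field.
rewrite normrN (le_trans (ler_norm_sum _ _ _)) //.
rewrite mulr_sumr mulr_suml ler_sum // => k _.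
rewrite normrM ger0_norm ?sqr_ge0 //.
rewrite (_ : n * y k ^+ 2 / 2 = y k ^+ 2 * (n / 2)); last by ring.
rewrite ler_wpM2l ?sqr_ge0 //.
have := mass_below_ge0 k y0; have := mass_below_total k y0; have := y0 k.
rewrite -/n ler_norml => *; apply/andP; split; lra.
Qed.

(** Each point is the start of at most one edge of the path and the end of at most one. *)
Lemma sum_edges_perm D (a : 'S_D) (F : 'I_D -> R) : (forall k, 0 <= F k) ->
  consecutive_sum (fun i j => F (a i) + F (a j)) <= 2 * \sum_k F k.
Proof.
case: D a F => [|D] a F F0.
  by rewrite /consecutive_sum !big_ord0 mulr0.
rewrite consecutive_sumE big_split /= mulr_natl mulr2n.
have -> : \sum_k F k = \sum_k F (a k) by rewrite (reindex_inj (@perm_inj _ a)).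
rewrite lerD //.
  by rewrite [leRHS]big_ord_recr /= lerDl.
by rewrite [leRHS]big_ord_recl /= lerDr.
Qed.

(* Each gap is straddled by at most twice as many edges as there are points on
   either of its sides. *)
Lemma block_variation_le m (x : 'I_m -> R) (t a : 'S_m) : (forall k, 1 <= x k) ->
  (\sum_k x k) * block_variation x t a <= 4 * mass_form (x \o t).
Proof.
move=> x1; have x0 k : 0 <= (x \o t) k by rewrite (le_trans ler01) //; exact: x1.
set n := \sum_k x k.
have nE : \sum_k (x \o t) k = n by rewrite /n [RHS](reindex_inj (@perm_inj _ t)).
(* The number of edges of the path that cross the gap before position [j]. *)
pose e (j : 'I_m) : R := consecutive_sum (fun i k => (between j (a k) (a i))%:R).
have -> : block_variation x t a = \sum_j (x \o t) j * e j.
  rewrite /block_variation /consecutive_sum.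
  under eq_bigr => i _ do under eq_bigr => k _ do rewrite csum_dist //.
  under eq_bigr => i _ do rewrite exchange_big.
  rewrite exchange_big; apply: eq_bigr => j _ /=.
  rewrite /e /consecutive_sum mulr_sumr; apply: eq_bigr => i _.
  by rewrite mulr_sumr.
rewrite /mass_form nE !mulr_sumr ler_sum // => j _.
rewrite mulrCA [leRHS]mulrCA ler_wpM2l //.
have eL : e j <= 2 * j%:R.
  rewrite -(@sum_ord_ltn R m j (ltnW (ltn_ord j))).
  apply: le_trans (@sum_edges_perm m a (fun k => (k < j)%:R) _); last by move=> k; exact: ler0n.
  rewrite /e /consecutive_sum ler_sum // => i _; rewrite ler_sum // => k _.
  by rewrite -natrD ler_nat /between; case: (ltnP (a k) j); case: (ltnP (a i) j) => ? ?; rewrite //= ?andbF //=; case: (_ <= _)%N.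
have eR : e j <= 2 * (m%:R - j%:R).
  rewrite -(@sum_ord_geq R m j (ltnW (ltn_ord j))).
  apply: le_trans (@sum_edges_perm m a (fun k => (j <= k)%:R) _); last by move=> k; exact: ler0n.
  rewrite /e /consecutive_sum ler_sum // => i _; rewrite ler_sum // => k _.
  by rewrite -natrD ler_nat /between; case: (leqP j (a k)); case: (leqP j (a i)) => ? ?; rewrite //= ?andbF //=; case: (_ < _)%N.
have cL : j%:R <= mass_below (x \o t) j.
  rewrite mass_belowE -(@sum_ord_ltn R m j (ltnW (ltn_ord j))) [leRHS]big_mkcond /=.
  by rewrite ler_sum // => k _; case: ltnP => // _; exact: x1.
have cR : m%:R - j%:R <= n - mass_below (x \o t) j.
  rewrite mass_belowE -nE [X in _ <= X - _](bigID (fun k : 'I_m => (k < j)%N)) /= addrAC subrr add0r.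
  rewrite -(@sum_ord_geq R m j (ltnW (ltn_ord j))) [leRHS]big_mkcond /=.
  by rewrite ler_sum // => k _; rewrite -leqNgt; case: leqP => // _; exact: x1.
have j0 : 0 <= j%:R :> R by exact: ler0n.
have jm : j%:R <= m%:R :> R by rewrite ler_nat ltnW.
move: (mass_below _ _) cL cR => c cL cR.
have c0 : 0 <= c by lra.
have nc0 : 0 <= n - c by lra.
(* The bounds [2 (n - c)] and [2 c] on the number of crossing edges are weighted by [c] and [n - c],
   which add up to [n]. *)
have h1 := ler_wpM2l c0 (le_trans eR (ler_wpM2l (ler0n R 2) cR)).
have h2 := ler_wpM2l nc0 (le_trans eL (ler_wpM2l (ler0n R 2) cL)).
move: (e j) h1 h2 => E h1 h2; lra.
Qed.

(** With [M] the mass form, [B] the block variation and [Q] the sum of squares, the difference is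
    [n B / (4 M)] times [12 / n^3] times [n^3 / 6 - M]. The first factor is at most 1 for every
    arrangement by [block_variation_le], so a small [M] does no harm; the rest is at most
    [6 Q / n^2] by [mass_form_approx]. *)
Lemma block_ratio_approx m (x : 'I_m -> R) (t a : 'S_m) :
  (forall k, 1 <= x k) -> (0 < m)%N ->
  `|(\sum_k x k) / (2 * mass_form (x \o t)) * block_variation x t a
    - 3 / (\sum_k x k) ^+ 2 * block_variation x t a| <=
  10 * (\sum_k x k ^+ 2) / (\sum_k x k) ^+ 2.
Proof.
move=> x1 m0; set n := \sum_k x k.
have x0 k : 0 <= (x \o t) k by rewrite (le_trans ler01) //; exact: x1.
have x0' k : 0 <= x k by rewrite (le_trans ler01).
have n0 : 0 < n.
  by rewrite /n (bigD1 (Ordinal m0)) //= ltr_pwDl ?sumr_ge0 // (lt_le_trans ltr01).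
have bv0 : 0 <= block_variation x t a.
  by apply: sumr_ge0 => i _; apply: sumr_ge0.
have le4 := block_variation_le t a x1; rewrite -/n in le4.
have := mass_form_approx x0.
have -> : \sum_k (x \o t) k = n by rewrite /n [RHS](reindex_inj (@perm_inj _ t)).
have -> : \sum_k (x \o t) k ^+ 2 = \sum_k x k ^+ 2.
  by rewrite [RHS](reindex_inj (@perm_inj _ t)).
have Q0 : 0 <= \sum_k x k ^+ 2 by apply: sumr_ge0 => k _; exact: sqr_ge0.
move: (\sum_k x k ^+ 2) (mass_form _) (block_variation _ _ _) Q0 le4 bv0 => Q M B Q0 le4 bv0 HM.
(* A vanishing denominator forces the block variation to vanish too, which covers the inverse of
   zero. *)
have [M0|M0] := ler0P M.
  have B0 : B = 0.
    apply/eqP; rewrite eq_le bv0 andbT.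
    by rewrite -(pmulr_rle0 _ n0) (le_trans le4) // mulr_ge0_le0.
  by rewrite B0 !mulr0 subrr normr0 divr_ge0 ?sqr_ge0 ?mulr_ge0.
have -> : n / (2 * M) * B - 3 / n ^+ 2 * B =
   (n * B / (4 * M)) * ((12 / n ^+ 3) * (n ^+ 3 / 6 - M)).
  by field; rewrite !gt_eqF.
rewrite normrM [X in X * _]ger0_norm; last by rewrite divr_ge0 ?mulr_ge0 // ltW.
rewrite normrM [X in _ * (X * _)]ger0_norm; last by rewrite divr_ge0 ?exprn_ge0 // ltW.
rewrite distrC.
have u1 : n * B / (4 * M) <= 1 by rewrite ler_pdivrMr ?mul1r // mulr_gt0.
have u0 : 0 <= n * B / (4 * M) by rewrite divr_ge0 ?mulr_ge0 // ltW.
have v0 : 0 <= 12 / n ^+ 3 by rewrite divr_ge0 ?exprn_ge0 // ltW.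
apply: (@le_trans _ _ (1 * (12 / n ^+ 3 * (n * Q / 2)))).
  by apply: ler_pM => //; [exact: mulr_ge0|exact: ler_wpM2l].
rewrite -subr_ge0.
have -> : 10 * Q / n ^+ 2 - 1 * (12 / n ^+ 3 * (n * Q / 2)) = 4 * Q / n ^+ 2.
  by field; rewrite gt_eqF.
by rewrite divr_ge0 ?sqr_ge0 ?mulr_ge0.
Qed.

End Denominator.

From mathcomp Require Import all_classical all_reals all_analysis.
From mathcomp Require Import measurable_realfun.
Import numFieldNormedType.Exports.

Local Open Scope classical_set_scope.
Local Open Scope ring_scope.

(** * From bootstrap observations to blocks of tied pairs *)

Section Blocks.
Variables (R : realType) (n : nat) (s : {ffun 'I_n -> 'I_n}).

Definition drawn : {pred 'I_n} := [pred i | multiplicity s i != 0%N].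
Definition label (k : 'I_#|drawn|) : 'I_n := enum_val k.
Definition block_size (k : 'I_#|drawn|) : R := (multiplicity s (label k))%:R.

Lemma label_inj : injective label.
Proof. exact: enum_val_inj. Qed.

Lemma mem_drawn a : s a \in drawn.
Proof.
by rewrite inE /multiplicity (bigD1 a) //= eqxx.
Qed.

Definition block_of (a : 'I_n) : 'I_#|drawn| := enum_rank_in (mem_drawn a) (s a).

Lemma label_block_of a : label (block_of a) = s a.
Proof. by rewrite /label /block_of enum_rankK_in // mem_drawn. Qed.

Lemma block_of_surj k : exists a, block_of a = k.
Proof.
have : multiplicity s (label k) != 0%N by exact: enum_valP k.
rewrite /multiplicity sum_nat_eq0 negb_forall => /existsP[a].
rewrite /= eqb0 negbK => /eqP e; exists a.
by apply: label_inj; rewrite label_block_of.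
Qed.

Lemma block_size_ge1 k : 1 <= block_size k.
Proof. by rewrite /block_size -[1]/(1%:R) ler_nat lt0n; exact: enum_valP k. Qed.

Lemma sum_over_draws (F : 'I_#|drawn| -> R) :
  \sum_a F (block_of a) = \sum_k block_size k * F k.
Proof.
rewrite (partition_big block_of predT) //=; apply: eq_bigr => k _.
rewrite (eq_bigr (fun=> 1 * F k)); last by move=> a /eqP ->; rewrite mul1r.
rewrite -mulr_suml /block_size /multiplicity natr_sum big_mkcond /=; congr (_ * _).
apply: eq_bigr => a _; rewrite -label_block_of (inj_eq label_inj).
by case: (_ == _).
Qed.

Lemma sum_block_size : \sum_k block_size k = n%:R.
Proof.
have := sum_over_draws (fun=> 1); rewrite sumr_const card_ord.
by under eq_bigr => k _ do rewrite mulr1.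
Qed.

Lemma sum_drawn (F : nat -> R) : F 0%N = 0 ->
  \sum_k F (multiplicity s (label k)) = \sum_i F (multiplicity s i).
Proof.
move=> F0; rewrite [RHS](bigID drawn) /= [X in _ + X]big1 ?addr0; last first.
  by move=> i; rewrite /drawn /= negbK => /eqP ->.
by rewrite -(big_enum_val (A := drawn) (fun i => F (multiplicity s i))); apply: eq_bigl.
Qed.

Lemma sum_block_size_sqr : \sum_k block_size k ^+ 2 = (sum_sqr_mult s)%:R.
Proof.
rewrite /sum_sqr_mult natr_sum -(@sum_drawn (fun k => (k ^ 2)%:R)) //.
by apply: eq_bigr => k _; rewrite natrX.
Qed.

Lemma card_drawn : #|drawn|%:R = n%:R - (missed s)%:R :> R.
Proof.
have -> : n%:R = #|drawn|%:R + (missed s)%:R :> R.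
  rewrite -natrD; congr _%:R; rewrite -[LHS](card_ord n) -(cardC drawn).
  congr addn; rewrite -sum1_card big_mkcond /missed /=; apply: eq_bigr => i _.
  by rewrite !inE negbK; case: eqP.
by rewrite addrK.
Qed.

Definition sorts_blocks (x : 'I_n -> R) (a : 'S_#|drawn|) :=
  forall k l : 'I_#|drawn|, (k < l)%N -> x (label (a k)) < x (label (a l)).

Variables (x y : 'I_n -> R) (a t : 'S_#|drawn|).
Hypotheses (xa : sorts_blocks x a) (yt : sorts_blocks y t).

Lemma sorts_blocks_le z b k l : sorts_blocks z b ->
  (z (label (b k)) <= z (label (b l))) = (k <= l)%N.
Proof.
move=> zb; case: (ltngtP k l) => [kl|lk|/val_inj ->]; last exact: lexx.
  by rewrite ltW // zb.
by rewrite leNgt zb.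
Qed.

Let c := csum (block_size \o t).

Lemma lrank_block i : (lrank (y \o s) i)%:R = c ((t^-1)%g (block_of i)).
Proof.
rewrite /lrank natr_sum.
rewrite (eq_bigr (fun j => (y (label (block_of j)) <= y (label (block_of i)))%R%:R)); last first.
  by move=> j _; rewrite !label_block_of.
rewrite (sum_over_draws (fun k => (y (label k) <= y (label (block_of i)))%R%:R)).
rewrite (reindex_inj (@perm_inj _ t)) /c /csum [RHS]big_mkcond /=.
apply: eq_bigr => k _; rewrite -{1}(permKV t (block_of i)) sorts_blocks_le //.
by case: ifP; rewrite ?mulr1 ?mulr0.
Qed.

Lemma urank_block i :
  (urank (y \o s) i)%:R = n%:R - mass_below (block_size \o t) ((t^-1)%g (block_of i)).
Proof.
rewrite /urank natr_sum.
rewrite (eq_bigr (fun j => (y (label (block_of i)) <= y (label (block_of j)))%R%:R)); last first.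
  by move=> j _; rewrite !label_block_of.
rewrite (sum_over_draws (fun k => (y (label (block_of i)) <= y (label k))%R%:R)).
rewrite (reindex_inj (@perm_inj _ t)) mass_belowE -sum_block_size.
rewrite [in RHS](reindex_inj (@perm_inj _ t)) [X in _ = _ - X]big_mkcond -sumrB.
apply: eq_bigr => k _ /=; rewrite -{1}(permKV t (block_of i)) sorts_blocks_le // leqNgt.
by case: (k < _)%N; rewrite /= ?mulr1 ?mulr0 ?subrr ?subr0.
Qed.

Lemma sum_urank_block :
  \sum_i (urank (y \o s) i)%:R * (n%:R - (urank (y \o s) i)%:R) =
  mass_form (block_size \o t) :> R.
Proof.
pose F k : R := (n%:R - mass_below (block_size \o t) ((t^-1)%g k))
    * mass_below (block_size \o t) ((t^-1)%g k).
rewrite (eq_bigr (fun i => F (block_of i))); last first.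
  by move=> i _; rewrite urank_block /F; ring.
rewrite (sum_over_draws F) (reindex_inj (@perm_inj _ t)) /mass_form.
have -> : \sum_j (block_size \o t) j = n%:R.
  by rewrite -sum_block_size [RHS](reindex_inj (@perm_inj _ t)).
by apply: eq_bigr => k _; rewrite /F permK /=; ring.
Qed.

(** [rho] sends a place in the sorted list of draws to the X position of its block. It is monotone
    however [p] breaks the ties, and onto because every block contains a draw. The result is free of
    [p]. *)
Lemma rank_variation_block (p : 'S_n) : arranges (x \o s) p ->
  rank_variation (y \o s) p = block_variation block_size t (a * t^-1)%g.
Proof.
move=> xp.
pose rho i := (a^-1)%g (block_of (p i)).
have rhoE i : c ((t^-1)%g (a (rho i))) = (lrank (y \o s) (p i))%:R.
  by rewrite /rho permKV lrank_block.
rewrite /block_variation.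
transitivity (consecutive_sum (fun i j => `|c ((t^-1)%g (a (rho j))) - c ((t^-1)%g (a (rho i)))|)).
  by apply: eq_bigr => i _; apply: eq_bigr => j _; rewrite !rhoE.
rewrite (@sum_monotone_surjection _ _ _ rho (fun k => c ((t^-1)%g (a k)))).
- by apply: eq_bigr => i _; apply: eq_bigr => j _; rewrite !permM.
- move=> i j ij; rewrite -(sorts_blocks_le _ _ xa) /rho !permKV !label_block_of.
  exact: xp.
move=> k; have [i iE] := block_of_surj (a k).
by exists ((p^-1)%g i); rewrite /rho permKV iE permK.
Qed.

Lemma chatterjee_ties_block (p : 'S_n) : arranges (x \o s) p -> (0 < n)%N ->
  `|chatterjee_ties (x \o s) (y \o s) p -
    (1 - 3 / n%:R ^+ 2 * block_variation block_size t (a * t^-1)%g)|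
  <= 10 * (sum_sqr_mult s)%:R / n%:R ^+ 2.
Proof.
move=> xp n0; rewrite /chatterjee_ties.
have m0 : (0 < #|drawn|)%N.
  by case: #|drawn| (block_of (Ordinal n0)) => [[]|].
have N0 : 0 < n%:R :> R by rewrite ltr0n.
(* When all draws coincide, the conventional value 1 agrees with the approximating formula, since
   the rank variation is zero. *)
case: ifPn => [/forallP all_eq|_].
  rewrite -(rank_variation_block xp) /rank_variation big1 ?mulr0 ?subr0 ?subrr ?normr0.
    by rewrite divr_ge0 ?sqr_ge0 ?mulr_ge0 ?ler0n.
  have const i j : (y \o s) i = (y \o s) j by have /forallP/(_ j)/andP[_ /eqP] := all_eq i.
  move=> i _; apply: big1 => j _; rewrite /lrank.
  by under eq_bigr => k _ do rewrite (const (p j) (p i)); rewrite subrr normr0.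
rewrite (rank_variation_block xp) sum_urank_block.
have := @block_ratio_approx _ _ block_size t (a * t^-1)%g block_size_ge1 m0.
rewrite sum_block_size sum_block_size_sqr => H.
by rewrite opprB addrC addrA subrK distrC.
Qed.

End Blocks.

(** * Patterns of independent atomless samples *)

Section FiniteFactor.
Context {R : realType} {d : measure_display} {T : measurableType d} {F : finType}.
Variable (Th : T -> F).
Hypothesis mTh : forall th, measurable (Th @^-1` [set th]).

Lemma measurable_finite_preimage (A : set F) : measurable (Th @^-1` A).
Proof.
have -> : Th @^-1` A = \bigcup_(th in A) (Th @^-1` [set th]).
  by apply/seteqP; split => [w Aw|w [th Ath /= e]] /=; [exists (Th w)|rewrite e].
by apply: fin_bigcup_measurable => [|th _]; [exact: finite_finset|exact: mTh].
Qed.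

Variable h : T -> R.
Hypothesis hTh : forall w w', Th w = Th w' -> h w = h w'.

Lemma measurable_finite_factor : measurable_fun setT h.
Proof.
move=> _ B _; rewrite setTI.
have -> : h @^-1` B = Th @^-1` [set th | exists2 w, Th w = th & B (h w)].
  apply/seteqP; split => [w Bw|w [w' e Bw']] /=; first by exists w.
  by rewrite -(hTh e).
exact: measurable_finite_preimage.
Qed.

Lemma finite_factorE : exists phi : F -> R, forall w, h w = phi (Th w).
Proof.
have /choice[phi phiP] : forall th, exists v, forall w, Th w = th -> h w = v.
  move=> th; have [[w we]|no] := pselect (exists w, Th w = th).
    by exists (h w) => w' w'e; apply: hTh; rewrite we w'e.
  by exists 0 => w we; case: no; exists w.
by exists phi => w; exact: phiP.
Qed.

Lemma bounded_finite_factor : exists2 M, 0 <= M & forall w, `|h w| <= M.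
Proof.
have [phi phiE] := finite_factorE.
exists (\sum_th `|phi th|); first exact: sumr_ge0.
by move=> w; rewrite phiE (bigD1 (Th w)) //= lerDl sumr_ge0.
Qed.

End FiniteFactor.

Section FiniteCover.
Context {R : realType} {d : measure_display} {T : measurableType d}.
Variable P : probability T R.

Lemma bounded_integrable (h : T -> R) M : measurable_fun setT h ->
  (forall w, `|h w| <= M) -> P.-integrable setT (EFin \o h).
Proof.
move=> mh hM; apply: (@le_integrable _ _ _ _ _ _ _ (EFin \o cst M)) => //.
- exact/measurable_EFinP.
- by move=> w _ /=; rewrite lee_fin (le_trans (hM w)) ?ler_norm.
- exact: finite_measure_integrable_cst.
Qed.

(** The sets may overlap, which only increases the right side. *)
Lemma integral_le_cover (I : finType) (U : I -> set T) (c : I -> R) (f : T -> R) :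
  measurable_fun setT f -> (forall w, 0 <= f w) ->
  (forall i, measurable (U i)) -> (forall i, 0 <= c i) ->
  (forall i w, U i w -> f w <= c i) ->
  P.-negligible (~` \bigcup_i U i) ->
  (\int[P]_w (f w)%:E <= \sum_i (c i)%:E * P (U i))%E.
Proof.
move=> mf f0 mU c0 fc U0.
have mi i : measurable_fun setT (fun w => c i * \1_(U i) w).
  by apply: measurable_funM => //; apply: measurable_indic.
have i0 i w : 0 <= c i * \1_(U i) w by rewrite mulr_ge0.
have emi i : measurable_fun setT (fun w => (c i * \1_(U i) w)%:E).
  exact/measurable_EFinP.
have ei0 i w : setT w -> (0 <= (c i * \1_(U i) w)%:E)%E by rewrite lee_fin.
have -> : (\sum_i (c i)%:E * P (U i) =
    \int[P]_w (\sum_i c i * \1_(U i) w)%:E)%E.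
  under [RHS]eq_integral do rewrite -sumEFin.
  rewrite (ge0_integral_sum P measurableT emi ei0).
  apply: eq_bigr => i _; under [RHS]eq_integral do rewrite EFinM.
  by rewrite ge0_integralZl_EFin ?integral_indic ?setIT //; apply/measurable_EFinP; apply: measurable_indic.
have mUU : measurable (\bigcup_i U i) by exact: fin_bigcup_measurable.
apply: ae_ge0_le_integral => //.
- by move=> w _; rewrite lee_fin.
- exact/measurable_EFinP.
- by move=> w _; rewrite lee_fin sumr_ge0.
- by apply/measurable_EFinP; apply: measurable_sum.
apply: negligibleS U0 => w /= H [i _ Ui]; apply: H => _.
rewrite lee_fin (bigD1 i) //=.
rewrite indicE mem_set // mulr1 (le_trans (fc i w Ui)) // lerDl.
exact: sumr_ge0.
Qed.

Lemma integral_finite_simple (A : set T) (I : finType) (a : I -> R) (U : I -> set T) :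
  measurable A -> (forall i, measurable (U i)) ->
  (\int[P]_(w in A) (\sum_i a i * \1_(U i) w)%:E =
   (\sum_i a i * fine (P (A `&` U i)))%:E)%E.
Proof.
move=> mA mU.
have intU i : P.-integrable A (fun w => (a i * \1_(U i) w)%:E).
  apply: (@eq_integrable _ _ _ _ _ mA (fun w => (a i)%:E * (\1_(U i) w)%:E)%E).
    by move=> w _; rewrite EFinM.
  apply: integrableZl => //; apply: (integrableS measurableT) => //.
  by apply: integrable_indic => //; rewrite -ge0_fin_numE // fin_num_measure.
transitivity (\sum_i \int[P]_(w in A) (a i * \1_(U i) w)%:E)%E.
  by rewrite -(integral_sum mA intU); apply: eq_integral => w _; rewrite sumEFin.
rewrite -[RHS]sumEFin; apply: eq_bigr => i _.
under eq_integral do rewrite EFinM.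
rewrite integralZl //; last first.
  apply: (integrableS measurableT) => //.
  by apply: integrable_indic => //; rewrite -ge0_fin_numE // fin_num_measure.
rewrite integral_indic // EFinM; congr (_ * _)%E.
rewrite setIC fineK //; apply: fin_num_measure.
exact: measurableI.
Qed.

End FiniteCover.

Section NoTies.
Context {R : realType} {d : measure_display} {T : measurableType d}.
Variable P : probability T R.

Lemma measurable_comparison d' (S : measurableType d') (f g : S -> R) (b : bool) :
  measurable_fun setT f -> measurable_fun setT g ->
  measurable [set z | (f z <= g z) = b].
Proof.
move=> mf mg; have := measurable_fun_ler mf mg measurableT (Y := [set b]) I.
by rewrite setTI.
Qed.

Lemma measurable_less d' (S : measurableType d') (f g : S -> R) :
  measurable_fun setT f -> measurable_fun setT g ->
  measurable [set z | f z < g z].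
Proof.
move=> mf mg; rewrite (_ : [set z | _] = [set z | (g z <= f z) = false]).
  exact: measurable_comparison.
by apply/seteqP; split => z /=; rewrite ltNge; [move/negbTE|move=> ->].
Qed.

(** By independence the joint law is the product of the two laws, and the sections of the diagonal
    are points, null for the law of [V]. *)
Lemma independent_ties (U V : {RV P >-> R}) :
  (forall A B : set R, measurable A -> measurable B ->
     P (U @^-1` A `&` V @^-1` B) = (P (U @^-1` A) * P (V @^-1` B))%E) ->
  (forall x, P (V @^-1` [set x]) = 0%E) ->
  P [set w | U w = V w] = 0%E.
Proof.
move=> UV V0.
have mUV : measurable_fun setT (fun w => (U w, V w)).
  by apply: measurable_fun_pair.
pose W : {mfun T >-> (R * R)%type} := mfun_Sub (mem_set mUV).
have mdiag : measurable [set z : R * R | z.1 = z.2].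
  have -> : [set z : R * R | z.1 = z.2] =
      [set z : R * R | (z.1 <= z.2) = true] `&` [set z : R * R | (z.2 <= z.1) = true].
    apply/seteqP; split => z /=; first by move=> ->; rewrite lexx.
    by move=> [h1 h2]; apply/eqP; rewrite eq_le h1 h2.
  by apply: measurableI; apply: measurable_comparison.
have E := @product_measure_unique _ _ _ _ R (distribution P U) (distribution P V)
  (distribution P W) _ _ mdiag.
rewrite -[LHS]/(distribution P W [set z : R * R | z.1 = z.2]) -E.
  apply: integral0_eq => x _ /=.
  have -> : xsection [set z : R * R | z.1 = z.2] x = [set x]; last exact: V0.
  by apply/seteqP; split => y; rewrite /xsection /= inE /= => ->.
by move=> A B mA mB; rewrite -UV.
Qed.

End NoTies.

(** * Laws of finite families of pairs *)

Section Boxes.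
Context {R : realType} {D : nat}.
Implicit Types x y : 'I_D -> R.

Definition box x y : set ('I_D -> R * R) :=
  [set z | forall k, (z k).1 <= x k /\ (z k).2 <= y k].

(** A pi-system that exhausts the space. With the sigma-algebra it generates, equality of laws
    reduces to equality of joint distribution functions. *)
Definition boxes : set (set ('I_D -> R * R)) :=
  [set A | exists x y, A = box x y].

Lemma boxes_setI : setI_closed boxes.
Proof.
move=> _ _ [x [y ->]] [x' [y' ->]].
exists (fun k => Num.min (x k) (x' k)), (fun k => Num.min (y k) (y' k)).
apply/seteqP; split => z /=.
  by move=> [h h'] k; rewrite !le_min; have [-> ->] := h k; have [-> ->] := h' k.
move=> h; split => k; have := h k; rewrite !le_min.
  by move=> [/andP[-> _] /andP[-> _]].
by move=> [/andP[_ ->] /andP[_ ->]].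
Qed.

Lemma finite_nat_bound (f : 'I_D -> R) : exists m : nat, forall k, f k <= m%:R.
Proof.
exists (\max_k `|Num.ceil (f k)|%N)%N => k.
apply: (le_trans (Num.Theory.ceil_ge _)).
apply: (@le_trans _ _ (`|Num.ceil (f k)|%N%:R)); last by rewrite ler_nat leq_bigmax.
by rewrite natr_absz ler_int ler_norm.
Qed.

Lemma bigcup_boxes : \bigcup_m box (fun=> m%:R) (fun=> m%:R) = setT.
Proof.
rewrite -subTset => z _.
have [m1 h1] := finite_nat_bound (fun k => (z k).1).
have [m2 h2] := finite_nat_bound (fun k => (z k).2).
exists (maxn m1 m2) => // k; split.
  by rewrite (le_trans (h1 k)) // ler_nat leq_maxl.
by rewrite (le_trans (h2 k)) // ler_nat leq_maxr.
Qed.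

Let Om := g_sigma_algebraType boxes.

Lemma measurable_box x y : measurable (box x y : set Om).
Proof. by apply: sub_sigma_algebra; exists x, y. Qed.

(** The half-space where the coordinate is at most [c] is a countable union of boxes whose other
    sides are bounded by a growing integer. *)
Lemma measurable_coord1 i : measurable_fun setT (fun z : Om => (z i).1).
Proof.
apply: (measurability _ (RGenOInfty.measurableE R)) => _ [_ [c ->] <-].
rewrite setTI; have -> : (fun z : Om => (z i).1) @^-1` `]c, +oo[ =
    ~` \bigcup_m (box (fun k => if k == i then c else m%:R) (fun=> m%:R) : set Om).
  apply/seteqP; split => z /=; rewrite in_itv /= andbT.
    move=> cz [m _ /(_ i)]; rewrite eqxx => -[h _].
    by move: cz; rewrite ltNge h.
  move=> h; rewrite ltNge; apply/negP => zc; apply: h.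
  have [m1 h1] := finite_nat_bound (fun k => (z k).1).
  have [m2 h2] := finite_nat_bound (fun k => (z k).2).
  exists (maxn m1 m2) => // k; split; last by rewrite (le_trans (h2 k)) // ler_nat leq_maxr.
  by case: eqP => [->//|_]; rewrite (le_trans (h1 k)) // ler_nat leq_maxl.
by apply: measurableC; apply: bigcup_measurable => m _; exact: measurable_box.
Qed.

Lemma measurable_coord2 i : measurable_fun setT (fun z : Om => (z i).2).
Proof.
apply: (measurability _ (RGenOInfty.measurableE R)) => _ [_ [c ->] <-].
rewrite setTI; have -> : (fun z : Om => (z i).2) @^-1` `]c, +oo[ =
    ~` \bigcup_m (box (fun=> m%:R) (fun k => if k == i then c else m%:R) : set Om).
  apply/seteqP; split => z /=; rewrite in_itv /= andbT.
    move=> cz [m _ /(_ i)]; rewrite eqxx => -[_ h].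
    by move: cz; rewrite ltNge h.
  move=> h; rewrite ltNge; apply/negP => zc; apply: h.
  have [m1 h1] := finite_nat_bound (fun k => (z k).1).
  have [m2 h2] := finite_nat_bound (fun k => (z k).2).
  exists (maxn m1 m2) => // k; split; first by rewrite (le_trans (h1 k)) // ler_nat leq_maxl.
  by case: eqP => [->//|_]; rewrite (le_trans (h2 k)) // ler_nat leq_maxr.
by apply: measurableC; apply: bigcup_measurable => m _; exact: measurable_box.
Qed.

Definition increasing : set Om :=
  [set z | forall k l : 'I_D, (k < l)%N -> (z k).1 < (z l).1 /\ (z k).2 < (z l).2].

Lemma measurable_increasing : measurable increasing.
Proof.
have -> : increasing = \bigcap_(k in [set: 'I_D]) \bigcap_(l in [set l : 'I_D | (k < l)%N])
   ([set z : Om | (z k).1 < (z l).1] `&` [set z : Om | (z k).2 < (z l).2]).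
  apply/seteqP; split => z h k; first by move=> _ l kl; exact: h.
  by move=> l kl; have [] := h k I l kl.
apply: fin_bigcap_measurable => // k _; apply: fin_bigcap_measurable => // l _.
apply: measurableI.
  exact: measurable_less (measurable_coord1 k) (measurable_coord1 l).
exact: measurable_less (measurable_coord2 k) (measurable_coord2 l).
Qed.

Context {d : measure_display} {T : measurableType d}.

Lemma measurable_to_boxes (Z : T -> Om) :
  (forall i, measurable_fun setT (fun w => (Z w i).1)) ->
  (forall i, measurable_fun setT (fun w => (Z w i).2)) -> measurable_fun setT Z.
Proof.
move=> m1 m2; apply: (@measurability _ _ _ Om _ _ boxes) => // _ [_ [x [y ->]] <-].
rewrite setTI.
have -> : Z @^-1` box x y = \bigcap_(k in [set: 'I_D])
   ([set w | ((Z w k).1 <= x k) = true] `&` [set w | ((Z w k).2 <= y k) = true]).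
  by apply/seteqP; split => w h k; [move=> _; have [] := h k|have [] := h k I].
apply: fin_bigcap_measurable => // k _.
by apply: measurableI; apply: measurable_comparison.
Qed.

Variable P : probability T R.

Lemma law_eq_boxes (Z1 Z2 : T -> Om) :
  measurable_fun setT Z1 -> measurable_fun setT Z2 ->
  (forall x y, P (Z1 @^-1` box x y) = P (Z2 @^-1` box x y)) ->
  forall A : set Om, measurable A -> P (Z1 @^-1` A) = P (Z2 @^-1` A).
Proof.
move=> mZ1 mZ2 E A mA.
pose W1 : {mfun T >-> Om} := mfun_Sub (mem_set mZ1).
pose W2 : {mfun T >-> Om} := mfun_Sub (mem_set mZ2).
rewrite -[LHS]/(distribution P W1 A) -[RHS]/(distribution P W2 A).
apply: (@measure_unique _ R Om boxes (fun m => box (fun=> m%:R) (fun=> m%:R))) => //.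
- exact: boxes_setI.
- by move=> m; exists (fun=> m%:R), (fun=> m%:R).
- exact: bigcup_boxes.
- by move=> _ [x [y ->]]; exact: E.
move=> m; apply: le_lt_trans (ltry 1).
by apply: probability_le1; exact: measurable_box.
Qed.

End Boxes.

(** * The error bound attached to draws and a pair of orders *)

Section PatternAverage.
Variables (R : realType) (n : nat) (s : {ffun 'I_n -> 'I_n}).

(** The centre [n^2 (1 - q) / 3], with [q = (n - 1)^n / n^n], is the rank variation [S] for which
    [1 - 3 S / n^2 = q]. *)
Definition pattern_bound (a t : 'S_#|drawn s|) : R :=
  (1 + 1 / 1000) * (9 / n%:R ^+ 4 *
    (block_variation (@block_size R n s) t (a * t^-1)%g
      - n%:R ^+ 2 * (1 - (n%:R - 1) ^+ n / n%:R ^+ n) / 3) ^+ 2)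
  + (1 + 1000) * (100 * (sum_sqr_mult s)%:R ^+ 2 / n%:R ^+ 4).

Lemma pattern_bound_ge0 a t : 0 <= pattern_bound a t.
Proof.
have c1 : 0 <= 1 + 1 / 1000 :> R by lra.
have c2 : 0 <= 1 + 1000 :> R by lra.
apply: addr_ge0; apply: mulr_ge0 => //.
by apply: mulr_ge0; [apply: divr_ge0 => //; exact: exprn_ge0|exact: sqr_ge0].
Qed.

Lemma sum_pattern_bound : (0 < n)%N ->
  \sum_(at_ : 'S_#|drawn s| * 'S_#|drawn s|) pattern_bound at_.1 at_.2
  <= (#|drawn s|)`!%:R ^+ 2 * draw_bound R s.
Proof.
move=> n0; rewrite -(pair_bigA _ (fun a t => pattern_bound a t)) /= exchange_big /=.
set kappa := n%:R ^+ 2 * (1 - (n%:R - 1) ^+ n / n%:R ^+ n) / 3 : R.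
have := @block_variation_sqdev R _ (@block_size R n s) kappa (fun k =>
   le_trans ler01 (block_size_ge1 R k)).
rewrite sum_block_size sum_block_size_sqr card_drawn => H.
(* For fixed [t], multiplication by its inverse permutes the range of [a]. *)
have E t : \sum_(a : 'S_#|drawn s|) (block_variation (@block_size R n s) t (a * t^-1)%g - kappa) ^+ 2
   = \sum_(a : 'S_#|drawn s|) (block_variation (@block_size R n s) t a - kappa) ^+ 2.
  by rewrite [RHS](reindex_inj (mulIg (t^-1)%g)).
rewrite (eq_bigr (fun t : 'S_#|drawn s| => (1 + 1 / 1000) * (9 / n%:R ^+ 4) *
   (\sum_(a : 'S_#|drawn s|) (block_variation (@block_size R n s) t a - kappa) ^+ 2)
   + (#|drawn s|)`!%:R * ((1 + 1000) * (100 * (sum_sqr_mult s)%:R ^+ 2 / n%:R ^+ 4)))); last first.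
  move=> t _; rewrite big_split /= sum_perm_cst; congr (_ + _).
  by rewrite -!mulr_sumr E mulrA.
rewrite big_split /= sum_perm_cst -mulr_sumr [X in _ + X]mulrA -expr2.
rewrite /draw_bound /= -/kappa mulrDr lerD2r.
have C0 : 0 <= (1 + 1 / 1000) * (9 / n%:R ^+ 4) :> R.
  by apply: mulr_ge0; [lra|apply: divr_ge0 => //; exact: exprn_ge0].
move: C0 H; set C := (1 + 1 / 1000) * _.
clearbody C; move: (_`!%:R ^+ 2) (\sum_t _) => M Sg C0 H.
by rewrite [leRHS]mulrCA; exact: ler_wpM2l.
Qed.

Lemma bootstrap_sqdev_le (x y : 'I_n -> R) (a t : 'S_#|drawn s|) (p : 'S_n) :
  (0 < n)%N -> sorts_blocks x a -> sorts_blocks y t -> arranges (x \o s) p ->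
  (chatterjee_ties (x \o s) (y \o s) p - (n%:R - 1) ^+ n / n%:R ^+ n) ^+ 2
  <= pattern_bound a t.
Proof.
move=> n0 xa yt xp; have := chatterjee_ties_block xa yt xp n0.
have N0 : 0 < n%:R :> R by rewrite ltr0n.
rewrite /pattern_bound; move: (chatterjee_ties _ _ _) (block_variation _ _ _) => xi B.
set q := _ / n%:R ^+ n; set v := xi - _; set w := 10 * _ / _ => vw.
have -> : xi - q = v - 3 / n%:R ^+ 2 * (B - n%:R ^+ 2 * (1 - q) / 3).
  by rewrite /v; field; rewrite gt_eqF.
have -> : 9 / n%:R ^+ 4 * (B - n%:R ^+ 2 * (1 - q) / 3) ^+ 2 =
   (3 / n%:R ^+ 2 * (B - n%:R ^+ 2 * (1 - q) / 3)) ^+ 2 :> R.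
  by field; rewrite gt_eqF.
have -> : 100 * (sum_sqr_mult s)%:R ^+ 2 / n%:R ^+ 4 = w ^+ 2.
  by rewrite /w; field; rewrite gt_eqF.
have v2 : v ^+ 2 <= w ^+ 2.
  by rewrite -[v ^+ 2]real_normK ?num_real // lerXn2r ?nnegrE // (le_trans _ vw).
move: (3 / _ * _) v2 => u; clear; move: v w => v w v2.
have : 0 <= (v + u / 1000) ^+ 2 by exact: sqr_ge0.
have -> : (v + u / 1000) ^+ 2 = v ^+ 2 + v * u / 500 + u ^+ 2 / 1000 / 1000 by field.
have -> : (v - u) ^+ 2 = v ^+ 2 - 2 * (v * u) + u ^+ 2 by ring.
lra.
Qed.

End PatternAverage.

(** * Mean square errors of the two statistics *)

Section Sampling.
Context {R : realType} {d : measure_display} {T : measurableType d}.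
Variables (P : probability T R) (X Y : nat -> {RV P >-> R}).
Hypothesis indep : mutually_independent P (fun i w => (X i w, Y i w)).
Variables F G : R -> \bar R.
Hypothesis marg : forall i x y,
  P (X i @^-1` `]-oo, x] `&` Y i @^-1` `]-oo, y]) = (F x * G y)%E.
Hypothesis X_atomless : forall i x, P (X i @^-1` [set x]) = 0%E.
Hypothesis Y_atomless : forall i x, P (Y i @^-1` [set x]) = 0%E.

Let Om D := g_sigma_algebraType (@boxes R D).

Definition rearranged D (e : 'I_D -> nat) (a t : 'S_D) (w : T) : Om D :=
  fun k => (X (e (a k)) w, Y (e (t k)) w).

Lemma measurable_rearranged D (e : 'I_D -> nat) a t :
  measurable_fun setT (rearranged e a t).
Proof. by apply: measurable_to_boxes => i. Qed.

(** The constraints are regrouped by observation: [e k] carries a bound on X at place [a^-1 k] and a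
    bound on Y at place [t^-1 k]. Independence between observations, then [marg] inside each, yields
    products from which the two permutations disappear by reindexing. *)
Lemma rearranged_box D (e : 'I_D -> nat) a t x y : injective e ->
  P (rearranged e a t @^-1` box x y) = ((\prod_k F (x k)) * \prod_k G (y k))%E.
Proof.
move=> eI.
pose A i : set (R * R) :=
  [set z | forall k, e k = i -> z.1 <= x ((a^-1)%g k) /\ z.2 <= y ((t^-1)%g k)].
have mA i : measurable (A i).
  have -> : A i = \bigcap_(k in [set k | e k = i])
     ([set z : R * R | (z.1 <= x ((a^-1)%g k)) = true]
      `&` [set z | (z.2 <= y ((t^-1)%g k)) = true]).
    by apply/seteqP; split => z h k; exact: h.
  apply: fin_bigcap_measurable => // k _.
  by apply: measurableI; apply: measurable_comparison.
have uI : uniq [seq e k | k <- enum 'I_D] by rewrite map_inj_uniq // enum_uniq.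
have := indep uI mA.
have -> : \bigcap_(i in [set` [seq e k | k <- enum 'I_D]])
    ((fun w => (X i w, Y i w)) @^-1` A i) = rearranged e a t @^-1` box x y.
  apply/seteqP; split => w.
    move=> h k; split.
      have [] := h (e (a k)) _ (a k) erefl; last by rewrite permK.
      by rewrite /= map_f // mem_enum.
    have [] := h (e (t k)) _ (t k) erefl; last by rewrite permK.
    by rewrite /= map_f // mem_enum.
  move=> h i /= /mapP[k _ ->] k' /eI ->; split.
    by have [+ _] := h ((a^-1)%g k); rewrite /= permKV.
  by have [_ +] := h ((t^-1)%g k); rewrite /= permKV.
move=> ->; rewrite big_map big_enum /=.
transitivity (\prod_k (F (x ((a^-1)%g k)) * G (y ((t^-1)%g k))))%E.
  apply: eq_bigr => k _; rewrite -(marg (e k)); congr (P _).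
  apply/seteqP; split => w; rewrite /A /= !in_itv /=.
    by move=> /(_ k erefl).
  by move=> h k' /eI ->.
rewrite big_split /=; congr (_ * _)%E.
  by rewrite [RHS](reindex_inj (@perm_inj _ (a^-1)%g)).
by rewrite [RHS](reindex_inj (@perm_inj _ (t^-1)%g)).
Qed.

Definition pattern D (e : 'I_D -> nat) (a t : 'S_D) : set T :=
  rearranged e a t @^-1` increasing.

Lemma measurable_pattern D (e : 'I_D -> nat) a t : measurable (pattern e a t).
Proof.
have := @measurable_rearranged D e a t measurableT _ (@measurable_increasing R D).
by rewrite setTI.
Qed.

Lemma pattern_equiprobable D (e : 'I_D -> nat) a t : injective e ->
  P (pattern e a t) = P (pattern e 1 1).
Proof.
move=> eI; apply: law_eq_boxes.
- exact: measurable_rearranged.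
- exact: measurable_rearranged.
- by move=> x y; rewrite !rearranged_box.
exact: measurable_increasing.
Qed.

(** The position of [m] in the sorted order is the number of entries below [z m], which determines
    the inverse permutation. *)
Lemma increasing_perm_unique D (z : 'I_D -> R) (a b : 'S_D) :
  (forall k l : 'I_D, (k < l)%N -> z (a k) < z (a l)) ->
  (forall k l : 'I_D, (k < l)%N -> z (b k) < z (b l)) -> a = b.
Proof.
have cnt (c : 'S_D) : (forall k l : 'I_D, (k < l)%N -> z (c k) < z (c l)) ->
    forall m, (c^-1)%g m = #|[pred l | z l < z m]| :> nat.
  move=> cinc m; rewrite -[in RHS](permKV c m); set k := (c^-1)%g m.
  have clt l : (z (c l) < z (c k)) = (l < k)%N.
    case: (ltngtP l k) => [lk|kl|/val_inj ->]; first exact: cinc.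
      by rewrite ltNge ltW // cinc.
    by rewrite ltxx.
  rewrite -(card_imset _ (@perm_inj _ (c^-1)%g)).
  rewrite (_ : [set _ | _ in _]%SET = [set l : 'I_D | (l < k)%N]%SET).
    by rewrite cardsE -[LHS](card_ord k) -!sum1_card (big_ord_narrow (ltnW (ltn_ord k))).
  apply/setP => l; rewrite inE; apply/imsetP/idP => [[u + ->]|lk].
    by rewrite inE -clt permKV.
  by exists (c l); rewrite ?permK // inE clt.
move=> ha hb; apply: invg_inj; apply/permP => m; apply: val_inj.
by rewrite /= cnt // cnt.
Qed.

Lemma increasing_perm_exists D (z : 'I_D -> R) : injective z ->
  exists a : 'S_D, forall k l : 'I_D, (k < l)%N -> z (a k) < z (a l).
Proof.
move=> zI.
have rlt m : (#|[pred l | (z l < z m)%R]| < D)%N.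
  rewrite -[X in (_ < X)%N](card_ord D) [ltnRHS](cardD1 m) inE /= add1n ltnS.
  apply: subset_leq_card; apply/fintype.subsetP => l; rewrite !inE => lm.
  by rewrite andbT; apply: contraTneq lm => ->; rewrite ltxx.
pose r m := Ordinal (rlt m).
have rmono m m' : z m < z m' -> (r m < r m')%N.
  move=> mm'; rewrite /= [ltnRHS](cardD1 m) inE mm' add1n ltnS.
  apply: subset_leq_card; apply/fintype.subsetP => l; rewrite !inE => lm.
  rewrite (lt_trans lm mm') andbT.
  by apply: contraTneq lm => ->; rewrite ltxx.
have rI : injective r.
  move=> m m' e; apply: zI; apply/eqP; rewrite eq_le !leNgt.
  by apply/andP; split; apply/negP => /rmono; rewrite e ltnn.
exists ((perm rI)^-1)%g => k l kl; rewrite ltNge le_eqVlt; apply/negP => /orP[/eqP/zI/perm_inj e|/rmono].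
  by move: kl; rewrite e ltnn.
rewrite -!(permE rI) !permKV => lk.
by have := ltn_trans kl lk; rewrite ltnn.
Qed.

(** The [D!^2] patterns are equally likely, and disjoint because each of the two orders determines
    its sorting permutation; their total mass is at most 1. *)
Lemma pattern_prob_le D (e : 'I_D -> nat) a t : injective e ->
  (P (pattern e a t) <= ((D`!%:R ^+ 2)^-1)%:E)%E.
Proof.
move=> eI.
pose U (at_ : 'S_D * 'S_D) := pattern e at_.1 at_.2.
have tU : trivIset setT U.
  apply/trivIsetP => -[a1 t1] [a2 t2] _ _ ne; rewrite -subset0 => w [h1 h2].
  move/eqP: ne; apply; congr pair.
    by apply: (@increasing_perm_unique D (fun k => X (e k) w)) => k l kl;
      [have [] := h1 k l kl|have [] := h2 k l kl].
  by apply: (@increasing_perm_unique D (fun k => Y (e k) w)) => k l kl;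
    [have [] := h1 k l kl|have [] := h2 k l kl].
have mU p : measurable (U p) by exact: measurable_pattern.
have : (P (\bigcup_(p in [set: 'S_D * 'S_D]) U p) <= 1)%E.
  apply: probability_le1; by apply: fin_bigcup_measurable => [|p _]; [exact: finite_finset|exact: mU].
rewrite measure_fin_bigcup //; last exact: finite_finset.
rewrite fsbig_finite /=; last exact: finite_finset.
have -> : (\sum_(p <- finmap.enum_fset (fset_set [set: 'S_D * 'S_D])) P (U p) =
    \sum_(p : 'S_D * 'S_D) P (U p))%E.
  apply: perm_big; apply: uniq_perm; rewrite ?finmap.fset_uniq ?index_enum_uniq //.
  move=> p; rewrite mem_index_enum (in_fset_set finite_finset).
  by rewrite classical_sets.in_setT.
have PE b u : P (pattern e b u) = (fine (P (pattern e 1 1)))%:E.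
  by rewrite pattern_equiprobable // fineK // fin_num_measure //; exact: measurable_pattern.
rewrite (eq_bigr (fun=> (fine (P (pattern e 1 1)))%:E)); last by move=> p _; exact: PE.
rewrite sumEFin lee_fin => le1; rewrite PE lee_fin.
rewrite -[leRHS]mul1r ler_pdivlMr ?exprn_gt0 ?ltr0n ?fact_gt0 //.
by apply: le_trans le1; rewrite sumr_const card_prod -card_Sn expr2 -natrM mulr_natr.
Qed.

Lemma measurable_pair_obs i : measurable_fun setT (fun w => (X i w, Y i w)).
Proof. by apply: measurable_fun_pair. Qed.

Lemma indep_pairs i j (A B : set (R * R)) : i != j -> measurable A -> measurable B ->
  P ([set w | A (X i w, Y i w)] `&` [set w | B (X j w, Y j w)]) =
  (P [set w | A (X i w, Y i w)] * P [set w | B (X j w, Y j w)])%E.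
Proof.
move=> ij mA mB; pose C k := if k == i then A else B.
have mC k : measurable (C k) by rewrite /C; case: ifP.
have := indep (I := [:: i; j]) _ mC; rewrite /= inE ij => /(_ isT).
rewrite big_cons big_seq1 /C eqxx eq_sym (negbTE ij) => <-.
congr (P _); apply/seteqP; split => w.
  move=> [Aw Bw] k /=; rewrite !inE => /orP[|] /eqP ->; first by rewrite eqxx.
  by rewrite eq_sym (negbTE ij).
move=> h; split; first by have := h i; rewrite /= eqxx; apply; rewrite !inE eqxx.
by have := h j; rewrite /= eq_sym (negbTE ij); apply; rewrite !inE eqxx orbT.
Qed.

Lemma tie_null i j : i != j ->
  P [set w | X i w = X j w] = 0%E /\ P [set w | Y i w = Y j w] = 0%E.
Proof.
move=> ij; split; apply: independent_ties => // A B mA mB.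
  have := @indep_pairs i j [set z | A z.1] [set z | B z.1] ij.
  by apply; rewrite -[X in measurable X]setTI; exact: measurable_fst.
have := @indep_pairs i j [set z | A z.2] [set z | B z.2] ij.
by apply; rewrite -[X in measurable X]setTI; exact: measurable_snd.
Qed.

Definition untied : set T :=
  [set w | forall i j : nat, i != j -> X i w != X j w /\ Y i w != Y j w].

Lemma untied_ae : P.-negligible (~` untied).
Proof.
have mtie (U V : {RV P >-> R}) : measurable [set w | U w = V w].
  have -> : [set w | U w = V w] =
      [set w | (U w <= V w) = true] `&` [set w | (V w <= U w) = true].
    apply/seteqP; split => w /=; first by move=> ->; rewrite lexx.
    by move=> [h1 h2]; apply/eqP; rewrite eq_le h1 h2.
  by apply: measurableI; apply: measurable_comparison.
pose N i j := if i == j :> nat then set0 else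
  [set w | X i w = X j w] `|` [set w | Y i w = Y j w].
have sub : ~` untied `<=` \bigcup_i \bigcup_j N i j.
  move=> w /= /existsNP[i] /existsNP[j] /not_implyP[ij nh].
  exists i => //; exists j => //; rewrite /N (negbTE ij).
  have [e|nX] := eqVneq (X i w) (X j w); first by left.
  by have [e|nY] := eqVneq (Y i w) (Y j w); [right|case: nh].
apply: (negligibleS sub).
apply: negligible_bigcup => i; apply: negligible_bigcup => j.
rewrite /N; case: ifP => [_|/negbT ij]; first exact: negligible_set0.
have [h1 h2] := tie_null ij.
by apply: negligibleU; apply/negligibleP.
Qed.

Section SampleSize.
Variable n : nat.

Definition labels (s : {ffun 'I_n -> 'I_n}) (k : 'I_#|drawn s|) : nat := label k.

Lemma labels_inj s : injective (@labels s).
Proof. by move=> k l /val_inj/label_inj. Qed.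

Lemma pattern_sorts s a t w : pattern (@labels s) a t w ->
  sorts_blocks (fun i : 'I_n => X i w) a /\ sorts_blocks (fun i : 'I_n => Y i w) t.
Proof. by move=> h; split => k l kl; have [] := h k l kl. Qed.

Lemma untied_pattern s w : untied w -> exists a t, pattern (@labels s) a t w.
Proof.
move=> uw.
have XI : injective (fun k => X (@labels s k) w).
  move=> k l /= e; apply: (@labels_inj s); apply/eqP/negPn/negP => /uw[+ _].
  by rewrite e eqxx.
have YI : injective (fun k => Y (@labels s k) w).
  move=> k l /= e; apply: (@labels_inj s); apply/eqP/negPn/negP => /uw[_ +].
  by rewrite e eqxx.
have [a ha] := increasing_perm_exists XI.
have [t ht] := increasing_perm_exists YI.
by exists a, t => k l kl; split; [exact: ha|exact: ht].
Qed.

Lemma measurable_sample : measurable_fun setT (sample X Y n).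
Proof.
apply/measurable_fun_tnthP => i.
rewrite (_ : _ \o _ = fun w => (X i w, Y i w)); first exact: measurable_pair_obs.
by apply/funext => w; rewrite /= tnth_mktuple.
Qed.

Lemma measurable_tnth1 (i : 'I_n) :
  measurable_fun setT (fun z : n.-tuple (R * R) => (tnth z i).1).
Proof. exact: (measurableT_comp measurable_fst (measurable_tnth i)). Qed.

Lemma measurable_tnth2 (i : 'I_n) :
  measurable_fun setT (fun z : n.-tuple (R * R) => (tnth z i).2).
Proof. exact: (measurableT_comp measurable_snd (measurable_tnth i)). Qed.

Lemma pattern_sample s a t : exists2 A : set (n.-tuple (R * R)), measurable A &
  pattern (@labels s) a t = sample X Y n @^-1` A.
Proof.
exists (\bigcap_(k in [set: 'I_#|drawn s|]) \bigcap_(l in [set l : 'I_#|drawn s| | (k < l)%N])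
   ([set z : n.-tuple (R * R) | (tnth z (label (a k))).1 < (tnth z (label (a l))).1]
  `&` [set z | (tnth z (label (t k))).2 < (tnth z (label (t l))).2])).
  apply: fin_bigcap_measurable => [|k _]; first exact: finite_finset.
  apply: fin_bigcap_measurable => [|l _]; first exact: finite_finset.
  by apply: measurableI; apply: measurable_less;
    do ?[exact: measurable_tnth1|exact: measurable_tnth2].
apply/seteqP; split => w h k.
  by move=> _ l /= kl; rewrite !tnth_mktuple; exact: h.
by move=> l kl; have := h k I l kl; rewrite /= !tnth_mktuple.
Qed.

Variable J : forall n, T -> {ffun 'I_n -> 'I_n}.
Hypothesis draws : bootstrap_draws X Y J.

(** A pattern is an event of the sample, and the draws are uniform given the sample. *)
Lemma draw_pattern_prob s a t : (P (J n @^-1` [set s] `&` pattern (@labels s) a t)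
   <= ((n%:R ^+ n)^-1 * ((#|drawn s|)`!%:R ^+ 2)^-1)%:E)%E.
Proof.
have [A mA E] := pattern_sample a t.
have [_ /(_ A mA) JA] := draws s; rewrite E JA -E.
rewrite prodr_const card_ord exprVn EFinM; apply: lee_wpmul2l.
  by rewrite lee_fin invr_ge0 exprn_ge0.
exact: (pattern_prob_le _ _ (@labels_inj s)).
Qed.

(** A finite summary of the sample that suffices for every rank. Measurability of both statistics
    and the averaging over draws are reduced to it. *)
Definition comparisons (w : T) : {ffun 'I_n * 'I_n -> bool * bool} :=
  [ffun ij : 'I_n * 'I_n => (X ij.1 w <= X ij.2 w, Y ij.1 w <= Y ij.2 w)].

Lemma comparisons_sample c : exists2 A : set (n.-tuple (R * R)), measurable A &
  comparisons @^-1` [set c] = sample X Y n @^-1` A.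
Proof.
exists (\bigcap_(ij in [set: 'I_n * 'I_n])
  ([set z : n.-tuple (R * R) | ((tnth z ij.1).1 <= (tnth z ij.2).1) = (c ij).1]
   `&` [set z | ((tnth z ij.1).2 <= (tnth z ij.2).2) = (c ij).2])).
  apply: fin_bigcap_measurable => [|ij _]; first exact: finite_finset.
  by apply: measurableI; apply: measurable_comparison;
    do ?[exact: measurable_tnth1|exact: measurable_tnth2].
apply/seteqP; split => w /=.
  by move=> <- ij _; rewrite /= !tnth_mktuple ffunE.
move=> h; apply/ffunP => ij; rewrite ffunE.
have := h ij I; rewrite /= !tnth_mktuple => -[-> ->].
by case: (c ij).
Qed.

Lemma measurable_sample_set (A : set (n.-tuple (R * R))) : measurable A ->
  measurable (sample X Y n @^-1` A).
Proof. by move=> mA; rewrite -[X in measurable X]setTI; exact: measurable_sample. Qed.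

Lemma measurable_comparisons c : measurable (comparisons @^-1` [set c]).
Proof. by have [A mA ->] := comparisons_sample c; exact: measurable_sample_set. Qed.

Lemma chatterjee_ties_order (x y x' y' : 'I_n -> R) (p : 'S_n) :
  (forall i j, (x i <= x j) = (x' i <= x' j)) ->
  (forall i j, (y i <= y j) = (y' i <= y' j)) ->
  chatterjee_ties x y p = chatterjee_ties x' y' p.
Proof.
move=> xx yy.
have lr i : lrank y i = lrank y' i by apply: eq_bigr => j _; rewrite yy.
have ur i : urank y i = urank y' i by apply: eq_bigr => j _; rewrite yy.
rewrite /chatterjee_ties.
have -> : [forall i, forall j, (x i == x j) && (y i == y j)] =
    [forall i, forall j, (x' i == x' j) && (y' i == y' j)].
  by apply: eq_forallb => i; apply: eq_forallb => j; rewrite !eq_le !xx !yy.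
have -> : rank_variation y p = rank_variation y' p.
  by apply: eq_bigr => i _; apply: eq_bigr => j _; rewrite !lr.
by under eq_bigr => i _ do rewrite ur.
Qed.

Variables (srt bsrt : forall n, T -> 'S_n).
Hypothesis srt_meas : forall s : 'S_n, measurable (srt n @^-1` [set s]).
Hypothesis bsrt_meas : forall s : 'S_n, measurable (bsrt n @^-1` [set s]).
Hypothesis srtP : forall w, arranges (fun i : 'I_n => X i w) (srt n w).
Hypothesis bsrtP : forall w, arranges (@Xb R d T P X J n w) (bsrt n w).

Definition configuration (w : T) := (J n w, bsrt n w, srt n w, comparisons w).

Lemma measurable_configuration c : measurable (configuration @^-1` [set c]).
Proof.
case: c => [[[s p] r] c].
have -> : configuration @^-1` [set (s, p, r, c)] =
    (J n @^-1` [set s]) `&` (bsrt n @^-1` [set p]) `&` (srt n @^-1` [set r])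
    `&` (comparisons @^-1` [set c]).
  apply/seteqP; split => w /=; first by move=> [-> -> -> ->].
  by move=> [[[<- <-] <-] <-].
have [mJ _] := draws s.
by do !apply: measurableI => //; exact: measurable_comparisons.
Qed.

Lemma comparisonsP w w' (i j : 'I_n) : comparisons w = comparisons w' ->
  (X i w <= X j w) = (X i w' <= X j w') /\ (Y i w <= Y j w) = (Y i w' <= Y j w').
Proof. by move=> /ffunP/(_ (i, j)); rewrite !ffunE => -[]. Qed.

Lemma xi_b_config w w' : configuration w = configuration w' ->
  xi_b X Y J bsrt n w = xi_b X Y J bsrt n w'.
Proof.
move=> [Jw bw _ cw]; rewrite /xi_b bw; apply: chatterjee_ties_order => i j;
  by rewrite /Xb /Yb Jw; have [] := comparisonsP (J n w' i) (J n w' j) cw.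
Qed.

Lemma xi_n_config w w' : configuration w = configuration w' ->
  xi_n Y srt n w = xi_n Y srt n w'.
Proof.
move=> [_ _ sw cw]; rewrite /xi_n sw /chatterjee; congr (1 - _ * _).
have lr i : lrank (fun i : 'I_n => Y i w) i = lrank (fun i : 'I_n => Y i w') i.
  by apply: eq_bigr => j _; have [_ ->] := comparisonsP j i cw.
by apply: eq_bigr => i _; apply: eq_bigr => j _; rewrite !lr.
Qed.

Lemma measurable_xi_b : measurable_fun setT (xi_b X Y J bsrt n).
Proof. exact: measurable_finite_factor measurable_configuration _ xi_b_config. Qed.

Lemma measurable_xi_n : measurable_fun setT (xi_n Y srt n).
Proof. exact: measurable_finite_factor measurable_configuration _ xi_n_config. Qed.

Let q : R := (n%:R - 1) ^+ n / n%:R ^+ n.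

(** Up to ties, the space is covered by the events that fix the draws and the two orders of the
    drawn observations, and on each of them [bootstrap_sqdev_le] is deterministic. The number of
    permuted points depends on the draws, whence the dependent index type. *)
Lemma xi_b_sqdev : (0 < n)%N ->
  (\int[P]_w ((xi_b X Y J bsrt n w - q) ^+ 2)%:E <=
   ((n%:R ^+ n)^-1 * \sum_(s : {ffun 'I_n -> 'I_n}) draw_bound R s)%:E)%E.
Proof.
move=> n0.
pose I := {s : {ffun 'I_n -> 'I_n} & ('S_#|drawn s| * 'S_#|drawn s|)%type}.
pose U (u : I) := J n @^-1` [set tag u] `&`
  pattern (@labels (tag u)) (tagged u).1 (tagged u).2.
pose c (u : I) : R := pattern_bound R (tagged u).1 (tagged u).2.
have mU u : measurable (U u).
  by apply: measurableI; [have [] := draws (tag u)|exact: measurable_pattern].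
have Uc u w : U u w -> (xi_b X Y J bsrt n w - q) ^+ 2 <= c u.
  case: u => s [a t] [/= Js]; rewrite /c /=; case: s / Js a t => a t /pattern_sorts[xa yt].
  exact: (bootstrap_sqdev_le n0 xa yt (bsrtP w)).
have cov : P.-negligible (~` \bigcup_u U u).
  apply: negligibleS untied_ae => w nU uw; apply: nU.
  have [a [t at_]] := untied_pattern (J n w) uw.
  by exists (Tagged (fun s => ('S_#|drawn s| * 'S_#|drawn s|)%type) (a, t)).
apply: (le_trans (integral_le_cover _ _ mU (fun u => pattern_bound_ge0 R _ _) Uc cov)).
- by apply: measurable_funX; apply: measurable_funB => //; exact: measurable_xi_b.
- by move=> w; exact: sqr_ge0.
apply: (@le_trans _ _ (\sum_(u : I) (c u * ((n%:R ^+ n)^-1 *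
   ((#|drawn (tag u)|)`!%:R ^+ 2)^-1))%:E)%E).
  apply: lee_sum => u _; rewrite EFinM lee_wpmul2l ?lee_fin ?pattern_bound_ge0 //.
  exact: draw_pattern_prob.
rewrite sumEFin lee_fin mulr_sumr.
have -> : \sum_(u : I) (c u * ((n%:R ^+ n)^-1 * ((#|drawn (tag u)|)`!%:R ^+ 2)^-1)) =
  \sum_(s : {ffun 'I_n -> 'I_n}) \sum_(at_ : 'S_#|drawn s| * 'S_#|drawn s|)
     (pattern_bound R at_.1 at_.2 * ((n%:R ^+ n)^-1 * ((#|drawn s|)`!%:R ^+ 2)^-1)).
  by rewrite sig_big_dep.
apply: ler_sum => s _; rewrite -mulr_suml mulrCA ler_wpM2l ?invr_ge0 ?exprn_ge0 //.
rewrite ler_pdivrMr ?exprn_gt0 ?ltr0n ?fact_gt0 // mulrC.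
exact: sum_pattern_bound.
Qed.

(** The original sample is the outcome of the identity draw, with [n] blocks of size one. The centre
    [(n^2 - 1) / 3] is the exact mean of the rank variation, so the bias vanishes; 100 is a generous
    replacement of the asymptotic [2/5]. *)
Lemma xi_n_sqr : (1 < n)%N ->
  (\int[P]_w ((xi_n Y srt n w) ^+ 2)%:E <= (100 / n%:R)%:E)%E.
Proof.
move=> n1; have n0 : (0 < n)%N by rewrite ltnW.
have N1 : 2 <= n%:R :> R by rewrite ler_nat.
pose s : {ffun 'I_n -> 'I_n} := [ffun i => i].
have sE (x : 'I_n -> R) : x \o s = x by apply/funext => i; rewrite /= ffunE.
have mult1 i : multiplicity s i = 1%N.
  rewrite /multiplicity (bigD1 i) //= ffunE eqxx big1 // => j /negbTE.
  by rewrite ffunE => ->.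
have ssE : (sum_sqr_mult s)%:R = n%:R :> R.
  by rewrite /sum_sqr_mult (eq_bigr (fun=> 1%N)) ?sum1_card ?card_ord // => i _; rewrite mult1.
have DE : #|drawn s|%:R = n%:R :> R.
  by rewrite card_drawn /missed big1 ?subr0 // => i _; rewrite mult1.
set M : R := ((#|drawn s|)`!%:R ^+ 2).
have M0 : 0 < M by rewrite exprn_gt0 ?ltr0n ?fact_gt0.
pose kappa : R := (n%:R ^+ 2 - 1) / 3.
have k0 : 0 < n%:R ^+ 2 - 1 :> R.
  by rewrite subr_gt0 expr_gt1 ?ltr1n.
pose c (at_ : 'S_#|drawn s| * 'S_#|drawn s|) : R := (3 / (n%:R ^+ 2 - 1)) ^+ 2 *
  (block_variation (@block_size R n s) at_.2 (at_.1 * at_.2^-1)%g - kappa) ^+ 2.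
pose U (at_ : 'S_#|drawn s| * 'S_#|drawn s|) := pattern (@labels s) at_.1 at_.2.
have mU u : measurable (U u) by exact: measurable_pattern.
have Uc u w : U u w -> xi_n Y srt n w ^+ 2 <= c u.
  move=> /pattern_sorts[xa yt]; rewrite /c -exprMn /xi_n /chatterjee.
  have := rank_variation_block xa yt; rewrite !sE => ->; last exact: srtP.
  rewrite -sqrrN le_eqVlt; apply/orP; left; apply/eqP; congr (_ ^+ 2).
  by rewrite /kappa; field; rewrite gt_eqF.
have cov : P.-negligible (~` \bigcup_u U u).
  apply: negligibleS untied_ae => w nU uw; apply: nU.
  by have [a [t at_]] := untied_pattern s uw; exists (a, t).
apply: (le_trans (integral_le_cover _ _ mU _ Uc cov)).
- by apply: measurable_funX; exact: measurable_xi_n.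
- by move=> w; exact: sqr_ge0.
- by move=> u; rewrite mulr_ge0 ?sqr_ge0.
apply: (@le_trans _ _ (\sum_u (c u * M^-1)%:E)%E).
  apply: lee_sum => u _; rewrite [(c u * _)%:E]EFinM; apply: lee_wpmul2l.
    by rewrite lee_fin mulr_ge0 ?sqr_ge0.
  exact: (pattern_prob_le _ _ (@labels_inj s)).
rewrite sumEFin lee_fin -mulr_suml -mulr_sumr.
rewrite -(pair_bigA _ (fun a t => (block_variation (@block_size R n s) t (a * t^-1)%g - kappa) ^+ 2)) /=.
rewrite exchange_big /=.
have E t : \sum_(a : 'S_#|drawn s|) (block_variation (@block_size R n s) t (a * t^-1)%g - kappa) ^+ 2
   = \sum_(a : 'S_#|drawn s|) (block_variation (@block_size R n s) t a - kappa) ^+ 2.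
  by rewrite [RHS](reindex_inj (mulIg (t^-1)%g)).
rewrite (eq_bigr _ (fun t _ => E t)).
have := @block_variation_sqdev R _ (@block_size R n s) kappa (fun k =>
   le_trans ler01 (block_size_ge1 R k)).
rewrite sum_block_size sum_block_size_sqr ssE DE -/M => H.
have V0 : 0 <= (3 / (n%:R ^+ 2 - 1)) ^+ 2 :> R by exact: sqr_ge0.
rewrite ler_pdivrMr //; apply: (le_trans (ler_wpM2l V0 H)).
rewrite mulrCA [leRHS]mulrC ler_pM2l //.
have -> : n%:R * (n%:R ^+ 2 - 1) / (3 * n%:R) - kappa = 0 :> R.
  by rewrite /kappa; field; rewrite gt_eqF //; lra.
move: (n%:R : R) N1 k0 => N N1 k0.
have N0 : 0 < N by lra.
rewrite expr0n /= addr0 expr_div_n.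
rewrite mulrAC ler_pdivrMr ?exprn_gt0 // [leRHS]mulrAC ler_pdivlMr //.
rewrite -subr_ge0.
have [m [m0 ->]] : exists m, 0 <= m /\ N = m + 2 by exists (N - 2); split; lra.
rewrite (_ : _ - _ = 498 / 5 * m ^+ 4 + 3894 / 5 * m ^+ 3 + 10412 / 5 * m ^+ 2
   + 10856 / 5 * m + 3748 / 5); last by field.
have := exprn_ge0 4 m0; have := exprn_ge0 3 m0; have := exprn_ge0 2 m0.
move: (m ^+ 4) (m ^+ 3) (m ^+ 2) m0 => m4 m3 m2; lra.
Qed.

(** Each class of comparisons is an event of the sample, on which the draws average uniformly. *)
Lemma integral_draws_comparisons (A : set (n.-tuple (R * R)))
    (psi : {ffun 'I_n -> 'I_n} -> {ffun 'I_n * 'I_n -> bool * bool} -> R) :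
  measurable A ->
  (\int[P]_(w in sample X Y n @^-1` A) (psi (J n w) (comparisons w))%:E =
   (\sum_c (\sum_s psi s c) * ((n%:R ^+ n)^-1 *
     fine (P (sample X Y n @^-1` A `&` comparisons @^-1` [set c]))))%:E)%E.
Proof.
move=> mA; have mSA := measurable_sample_set mA.
pose U sc := (J n @^-1` [set sc.1]) `&` (comparisons @^-1` [set sc.2]).
have mU sc : measurable (U sc).
  by apply: measurableI; [have [] := draws sc.1|exact: measurable_comparisons].
transitivity (\int[P]_(w in sample X Y n @^-1` A)
   (\sum_sc psi sc.1 sc.2 * \1_(U sc) w)%:E)%E.
  apply: eq_integral => w _; congr (_%:E).
  rewrite (bigD1 (J n w, comparisons w)) //= indicE mem_set // mulr1 big1 ?addr0 //.
  move=> sc ne; rewrite indicE memNset ?mulr0 // => -[/= e1 e2].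
  by case/eqP: ne; rewrite e1 e2; case: (sc).
rewrite integral_finite_simple //; congr (_%:E).
rewrite -(pair_bigA _ (fun s c => psi s c * fine (P (sample X Y n @^-1` A `&` U (s, c))))) /=.
rewrite exchange_big; apply: eq_bigr => c _ /=.
rewrite mulr_suml; apply: eq_bigr => s _; congr (_ * _).
have [B mB cB] := comparisons_sample c.
have -> : sample X Y n @^-1` A `&` U (s, c) = J n @^-1` [set s] `&` sample X Y n @^-1` (A `&` B).
  by rewrite /U /= cB setICA.
rewrite cB; have [_ ->] := draws s; last exact: measurableI.
rewrite prodr_const card_ord exprVn fineM ?fin_num_measure //.
by apply: measurable_sample_set; exact: measurableI.
Qed.

(** Without ties in the original sample, [bsrt] is free only in ordering copies of the same
    observation, and [rank_variation_block] shows that this leaves the statistic unchanged.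
    Conditional means thereby become averages over the draws. *)
Lemma xi_b_untied : exists phi, forall w, untied w ->
  xi_b X Y J bsrt n w = phi (J n w) (comparisons w).
Proof.
have same w w' : untied w -> untied w' -> J n w = J n w' ->
    comparisons w = comparisons w' -> xi_b X Y J bsrt n w = xi_b X Y J bsrt n w'.
  move=> uw uw' Jw cw.
  have [a [t /pattern_sorts[xa yt]]] := untied_pattern (J n w) uw.
  have xa' : sorts_blocks (fun i : 'I_n => X i w') a.
    move=> k l kl; have := xa k l kl; rewrite !ltNge.
    by have [-> _] := comparisonsP (label (a l)) (label (a k)) cw.
  have yt' : sorts_blocks (fun i : 'I_n => Y i w') t.
    move=> k l kl; have := yt k l kl; rewrite !ltNge.
    by have [_ ->] := comparisonsP (label (t l)) (label (t k)) cw.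
  have e1 := rank_variation_block xa yt (bsrtP w).
  have bw' : arranges ((fun i : 'I_n => X i w') \o J n w) (bsrt n w').
    by rewrite Jw; exact: bsrtP.
  have e2 := rank_variation_block xa' yt' bw'.
  have E : xi_b X Y J bsrt n w =
     chatterjee_ties (@Xb _ _ _ _ X J n w') (@Yb _ _ _ _ Y J n w') (bsrt n w).
    by apply: chatterjee_ties_order => i j; rewrite /Xb /Yb Jw;
      have [] := comparisonsP (J n w' i) (J n w' j) cw.
  have e3 : rank_variation (@Yb _ _ _ _ Y J n w') (bsrt n w) =
      rank_variation (@Yb _ _ _ _ Y J n w) (bsrt n w).
    have lr i : lrank (@Yb _ _ _ _ Y J n w') i = lrank (@Yb _ _ _ _ Y J n w) i.
      apply: eq_bigr => j _; rewrite /Yb Jw.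
      by have [_ ->] := comparisonsP (J n w' j) (J n w' i) cw.
    by apply: eq_bigr => i _; apply: eq_bigr => j _; rewrite !lr.
  rewrite E /xi_b /chatterjee_ties; case: ifP => // _.
  have -> // : rank_variation (@Yb _ _ _ _ Y J n w') (bsrt n w) =
     rank_variation (@Yb _ _ _ _ Y J n w') (bsrt n w').
  rewrite e3; apply: (etrans e1); rewrite -e2 Jw //.
have /choice[phi phiP] : forall sc, exists v, forall w, untied w ->
    (J n w, comparisons w) = sc -> xi_b X Y J bsrt n w = v.
  move=> sc; have [[w [uw we]]|no] := pselect (exists w, untied w /\ (J n w, comparisons w) = sc).
    exists (xi_b X Y J bsrt n w) => w' uw' w'e.
    by move: we; rewrite -w'e => -[e1 e2]; apply: same.
  by exists 0 => w uw we; case: no; exists w.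
by exists (fun s c => phi (s, c)) => w uw; exact: phiP.
Qed.

(** * The conditional mean given the sample *)

Section ConditionalMean.
Variable m : T -> R.
Hypothesis mP : cond_exp_version P (sample X Y n) (xi_b X Y J bsrt n) m.

Lemma measurable_cond_mean : measurable_fun setT m.
Proof.
move=> _ B mB; rewrite setTI; have [/(_ B mB) [A mA <-] _ _] := mP.
by rewrite setTI; exact: measurable_sample_set.
Qed.

(** Almost sure uniqueness of conditional expectations: the events where [m] lies above or below
    [h], treated together in [side] with a sign [eps], belong to the sample, and the difference
    integrates to zero on each. *)
Lemma cond_mean_ae (h : {ffun 'I_n * 'I_n -> bool * bool} -> R) :
  (forall A : set (n.-tuple (R * R)), measurable A ->
    (\int[P]_(w in sample X Y n @^-1` A) (h (comparisons w))%:E =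
     \int[P]_(w in sample X Y n @^-1` A) (m w)%:E)%E) ->
  P.-negligible [set w | m w != h (comparisons w)].
Proof.
move=> hm.
have mh : measurable_fun setT (h \o comparisons).
  by apply: (measurable_finite_factor measurable_comparisons) => w w' /= ->.
have [M _ hM] := @bounded_finite_factor R _ _ _ comparisons (h \o comparisons)
  (fun w w' e => congr1 h e).
have inth := bounded_integrable P mh hM.
have [_ intm _] := mP.
have side (eps : R) (E := [set w | 0 < eps * (m w - h (comparisons w))]) :
    P.-negligible E.
  have [A mA EA] : exists2 A : set (n.-tuple (R * R)), measurable A & E = sample X Y n @^-1` A.
    have half c : exists2 A : set (n.-tuple (R * R)), measurable A &
        [set w | 0 < eps * (m w - h c)] = sample X Y n @^-1` A.
      have mB : measurable [set r : R | 0 < eps * (r - h c)].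
        have -> : [set r : R | 0 < eps * (r - h c)] = (fun r => eps * (r - h c)) @^-1` `]0, +oo[.
          by apply/seteqP; split => r /=; rewrite in_itv /= andbT.
        rewrite -[X in measurable X]setTI; apply: measurable_funM => //.
        exact: measurable_funB.
      have [/(_ _ mB) [A mA e] _ _] := mP; exists A => //.
      by move: e; rewrite setTI => ->.
    have /choice[A AP] : forall c, exists A : set (n.-tuple (R * R)), measurable A /\
        [set w | 0 < eps * (m w - h c)] `&` comparisons @^-1` [set c] = sample X Y n @^-1` A.
      move=> c; have [A mA ->] := half c; have [B mB ->] := comparisons_sample c.
      by exists (A `&` B); split; [exact: measurableI|].
    exists (\bigcup_c A c).
      by apply: fin_bigcup_measurable => [|c _]; [exact: finite_finset|have [] := AP c].
    apply/seteqP; split => w.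
      move=> Ew; exists (comparisons w) => //.
      by have [_ e] := AP (comparisons w); rewrite -[A _ _]/((sample X Y n @^-1` A (comparisons w)) w) -e.
    move=> [c _ Acw]; have [_ e] := AP c.
    have : (sample X Y n @^-1` A c) w by [].
    by rewrite -e => -[+ cw]; rewrite /E /= cw.
  have mE : measurable E by rewrite EA; exact: measurable_sample_set.
  have mdiff : measurable_fun E (fun w => (eps * (m w - h (comparisons w)))%:E).
    apply/measurable_EFinP; apply: measurable_funTS.
    by apply: measurable_funM => //; apply: measurable_funB => //; exact: measurable_cond_mean.
  have int0 : (\int[P]_(w in E) `|(eps * (m w - h (comparisons w)))%:E| = 0)%E.
    rewrite (eq_integral (fun w => eps%:E * ((m w)%:E - (h (comparisons w))%:E))%E); last first.
      by move=> w; rewrite inE /E /= => Ew; rewrite ger0_norm // ltW.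
    have im : P.-integrable E (EFin \o m) by exact: integrableS intm.
    have ih : P.-integrable E (EFin \o (h \o comparisons)) by exact: integrableS inth.
    rewrite integralZl //; last exact: integrableB.
    rewrite integralB // EA /= hm // subee ?mule0 //.
    by rewrite -EA; exact: integrable_fin_num.
  have /(ae_eq_integral_abs _ mE mdiff)[N [mN N0 sub]] := int0.
  exists N; split => //; apply: subset_trans sub => w Ew /= H.
  have := H Ew; rewrite /E /= in Ew => -[e].
  by move: Ew; rewrite e ltxx.
apply: (negligibleS _ (negligibleU (side 1) (side (-1)))) => w /=.
rewrite neq_lt mul1r mulN1r oppr_gt0 subr_gt0 subr_lt0 => /orP[]; by [right|left].
Qed.

(** Almost surely [m] is, on each class of comparisons, the average of [phi] over the draws, and an
    average minimises the sum of squared distances. *)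
Lemma cond_mean_optimal (k : R) :
  (\int[P]_w ((xi_b X Y J bsrt n w - m w) ^+ 2)%:E <=
   \int[P]_w ((xi_b X Y J bsrt n w - k) ^+ 2)%:E)%E.
Proof.
have [phi phiP] := xi_b_untied.
have W0 : 0 < n%:R ^+ n :> R.
  by case: (n) => [|k']; rewrite ?expr0 // exprn_gt0 // ltr0n.
pose h c : R := (n%:R ^+ n)^-1 * \sum_s phi s c.
have mxb := measurable_xi_b; have mm := measurable_cond_mean.
have mJC (psi : {ffun 'I_n -> 'I_n} -> {ffun 'I_n * 'I_n -> bool * bool} -> R) :
    measurable_fun setT (fun w => psi (J n w) (comparisons w)).
  by apply: (measurable_finite_factor measurable_configuration) => w w' [-> _ _ ->].
have mh : P.-negligible [set w | m w != h (comparisons w)].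
  apply: cond_mean_ae => A mA; have [_ _ ->] := mP; last by [].
  transitivity (\int[P]_(w in sample X Y n @^-1` A) (phi (J n w) (comparisons w))%:E)%E; last first.
    apply: ae_eq_integral => //; first exact: measurable_sample_set.
    - exact/measurable_EFinP/measurable_funTS.
    - exact/measurable_EFinP/measurable_funTS.
    apply: negligibleS untied_ae => w /= H uw; apply: H => _.
    by rewrite phiP.
  rewrite (integral_draws_comparisons (fun _ c => h c)) // (integral_draws_comparisons phi) //.
  congr (_%:E); apply: eq_bigr => c _; by rewrite sum_draws_cst /h mulVKf // gt_eqF.
have mN : P.-negligible (~` untied `|` [set w | m w != h (comparisons w)]).
  by apply: negligibleU => //; exact: untied_ae.
rewrite (@ae_eq_integral _ _ _ P setT (fun w => ((phi (J n w) (comparisons w) - h (comparisons w)) ^+ 2)%:E)) //; last first.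
- apply: negligibleS mN => w /= H; apply: contrapT => /not_orP[/contrapT uw /negP/negPn/eqP mw].
  by apply: H => _; rewrite phiP // mw.
- by apply/measurable_EFinP; exact: (mJC (fun s c => (phi s c - h c) ^+ 2)).
- by apply/measurable_EFinP; apply: measurable_funX; apply: measurable_funB.
rewrite [leRHS](@ae_eq_integral _ _ _ P setT (fun w => ((phi (J n w) (comparisons w) - k) ^+ 2)%:E)) //; last first.
- apply: negligibleS mN => w /= H; apply: contrapT => /not_orP[/contrapT uw _].
  by apply: H => _; rewrite phiP.
- by apply/measurable_EFinP; exact: (mJC (fun s c => (phi s c - k) ^+ 2)).
- by apply/measurable_EFinP; apply: measurable_funX; apply: measurable_funB.
have := integral_draws_comparisons (fun s c => (phi s c - h c) ^+ 2) (@measurableT _ _).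
have := integral_draws_comparisons (fun s c => (phi s c - k) ^+ 2) (@measurableT _ _).
rewrite !preimage_setT => -> ->; rewrite lee_fin; apply: ler_sum => c _.
apply: ler_wpM2r.
  by rewrite mulr_ge0 ?invr_ge0 ?(ltW W0) // fine_ge0.
rewrite -subr_ge0 -sumrB.
rewrite (eq_bigr (fun s => 2 * (h c - k) * (phi s c - h c) + (h c - k) ^+ 2)); last first.
  by move=> s _; ring.
have Eh : n%:R ^+ n * h c = \sum_s phi s c by rewrite /h mulVKf // gt_eqF.
rewrite big_split /= -mulr_sumr sumrB !sum_draws_cst Eh subrr mulr0 add0r.
by rewrite mulr_ge0 ?sqr_ge0 ?ltW.
Qed.

End ConditionalMean.

End SampleSize.

End Sampling.

(** * Second moment of a normal limit *)

Section NormalMoment.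
Context {R : realType} (s : R).
Hypothesis s_neq0 : s != 0.
Notation mu := (@lebesgue_measure R).
Notation phi := (normal_pdf 0 s).

Let is_derive_normal_pdf (x : R) : is_derive x 1 phi (- (x / s ^+ 2) * phi x).
Proof.
have -> : phi = normal_peak s \*: (expR \o (fun y => - (s ^+ 2 *+ 2)^-1 * y ^+ 2)).
  rewrite normal_pdfE//; apply/funext => y /=; rewrite /normal_fun subr0.
  by rewrite mulNr mulNr [X in expR (- X)]mulrC.
have s2 : s ^+ 2 != 0 by rewrite expf_neq0.
have dp : is_derive x 1 (fun y : R => - (s ^+ 2 *+ 2)^-1 * y ^+ 2) (- (x / s ^+ 2)).
  apply: is_derive_eq; rewrite /GRing.scale /= ?expr1.
  by field.
refine (is_derive_eq
  (is_deriveZ (normal_peak s) (is_derive1_comp (is_derive_expR _) dp)) _).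
by rewrite /= /GRing.scale /=; ring.
Qed.

Let is_derive_xphi (x : R) :
  is_derive x 1 (fun y => - s ^+ 2 * (y * phi y)) (x ^+ 2 * phi x - s ^+ 2 * phi x).
Proof.
have s2 : s ^+ 2 != 0 by rewrite expf_neq0.
refine (is_derive_eq (is_deriveZ (- s ^+ 2)
  (is_deriveM (is_derive_id x 1) (is_derive_normal_pdf x))) _).
by rewrite /= /GRing.scale /=; field.
Qed.

Let continuous_xxphi : continuous (fun x : R => x ^+ 2 * phi x).
Proof.
move=> x; apply: cvgM; first exact: sqr_continuous.
exact: continuous_normal_pdf.
Qed.

(** Integration by parts: [- s^2 x phi x] is a primitive of [x^2 phi x - s^2 phi x]. *)
Lemma integral_sqr_normal_pdf_itv (M : R) : 0 < M ->
  (\int[mu]_(x in `[(- M)%R, M]) (x ^+ 2 * phi x)%:E =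
   (s ^+ 2)%:E * normal_prob 0 s `[(- M)%R, M] - (2 * s ^+ 2 * M * phi M)%:E)%E.
Proof.
move=> M0.
have cs : continuous (fun x : R => s ^+ 2 * phi x).
  by move=> x; apply: cvgM; [exact: cvg_cst|exact: continuous_normal_pdf].
have cd : continuous (fun x : R => x ^+ 2 * phi x - s ^+ 2 * phi x).
  move=> x; apply: (@cvgB _ R^o); [exact: continuous_xxphi|exact: cs].
have integ (f : R -> R) : continuous f -> mu.-integrable `[(- M)%R, M] (EFin \o f).
  move=> cf; apply: continuous_compact_integrable; first exact: segment_compact.
  exact: continuous_subspaceT.
have FTC : (\int[mu]_(x in `[(- M)%R, M]) (x ^+ 2 * phi x - s ^+ 2 * phi x)%:E =
   (- s ^+ 2 * (M * phi M))%:E - (- s ^+ 2 * (- M * phi (- M)))%:E)%E.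
  have dF (x : R) := is_derive_xphi x.
  have cF : continuous (fun y : R => - s ^+ 2 * (y * phi y)).
    move=> x; apply/differentiable_continuous/derivable1_diffP.
    by have [] := dF x.
  apply: (@continuous_FTC2 _ _ (fun y => - s ^+ 2 * (y * phi y))).
  - lra.
  - exact: continuous_subspaceT.
  - split.
    + by move=> x _; have [] := dF x.
    + exact/cvg_at_right_filter/cF.
    + exact/cvg_at_left_filter/cF.
  - by move=> x _; rewrite derive1E; have [] := dF x.
have -> : (\int[mu]_(x in `[(- M)%R, M]) (x ^+ 2 * phi x)%:E =
   \int[mu]_(x in `[(- M)%R, M])
     ((x ^+ 2 * phi x - s ^+ 2 * phi x)%:E + (s ^+ 2 * phi x)%:E))%E.
  by apply: eq_integral => x _; rewrite -EFinD subrK.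
rewrite integralD//=; [|exact: integ cd|exact: integ cs].
rewrite FTC addrC; congr (_ + _)%E.
  under eq_integral do rewrite EFinM.
  rewrite integralZl//; apply: (integ phi); exact: continuous_normal_pdf.
rewrite -!EFinN -EFinD; congr EFin.
have -> : phi (- M) = phi M.
  by rewrite normal_pdfE// /normal_fun !subr0 sqrrN.
ring.
Qed.

Let mul_normal_pdf_le (M : R) : 0 < M ->
  M * phi M <= normal_peak s * (2 * s ^+ 2) * M^-1.
Proof.
move=> M0; rewrite normal_pdfE// /normal_fun subr0 mulNr expRN.
have s2 : 0 < s ^+ 2 by rewrite exprn_even_gt0.
rewrite mulrCA -mulrA; apply: ler_wpM2l; first exact: normal_peak_ge0.
set y := M ^+ 2 / _.
have y0 : 0 < y by rewrite /y divr_gt0 ?exprn_gt0 ?mulrn_wgt0.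
apply: (@le_trans _ _ (M * y^-1)).
  rewrite ler_pM2l// lef_pV2 ?posrE ?expR_gt0//.
  by apply: le_trans (expR_ge1Dx y); rewrite lerDr.
rewrite le_eqVlt; apply/orP; left; apply/eqP; rewrite /y.
have := gt_eqF s2; have := gt_eqF M0; move=> /negbT M1 /negbT s1.
by field; rewrite M1.
Qed.

(** The integrals over [[- M, M]] tend to [s^2], the boundary term [M * phi M] being of order at
    most [1 / M]. *)
Lemma normal_second_moment_ge :
  ((s ^+ 2)%:E <= \int[mu]_x (x ^+ 2 * phi x)%:E)%E.
Proof.
pose Q : probability (measurableTypeR R) R := normal_prob 0 s.
pose M k : R := k.+1%:R.
have M0 k : 0 < M k by rewrite ltr0n.
pose u k := s ^+ 2 * fine (Q `[(- M k)%R, M k]%classic) - 2 * s ^+ 2 * (M k * phi (M k)).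
have uI k : ((u k)%:E <= \int[mu]_x (x ^+ 2 * phi x)%:E)%E.
  have := integral_sqr_normal_pdf_itv (M0 k).
  rewrite -[normal_prob 0 s _]fineK ?fin_num_measure//.
  rewrite -EFinM -EFinB -mulrA => <-.
  apply: ge0_subset_integral => //.
  - apply/measurable_EFinP; apply: measurable_funM; last exact: measurable_normal_pdf.
    exact: measurable_funX.
  - by move=> x _; rewrite lee_fin mulr_ge0 ?sqr_ge0 ?normal_pdf_ge0.
have Qcvg : fine (Q `[(- M k)%R, M k]%classic) @[k --> \oo] --> (1 : R).
  have bigT : \bigcup_k `[(- M k)%R, M k]%classic = [set: R].
    rewrite -subTset => x _; exists (Num.truncn `|x|) => //=.
    by rewrite in_itv/= -ler_norml /M ltW// truncnS_gt.
  have : (Q \o (fun k => `[(- M k)%R, M k]%classic)) k @[k --> \oo] --> Q setT.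
    rewrite -bigT; apply: nondecreasing_cvg_mu => //.
    - by rewrite bigT.
    - move=> a b ab; apply/subsetPset/subset_itv; rewrite bnd_simp /= ?lerN2 ler_nat ltnS//.
  rewrite probability_setT => /fine_cvgP[_]; exact.
have pcvg : M k * phi (M k) @[k --> \oo] --> (0 : R).
  apply: (@squeeze_cvgr _ _ _ _ (fun=> 0)
    (fun k => normal_peak s * (2 * s ^+ 2) * (M k)^-1)).
  - near=> k; rewrite mul_normal_pdf_le// andbT.
    by rewrite mulr_ge0 ?normal_pdf_ge0 ?ltW.
  - exact: cvg_cst.
  - rewrite -[X in _ --> X](mulr0 (normal_peak s * (2 * s ^+ 2))).
    apply: cvgM; first exact: cvg_cst.
    exact: (@cvg_harmonic R).
have ucvg : u k @[k --> \oo] --> s ^+ 2.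
  rewrite -[X in _ --> X]mulr1 -[X in _ --> X]subr0 -(mulr0 (2 * s ^+ 2)).
  apply: (@cvgB _ R^o); apply: cvgM => //; exact: cvg_cst.
have uEcvg : (u k)%:E @[k --> \oo] --> (s ^+ 2)%:E 
  by apply: cvg_EFin; [exact: nearW|exact: ucvg].
rewrite -(cvg_lim (@ereal_hausdorff _) uEcvg).
apply: lime_le; first by apply/cvg_ex; eexists; exact: uEcvg.
by near=> k; exact: uI.
Unshelve. all: by end_near. Qed.

Let Q : probability (measurableTypeR R) R := normal_prob 0 s.

Let normal_cdf_lipschitz (a b : R) : a <= b ->
  fine (Q `]-oo, a]%classic) <= fine (Q `]-oo, b]%classic) <=
  fine (Q `]-oo, a]%classic) + normal_peak s * (b - a).
Proof.
move=> ab.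
have split_ray : `]-oo, b]%classic = `]-oo, a]%classic `|` `]a, b]%classic :> set R.
  by rewrite -itv_bndbnd_setU // bnd_simp.
have disj : [disjoint `]-oo, a]%classic & `]a, b]%classic : set R].
  apply/disj_setPS => x /= []; rewrite !in_itv /= => xa /andP[ax _].
  by move: (lt_le_trans ax xa); rewrite ltxx.
have add : Q `]-oo, b]%classic = (Q `]-oo, a]%classic + Q `]a, b]%classic)%E.
  rewrite split_ray measureU//; exact/disj_set2P.
have {}add : fine (Q `]-oo, b]%classic) =
    fine (Q `]-oo, a]%classic) + fine (Q `]a, b]%classic).
  by rewrite add fineD// fin_num_measure.
rewrite add lerDl fine_ge0 ?measure_ge0//= lerD2l.
rewrite -lee_fin fineK ?fin_num_measure//.
apply: (@le_trans _ _ (\int[mu]_(x in `]a, b]) (normal_peak s)%:E)%E).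
  apply: ge0_le_integral => //=.
  - by move=> x _; rewrite lee_fin normal_pdf_ge0.
  - apply/measurable_funTS/measurable_EFinP; exact: measurable_normal_pdf.
  - by move=> x _; rewrite lee_fin normal_pdf_ub.
rewrite integral_cst//= lebesgue_measure_itv/= lte_fin EFinM.
by have [_|ba] := ltP a b; [rewrite EFinB|
  rewrite (_ : b - a = 0) ?mule0//; apply/eqP; rewrite subr_eq0 eq_le ab ba].
Qed.

Lemma normal_cdf_continuous :
  continuous (fun u : R => fine (normal_prob 0 s `]-oo, u]%classic)).
Proof.
move=> u; apply/cvgrPdist_le => e e0.
have p0 := normal_peak_gt0 s_neq0.
have d0 : 0 < e / normal_peak s by rewrite divr_gt0.
near=> t.
have ut : `|u - t| <= e / normal_peak s 
  by near: t; apply: cvgr_dist_le d0; exact: cvg_id.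
have {}ut : normal_peak s * `|u - t| <= e by rewrite mulrC -ler_pdivlMr.
case: (leP u t) => [|/ltW] /[dup] ord /normal_cdf_lipschitz /andP[lo hi].
- rewrite distrC ger0_norm ?subr_ge0// lerBlDl; apply: le_trans hi _.
  by rewrite lerD2l -(ger0_norm (x := t - u)) ?subr_ge0// distrC.
- rewrite ger0_norm ?subr_ge0// lerBlDl; apply: le_trans hi _.
  by rewrite lerD2l -(ger0_norm (x := u - t)) ?subr_ge0.
Unshelve. all: by end_near. Qed.

Lemma normal_cdf0_gt0 : 0 < fine (normal_prob 0 s `]-oo, 0]%classic).
Proof.
have p0 := normal_peak_gt0 s_neq0.
rewrite -lte_fin fineK; last exact: (fin_num_measure Q).
pose c := normal_peak s * expR (- (s ^+ 2 *+ 2)^-1).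
apply: (@lt_le_trans _ _ (\int[mu]_(x in `[(-1)%R, 0%R]) c%:E)%E).
  rewrite integral_cst//= lebesgue_measure_itv/= lte_fin ltrN10.
  by rewrite -EFinD -EFinM lte_fin sub0r opprK mulr1 mulr_gt0 ?expR_gt0.
apply: (@le_trans _ _ (Q `[(-1)%R, 0%R]%classic)); last first.
  apply: (le_measure Q); rewrite ?inE//.
  by move=> x /=; rewrite !in_itv /= => /andP[_ ->].
apply: ge0_le_integral => //=.
- by move=> x _; rewrite lee_fin /c mulr_ge0 ?expR_ge0 ?normal_peak_ge0.
- apply/measurable_funTS/measurable_EFinP; exact: measurable_normal_pdf.
- move=> x; rewrite /= in_itv /= => /andP[x1 x0].
  rewrite lee_fin normal_pdfE// /normal_fun subr0 ler_wpM2l ?normal_peak_ge0//.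
  rewrite ler_expR mulNr lerN2 ler_piMl//.
    by rewrite invr_ge0 mulrn_wge0 ?sqr_ge0.
  rewrite -sqrrN; nra.
Qed.

(** Layer-cake formula: [x^2] is the length of the interval from 0 to [x^2], and Tonelli's theorem
    exchanges the integrations. Convergence in law gives access to tails, not directly to
    moments. *)
Lemma normal_tail_integral :
  ((s ^+ 2)%:E <= \int[mu]_(r in `[0%R, +oo[)
     normal_prob 0 s [set x | r < x ^+ 2]%R)%E.
Proof.
pose f (z : R * R) := ((\1_[set z : R * R | z.1 < z.2 ^+ 2] z * (\1_(`[0, +oo[%classic : set R) z.1 * phi z.2))%:E)%E.
have mf : measurable_fun setT f.
  apply/measurable_EFinP; apply: measurable_funM.
    apply: measurable_indic.
    have : measurable_fun setT (fun z : R * R => z.1 < z.2 ^+ 2).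
      apply: measurable_fun_ltr => //; apply: measurable_funX; exact: measurable_snd.
    by move=> /(_ measurableT [set true]) /=; rewrite setTI; apply.
  apply: measurable_funM.
    by apply: measurableT_comp => //; apply: measurable_indic.
  by apply: measurableT_comp => //; exact: measurable_normal_pdf.
have f0 z : (0 <= f z)%E.
  by rewrite lee_fin !mulr_ge0 ?normal_pdf_ge0.
apply: le_trans normal_second_moment_ge _.
have -> : (\int[mu]_x (x ^+ 2 * phi x)%:E = \int[mu]_x \int[mu]_r f (r, x))%E.
  apply: eq_integral => x _.
  transitivity (\int[mu]_r ((phi x)%:E * (\1_(`[0, x ^+ 2[%classic : set R) r)%:E))%E.
    rewrite ge0_integralZl//; last 2 first.
    - by apply/measurable_EFinP; exact: measurable_indic.
    - by rewrite lee_fin normal_pdf_ge0.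
    rewrite integral_indic// setIT/= lebesgue_measure_itv/= lte_fin mulrC EFinM.
    congr (_ * _)%E; case: ltP => [_|]; first by rewrite sube0.
    by rewrite real_exprn_even_le0//= ?num_real// => /eqP ->; rewrite expr0n.
  apply: eq_integral => r _; rewrite /f -EFinM; congr EFin.
  rewrite !indicE !mem_setE /= !in_itv /= andbT mulrA mulrC; congr (_ * _).
  by rewrite -natrM mulnb andbC.
rewrite -(@fubini_tonelli _ _ _ _ _ mu mu f mf f0) [leRHS]integral_mkcond.
rewrite le_eqVlt; apply/orP; left; apply/eqP.
apply: eq_integral => r _; rewrite patchE.
have [r0|r0] := boolP (r \in _).
  rewrite /normal_prob [RHS]integral_mkcond; apply: eq_integral => x _.
  rewrite /f /= patchE !indicE r0 mul1r /=.
  have -> : ((r, x) \in [set z : R * R | z.1 < z.2 ^+ 2]) =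
            (x \in [set y : R | r < y ^+ 2]).
    by apply/idP/idP; rewrite !inE.
  by case: ifP => _; rewrite ?mul1r ?mul0r.
apply: integral0_eq => x _.
by rewrite /f /= [X in _ * (X * _)]indicE (negbTE r0) mul0r mulr0.
Qed.

End NormalMoment.

(** * Second moments under convergence in law to a normal distribution *)

Section NormalLimit.
Context {R : realType} (s : R) d (T : measurableType d) (P : probability T R).
Hypothesis s_neq0 : s != 0.
Variable W : nat -> T -> R.
Hypothesis mW : forall n, measurable_fun setT (W n).
Hypothesis W_cvg : forall t : R,
  fine (P [set w | W n w <= t]) @[n --> \oo] -->
  fine (normal_prob 0 s `]-oo, t]%classic).
Notation mu := (@lebesgue_measure R).
Let Q : probability (measurableTypeR R) R := normal_prob 0 s.
Let cdfQ (t : R) := fine (Q `]-oo, t]%classic).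

Let limn_einf_ge (u : nat -> \bar R) (l : R) :
  (forall e : R, 0 < e -> \forall n \near \oo, ((l - e)%:E <= u n)%E) ->
  (l%:E <= limn_einf u)%E.
Proof.
move=> lu; apply/lee_addgt0Pr => e e0.
rewrite -leeBlDr// -EFinB limn_einf_lim.
apply: lime_ge; first exact: is_cvg_einfs.
have [N _ NP] := lu _ e0.
exists N => // n /= Nn.
by apply: le_ereal_inf_tmp => _ [k /= nk <-]; apply: NP; exact: leq_trans nk.
Qed.

Let limn_einf_le (u : nat -> \bar R) (l : \bar R) :
  (\forall n \near \oo, (u n <= l)%E) -> (limn_einf u <= l)%E.
Proof.
move=> ul; rewrite limn_einf_lim; apply: lime_le; first exact: is_cvg_einfs.
apply: filterS ul => n; apply: le_trans.
by apply: ereal_inf_lbound; exists n => /=.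
Qed.

Let measurable_le n (t : R) : measurable [set w | W n w <= t].
Proof.
by have := mW n measurableT (measurable_itv `]-oo, t]); rewrite setTI preimage_itvNyc.
Qed.

Let sqr_tail_limit (r : R) : 0 <= r ->
  (normal_prob 0 s [set x | (r < x ^+ 2)%R] <=
   limn_einf (fun n => P [set w | (r < W n w ^+ 2)%R]))%E.
Proof.
move=> r0; set q : R := Num.sqrt r.
have sqrq : q ^+ 2 = r by rewrite sqr_sqrtr.
have q0 : 0 <= q by exact: sqrtr_ge0.
have Q_le : (Q [set x : R | (r < x ^+ 2)%R] <= (1 - cdfQ q + cdfQ (- q))%:E)%E.
  apply: (@le_trans _ _ (Q (~` `]-oo, q]%classic `|` `]-oo, (- q)%R]%classic))).
    apply: (le_measure Q); rewrite ?inE.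
    - have : measurable_fun setT (fun x : R => r < x ^+ 2).
        by apply: measurable_fun_ltr => //; exact: measurable_funX.
      by move=> /(_ measurableT [set true]) /=; rewrite setTI; apply.
    - by apply: measurableU => //; exact: measurableC.
    - move=> x /=; rewrite !in_itv /= -sqrq => qx.
      case: (leP x q) => xq; [right|by left]; nra.
  apply: (@le_trans _ _ (Q (~` `]-oo, q]%classic) + Q `]-oo, (- q)%R]%classic)%E).
    by apply: measureU2 => //; exact: measurableC.
  rewrite probability_setC// EFinD EFinB; apply: leeD.
    by rewrite /cdfQ fineK// fin_num_measure.
  by rewrite /cdfQ fineK// fin_num_measure.
apply: le_trans Q_le _; apply: limn_einf_ge => e e0.
(* The event [W < - q] is strict whereas distribution functions count [W <= t]; continuity of the
   normal one allows a shift by [h] at the cost of [e / 2]. *)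
have [h [h0 hQ]] : exists h : R, 0 < h /\ cdfQ (- q) - e / 2 <= cdfQ (- q - h).
  have /cvgrPdist_le/(_ (e / 2)) := @normal_cdf_continuous R s s_neq0 (- q).
  rewrite divr_gt0// => /(_ isT) /nbhs_ballP[h /= h0 hP].
  exists (h / 2); split; first by rewrite divr_gt0.
  have /hP : ball (- q) h (- q - h / 2).
    rewrite /ball /= opprD addrA subrr sub0r opprK ger0_norm; lra.
  by move=> /= /ler_normlP[_]; rewrite -/(cdfQ _) -/(cdfQ _); lra.
have /cvgrPdist_le/(_ (e / 4)) := @W_cvg q.
have /cvgrPdist_le/(_ (e / 4)) := @W_cvg (- q - h).
rewrite divr_gt0// => /(_ isT) near_lo /(_ isT) near_hi.
near=> n.
have /ler_normlP[_ lo] : `|cdfQ (- q - h) - fine (P [set w | W n w <= - q - h])| <= e / 4.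
  by near: n.
have /ler_normlP[hi _] : `|cdfQ q - fine (P [set w | W n w <= q])| <= e / 4.
  by near: n.
have incl : [set w | W n w <= - q - h] `|` ~` [set w | W n w <= q]
    `<=` [set w | r < W n w ^+ 2].
  by move=> w /= [|/negP]; rewrite -sqrq -?ltNge; nra.
have mr : measurable [set w | r < W n w ^+ 2].
  have : measurable_fun setT (fun w => r < W n w ^+ 2).
    by apply: measurable_fun_ltr => //; exact: measurable_funX.
  by move=> /(_ measurableT [set true]) /=; rewrite setTI; apply.
apply: (@le_trans _ _ (P ([set w | W n w <= - q - h] `|` ~` [set w | W n w <= q])));
  last first.
  apply: le_measure incl; rewrite ?inE//.
  by apply: measurableU => //; exact: measurableC.
have -> : P ([set w | W n w <= - q - h] `|` ~` [set w | W n w <= q]) =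
    (P [set w | (W n w <= - q - h)%R] + (1 - P [set w | (W n w <= q)%R]))%E.
  rewrite -probability_setC//; apply: measureU => //; first exact: measurableC.
  by apply/seteqP; split => w //= [wlo /negP]; rewrite -ltNge; lra.
rewrite -[P [set w | W n w <= - q - h]]fineK ?fin_num_measure//.
rewrite -[P [set w | W n w <= q]]fineK ?fin_num_measure//.
rewrite -EFinB -EFinD lee_fin; lra.
Unshelve. all: by end_near. Qed.

Lemma normal_limit_second_moment (c : R) :
  (\forall n \near \oo, (\int[P]_w (W n w ^+ 2)%:E <= c%:E)%E) -> s ^+ 2 <= c.
Proof.
move=> Wc; rewrite -lee_fin.
apply: le_trans (normal_tail_integral s_neq0) _.
apply: le_trans (limn_einf_le Wc).
have mW2 n : measurable_fun setT (fun w => W n w ^+ 2) by exact: measurable_funX.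
pose W2 n : {RV P >-> R} := mfun_Sub (mem_set (mW2 n)).
have ccdfE n r : ccdf (W2 n) r = P [set w | (r < W n w ^+ 2)%R].
  by rewrite /ccdf /distribution /pushforward; congr (P _);
     apply/seteqP; split => w /=; rewrite in_itv /= andbT.
have -> : (fun n => \int[P]_w (W n w ^+ 2)%:E)%E =
  (fun n => \int[mu]_(r in `[0%R, +oo[) ccdf (W2 n) r)%E.
  apply/funext => n; rewrite -ge0_expectation_ccdf.
    by rewrite expectation_def.
  by move=> w; rewrite sqr_ge0.
apply: (@le_trans _ _ (\int[mu]_(r in `[0%R, +oo[) limn_einf (fun n => ccdf (W2 n) r))%E);
  last first.
  apply: fatou => // n; apply: measurable_funTS; exact: ccdf_measurable.
have mX2 : measurable_fun setT ((fun x : R => x ^+ 2) : measurableTypeR R -> R).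
  exact: measurable_funX.
pose X2 : {RV Q >-> R} := @mfun_Sub _ _ (measurableTypeR R) R _ (mem_set mX2).
apply: ge0_le_integral => //.
- have -> : (fun r => normal_prob 0 s [set x | r < x ^+ 2]) = ccdf X2.
    apply/funext => r; rewrite /ccdf /distribution /pushforward; congr (normal_prob 0 s _).
    by apply/seteqP; split => w /=; rewrite in_itv /= andbT.
  by apply: measurable_funTS; exact: ccdf_measurable.
- apply: measurable_funTS; apply: measurableT_comp => //.
  apply: measurable_fun_limn_esup => n.
  by apply: measurableT_comp => //; exact: ccdf_measurable.
- move=> r /=; rewrite in_itv /= andbT => r0.
  suff -> : (fun n => ccdf (W2 n) r) = (fun n => P [set w | (r < W n w ^+ 2)%R]).
    exact: sqr_tail_limit.
  by apply/funext => n; exact: ccdfE.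
Qed.

End NormalLimit.

(** * Inconsistency *)

Section Inconsistency.
Context {R : realType} d (T : measurableType d) (P : probability T R).
Variables (b x m : nat -> T -> R) (k : nat -> R).
Hypothesis mb : forall n, measurable_fun setT (b n).
Hypothesis mx : forall n, measurable_fun setT (x n).
Hypothesis mm : forall n, measurable_fun setT (m n).
Hypothesis k_ge : \forall n \near \oo, 357 / 1000 <= k n.
Hypothesis b_near_k : \forall n \near \oo,
  (\int[P]_w ((b n w - k n) ^+ 2)%:E <= (399 / 1000 / n%:R)%:E)%E.
Hypothesis b_near_m : \forall n \near \oo,
  (\int[P]_w ((b n w - m n w) ^+ 2)%:E <= (399 / 1000 / n%:R)%:E)%E.
Hypothesis x_near0 : \forall n \near \oo,
  (\int[P]_w ((x n w) ^+ 2)%:E <= (100 / n%:R)%:E)%E.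

Let prob_le_integral (A : set T) (g : T -> R) (c : R) : measurable A ->
  measurable_fun A g -> 0 <= c -> (forall w, A w -> c <= g w) ->
  ((c * fine (P A))%:E <= \int[P]_(w in A) (g w)%:E)%E.
Proof.
move=> mA mg c0 cg.
rewrite EFinM fineK ?fin_num_measure// -integral_cst//.
apply: ge0_le_integral => //=; exact/measurable_EFinP.
Qed.

Let integral_sqr_le (A : set T) (f : T -> R) : measurable A -> measurable_fun setT f ->
  (\int[P]_(w in A) (f w ^+ 2)%:E <= \int[P]_w (f w ^+ 2)%:E)%E.
Proof.
move=> mA mf; apply: ge0_subset_integral => //.
- by apply/measurable_EFinP; exact: measurable_funX.
- by move=> w _; rewrite lee_fin sqr_ge0.
Qed.

Let integral_sqrD (A : set T) (f g : T -> R) : measurable A ->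
  measurable_fun setT f -> measurable_fun setT g ->
  (\int[P]_(w in A) (f w ^+ 2 + g w ^+ 2)%:E =
   \int[P]_(w in A) (f w ^+ 2)%:E + \int[P]_(w in A) (g w ^+ 2)%:E)%E.
Proof.
move=> mA mf mg; under eq_integral do rewrite EFinD.
apply: ge0_integralD => //; try by move=> w _; rewrite lee_fin sqr_ge0.
- by apply/measurable_funTS/measurable_EFinP; exact: measurable_funX.
- by apply/measurable_funTS/measurable_EFinP; exact: measurable_funX.
Qed.

Let cvg_event (W : nat -> T -> R) (c e h : R) : (forall n, measurable_fun setT (W n)) ->
  0 < e -> 0 < h -> cvg_in_probability P W c ->
  \forall n \near \oo, 1 - h <= fine (P [set w | `|W n w - c| < e]).
Proof.
move=> mW e0 h0 /(_ e e0) /fine_cvgP[_ /cvgrPdist_le/(_ h h0)].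
apply: filterS => n /=; rewrite sub0r normrN ger0_norm ?fine_ge0// => Ph.
have mA : measurable [set w | e <= `|W n w - c|].
  have : measurable_fun setT (fun w => e <= `|W n w - c|).
    apply: measurable_fun_ler => //; apply: measurableT_comp => //.
    exact: measurable_funB.
  by move=> /(_ measurableT [set true]) /=; rewrite setTI; apply.
have -> : [set w | `|W n w - c| < e] = ~` [set w | e <= `|W n w - c|].
  by apply/seteqP; split => w /=; rewrite ltNge => /negP.
by rewrite probability_setC// fineB// ?fin_num_measure//= lerB.
Qed.

Let measurable_event d' (S : measurableType d') (Z : T -> S) (f g : T -> R) (c e : R) (a : R) :
  cond_exp_version P Z f g ->
  exists2 A : set S, measurable A & Z @^-1` A = [set w | `|a * g w - c| < e].
Proof.
move=> [/(_ [set y | `|a * y - c| < e]) [] ].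
  have : measurable_fun setT (fun y : R => `|a * y - c| < e).
    apply: measurable_fun_ltr => //; apply: measurableT_comp => //.
    by apply: measurable_funB => //; exact: measurable_funM.
  by move=> /(_ measurableT [set true]) /=; rewrite setTI; apply.
by move=> A mA; rewrite setTI => ZA _ _; exists A.
Qed.

Let measurable_version d' (S : measurableType d') (Z : T -> S) (f g : T -> R) :
  cond_exp_version P Z f g -> measurable_fun setT g.
Proof. by move=> [_ /measurable_int/measurable_EFinP]. Qed.

(** From [k = (b - x) - (b - k) + x], the constant [k^2] is at most three times the sum of the three
    squares. On the event where [n q] is near [c], which belongs to the sample, each square would
    have an integral of order [1/n]. *)
Lemma mean_square_not_cvg d' (S : nat -> measurableType d') (Z : forall n, T -> S n)
    (q : nat -> T -> R) (c : R) :
  (forall n, measurable_fun setT (Z n)) ->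
  (forall n, cond_exp_version P (Z n) (fun w => (b n w - x n w) ^+ 2) (q n)) ->
  ~ cvg_in_probability P (fun n w => n%:R * q n w) c.
Proof.
move=> mZ qP qc.
have mq n : measurable_fun setT (q n) := measurable_version (qP n).
have half : 0 < 1 / 2 :> R by rewrite divr_gt0.
have := cvg_event _ ltr01 half qc.
move=> /(_ (fun n => measurable_funM (measurable_cst _) (mq n))) Bn.
have : \forall n \near \oo, False.
  near=> n.
  have PB : 1 - 1 / 2 <= fine (P [set w | `|n%:R * q n w - c| < 1]) by near: n.
  have kn : 357 / 1000 <= k n by near: n.
  have bk : (\int[P]_w ((b n w - k n) ^+ 2)%:E <= (399 / 1000 / n%:R)%:E)%E by near: n.
  have x0 : (\int[P]_w ((x n w) ^+ 2)%:E <= (100 / n%:R)%:E)%E by near: n.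
  (* The inequality [0.0595 n <= 3 (|c| + 101.399)] obtained below fails for such [n]. *)
  have nbig : 60 * (`|c| + 102) <= n%:R by near: n; exact: nbhs_infty_ger.
  have n0 : 0 < n%:R :> R by have := normr_ge0 c; lra.
  have [A mA ABE] := measurable_event c 1 n%:R (qP n).
  set B := [set w | _] in PB ABE.
  have mB : measurable B.
    by rewrite -ABE; have := mZ n measurableT A mA; rewrite setTI.
  have [_ iq qE] := qP n.
  have bx : (\int[P]_(w in B) ((b n w - x n w) ^+ 2)%:E <= ((`|c| + 1) / n%:R)%:E)%E.
    rewrite -ABE -qE// ABE.
    apply: (@le_trans _ _ (\int[P]_(w in B) ((`|c| + 1) / n%:R)%:E)%E).
      apply: le_integral => //.
      - exact: integrableS iq.
      - exact: finite_measure_integrable_cst.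
      - move=> w; rewrite inE => Bw; rewrite lee_fin ler_pdivlMr// mulrC.
        have := ltr_norml; move: Bw; rewrite /B /= ltr_norml => /andP[_].
        by have := ler_norm c; lra.
    rewrite integral_cst// -[leRHS]mule1; apply: lee_wpmul2l.
      by rewrite lee_fin divr_ge0// addr_ge0.
    exact: probability_le1.
  have key : (((119 / 1000) * (1 / 2))%:E <=
     (3 * ((`|c| + 1) / n%:R + 399 / 1000 / n%:R + 100 / n%:R))%:E)%E.
    pose h1 w := b n w - x n w; pose h2 w := b n w - k n.
    have m1 : measurable_fun setT h1 by exact: measurable_funB.
    have m2 : measurable_fun setT h2 by exact: measurable_funB.
    have mg : measurable_fun setT (fun w => h1 w ^+ 2 + h2 w ^+ 2 + x n w ^+ 2).
      by apply: measurable_funD; [apply: measurable_funD|]; exact: measurable_funX.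
    have kg w : B w -> 119 / 1000 / 3 <= h1 w ^+ 2 + h2 w ^+ 2 + x n w ^+ 2.
      move=> _; rewrite /h1 /h2; set u := b n w; set y := x n w.
      have kk : 119 / 1000 <= k n ^+ 2 by nra.
      have := sqr_ge0 (u - y + (u - k n)); have := sqr_ge0 (u - y - y).
      by have := sqr_ge0 (u - k n + y); nra.
    have c0 : 0 <= 119 / 1000 / 3 :> R by lra.
    have le1 := prob_le_integral mB (measurable_funTS mg) c0 kg.
    apply: (@le_trans _ _ (3%:E * (119 / 1000 / 3 * fine (P B))%:E)%E).
      rewrite -EFinM lee_fin; lra.
    rewrite [leRHS]EFinM; apply: lee_wpmul2l; first by rewrite lee_fin ler0n.
    apply: le_trans le1 _.
    under eq_integral do rewrite EFinD.
    rewrite ge0_integralD//; last 4 first.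
    - by move=> w _; rewrite lee_fin addr_ge0 ?sqr_ge0.
    - by apply/measurable_funTS/measurable_EFinP/measurable_funD; exact: measurable_funX.
    - by move=> w _; rewrite lee_fin sqr_ge0.
    - by apply/measurable_funTS/measurable_EFinP; exact: measurable_funX.
    rewrite integral_sqrD// !EFinD; apply: leeD; last exact: le_trans (integral_sqr_le _ _) x0.
    by apply: leeD => //; exact: le_trans (integral_sqr_le _ _) bk.
  move: key; rewrite lee_fin.
  rewrite (_ : 3 * _ = 3 * (`|c| + 1 + 399 / 1000 + 100) / n%:R); last by ring.
  rewrite ler_pdivlMr//; lra.
by case=> N _ /(_ N (leqnn N)).
Unshelve. all: by end_near. Qed.

(** With probability at least [0.999], [n v] would be at least [0.3995]; the product of the two
    exceeds [0.399]. The event belongs to the sample, so [v] may be replaced there by the squared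
    deviation. *)
Lemma variance_not_cvg d' (S : nat -> measurableType d') (Z : forall n, T -> S n)
    (v : nat -> T -> R) :
  (forall n, measurable_fun setT (Z n)) ->
  (forall n, cond_exp_version P (Z n) (fun w => (b n w - m n w) ^+ 2) (v n)) ->
  ~ cvg_in_probability P (fun n w => n%:R * v n w) (2 / 5).
Proof.
move=> mZ vP vc.
have mv n : measurable_fun setT (v n) := measurable_version (vP n).
have e0 : 0 < 1 / 2000 :> R by lra.
have h0 : 0 < 1 / 1000 :> R by lra.
have := cvg_event _ e0 h0 vc.
move=> /(_ (fun n => measurable_funM (measurable_cst _) (mv n))) Bn.
have : \forall n \near \oo, False.
  near=> n.
  have PB : 1 - 1 / 1000 <= fine (P [set w | `|n%:R * v n w - 2 / 5| < 1 / 2000]).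
    by near: n.
  have bm : (\int[P]_w ((b n w - m n w) ^+ 2)%:E <= (399 / 1000 / n%:R)%:E)%E by near: n.
  have n0 : 0 < n%:R :> R by rewrite ltr0n; near: n; exact: nbhs_infty_gt.
  have [A mA ABE] := measurable_event (2 / 5) (1 / 2000) n%:R (vP n).
  set B := [set w | _] in PB ABE.
  have mB : measurable B.
    by rewrite -ABE; have := mZ n measurableT A mA; rewrite setTI.
  have [_ iv vE] := vP n.
  have c0 : 0 <= 799 / 2000 / n%:R :> R by apply: divr_ge0; [lra|exact: ler0n].
  have vB w : B w -> 799 / 2000 / n%:R <= v n w.
    by rewrite /B /= ltr_norml ler_pdivrMr// => /andP[+ _]; lra.
  have := prob_le_integral mB (measurable_funTS (mv n)) c0 vB.
  rewrite -ABE vE// ABE => /le_trans/(_ (integral_sqr_le mB _)).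
  move=> /(_ (measurable_funB (mb n) (mm n))) /le_trans/(_ bm).
  rewrite lee_fin mulrAC ler_pM2r ?invr_gt0//; lra.
by case=> N _ /(_ N (leqnn N)).
Unshelve. all: by end_near. Qed.

Let cond_prob_setT (A : set T) : cond_prob P A setT = fine (P A).
Proof. by rewrite /cond_prob setIT probability_setT /= divr1. Qed.

(** Tested at the point 0, where the normal distribution function is positive. The event [b <= x]
    forces [(b - k)^2 + x^2 >= k^2 / 2], so its probability is of order [1/n]. *)
Lemma deviation_not_cvg_in_law (s : R) : s != 0 ->
  ~ cvg_in_law_given P (fun=> setT) (fun n w => Num.sqrt n%:R * (b n w - x n w))
      (normal_prob 0 s).
Proof.
move=> s0 /(_ 0 (@normal_cdf_continuous R s s0 0)).
set c := fine _; have c0 : 0 < c := normal_cdf0_gt0 s0.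
have c2 : 0 < c / 2 by rewrite divr_gt0.
under eq_fun do rewrite cond_prob_setT.
move=> /cvgrPdist_le/(_ _ c2) Bn.
have : \forall n \near \oo, False.
  near=> n.
  have PB : `|c - fine (P [set w | Num.sqrt n%:R * (b n w - x n w) <= 0])| <= c / 2.
    by near: n.
  have kn : 357 / 1000 <= k n by near: n.
  have bk : (\int[P]_w ((b n w - k n) ^+ 2)%:E <= (399 / 1000 / n%:R)%:E)%E by near: n.
  have x0 : (\int[P]_w ((x n w) ^+ 2)%:E <= (100 / n%:R)%:E)%E by near: n.
  have nbig : 50 * 100 / c <= n%:R by near: n; exact: nbhs_infty_ger.
  have n0 : 0 < n%:R :> R by apply: lt_le_trans nbig; apply: divr_gt0 => //; lra.
  set B := [set w | _] in PB.
  have mB : measurable B.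
    have : measurable_fun setT (fun w => Num.sqrt n%:R * (b n w - x n w) <= 0).
      apply: measurable_fun_ler => //; apply: measurable_funM => //.
      exact: measurable_funB.
    by move=> /(_ measurableT [set true]) /=; rewrite setTI; apply.
  pose h w := b n w - k n.
  have mh : measurable_fun setT h by exact: measurable_funB.
  have kg w : B w -> 1 / 20 <= h w ^+ 2 + x n w ^+ 2.
    rewrite /B /= pmulr_rle0 ?sqrtr_gt0// subr_le0 /h => bx.
    have := sqr_ge0 (b n w - k n + x n w); nra.
  have mg : measurable_fun setT (fun w => h w ^+ 2 + x n w ^+ 2).
    by apply: measurable_funD; exact: measurable_funX.
  have c1 : 0 <= 1 / 20 :> R by lra.
  have := prob_le_integral mB (measurable_funTS mg) c1 kg.
  rewrite integral_sqrD// => /le_trans/(_ (leeD (integral_sqr_le mB mh)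
    (integral_sqr_le mB (mx n)))) /le_trans/(_ (leeD bk x0)).
  rewrite -EFinD lee_fin -mulrDl ler_pdivlMr//.
  move: PB => /ler_normlP[_ PB].
  move: nbig; rewrite ler_pdivrMr//.
  nra.
by case=> N _ /(_ N (leqnn N)).
Unshelve. all: by end_near. Qed.

Lemma centred_not_cvg_in_law :
  ~ cvg_in_law_given P (fun=> setT) (fun n w => Num.sqrt n%:R * (b n w - m n w))
      (normal_prob 0 (Num.sqrt (2 / 5))).
Proof.
have s2 : (Num.sqrt (2 / 5)) ^+ 2 = 2 / 5 :> R by rewrite sqr_sqrtr//; lra.
have s0 : Num.sqrt (2 / 5) != 0 :> R by rewrite sqrtr_eq0 -ltNge; lra.
move=> W_cvg.
have mW n : measurable_fun setT (fun w => Num.sqrt n%:R * (b n w - m n w)).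
  by apply: measurable_funM => //; exact: measurable_funB.
have Wc : \forall n \near \oo,
    (\int[P]_w ((Num.sqrt n%:R * (b n w - m n w)) ^+ 2)%:E <= (399 / 1000)%:E)%E.
  near=> n.
  have n0 : 0 < n%:R :> R by rewrite ltr0n; near: n; exact: nbhs_infty_gt.
  under eq_integral do rewrite exprMn sqr_sqrtr ?ler0n// EFinM.
  have mf : measurable_fun setT (fun w => ((b n w - m n w) ^+ 2)%:E).
    by apply/measurable_EFinP/measurable_funX; exact: measurable_funB.
  have f0 w : [set: T] w -> (0 <= ((b n w - m n w) ^+ 2)%:E)%E.
    by rewrite lee_fin sqr_ge0.
  rewrite (ge0_integralZl P measurableT mf f0) ?lee_fin ?ler0n//.
  rewrite -lee_pdivlMl// -EFinM mulrC; near: n; exact: b_near_m.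
have /= := normal_limit_second_moment s0 mW _ Wc.
rewrite s2 => H; have := H _; suff W_lim : forall t : R,
    fine (P [set w | Num.sqrt n%:R * (b n w - m n w) <= t]) @[n --> \oo] -->
    fine (normal_prob 0 (Num.sqrt (2 / 5)) `]-oo, t]%classic).
  by move=> /(_ W_lim); lra.
move=> t; have := W_cvg t (@normal_cdf_continuous R _ s0 t).
by under eq_fun do rewrite cond_prob_setT.
Unshelve. all: by end_near. Qed.

End Inconsistency.

(** * Numerical bounds around [expR (-1)] *)

Section Constants.
Context {R : realType}.

(** From [expR (- 1/20) >= 19/20] and [(19/20)^20], about [0.35849]; intermediate powers are rounded
    down. *)
Let expRN1_ge : 358 / 1000 <= expR (-1) :> R.
Proof.
have e20 : expR (-1) = expR (- (1 / 20)) ^+ 20 :> R.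
  by rewrite -expRM_natl; congr expR; field.
have := expR_ge1Dx (- (1 / 20) : R); rewrite e20.
set a := expR _ => a1.
have a0 : 19 / 20 <= a by lra.
have a4 : 8145 / (10 * 1000) <= a ^+ 4.
  have a2 : 361 / 400 <= a ^+ 2 by nra.
  by rewrite (exprM a 2 2); nra.
have a8 : 663 / 1000 <= a ^+ 8 by rewrite (exprM a 4 2); nra.
have a16 : 4395 / (10 * 1000) <= a ^+ 16 by rewrite (exprM a 8 2); nra.
by rewrite (exprD a 16 4); nra.
Qed.

(** With [t = 1 / (n - 1)], the inequality [n / (n - 1) = 1 + t <= expR t] raised to the power [n]
    gives the lower bound [expR (-1) * expR (- t)]. *)
Lemma missed_fraction_ge :
  \forall n \near \oo, 357 / 1000 <= (n%:R - 1) ^+ n / n%:R ^+ n :> R.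
Proof.
near=> n.
have n1 : 999 < n%:R - 1 :> R.
  suff : 1001 <= n%:R :> R by lra.
  by near: n; exact: nbhs_infty_ger.
have n1_gt0 : 0 < n%:R - 1 :> R by lra.
have n0 : 0 < n%:R :> R by lra.
set t : R := (n%:R - 1)^-1.
have t0 : 0 < t by rewrite invr_gt0.
have nt : (n%:R - 1) * t = 1 by rewrite /t divff// gt_eqF.
have t_le : t * 999 <= 1 by nra.
have base : expR (- t) <= (n%:R - 1) / n%:R.
  rewrite expRN ler_pdivlMr// mulrC ler_pdivrMr ?expR_gt0//.
  have := expR_ge1Dx t => te; nra.
rewrite -expr_div_n; apply: (@le_trans _ _ (expR (- t) ^+ n)); last first.
  by rewrite lerXn2r ?nnegrE ?expR_ge0// divr_ge0 ?ltW.
have -> : expR (- t) ^+ n = expR (-1) * expR (- t).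
  by rewrite -expRM_natl -expRD; congr expR; lra.
have := expR_ge1Dx (- t); have := expRN1_ge; nra.
Unshelve. all: by end_near. Qed.

Lemma compound_le (n : nat) : (n%:R + 1) ^+ n <= 4 * n%:R ^+ n :> R.
Proof.
have [->|n_gt0] := posnP n; first by rewrite !expr0; lra.
have n0 : 0 < n%:R :> R by rewrite ltr0n.
rewrite -ler_pdivrMr ?exprn_gt0// -expr_div_n mulrDl divff ?gt_eqF// mul1r.
apply: (@le_trans _ _ (expR n%:R^-1 ^+ n)).
  apply: lerXn2r (expR_ge1Dx _); rewrite ?nnegrE ?expR_ge0//.
rewrite -expRM_natl mulfV ?gt_eqF//.
have : expR 1 * expR (-1) = 1 :> R by rewrite -expRD subrr expR0.
by have := expRN1_ge; have := expR_gt0 (1 : R); nra.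
Qed.

End Constants.

(** An atom of X at [x] would make the joint distribution function jump at [(x, y)] by at least its
    mass times [cdf Y y], for a [y] where the latter is positive. *)
Lemma atomless_of_continuous_cdf (R : realType) d (T : measurableType d)
    (P : probability T R) (X Y : {RV P >-> R}) :
  (forall x y, joint_cdf X Y (x, y) = cdf X x * cdf Y y)%E ->
  continuous (fun z : R * R => fine (joint_cdf X Y z)) ->
  forall x, P (X @^-1` [set x]) = 0%E.
Proof.
move=> indepXY contXY x.
have [y y0] : exists y, 0 < fine (cdf Y y).
  have /fine_cvgP[_ /cvgrPdist_lt/(_ 1 ltr01)] := cvg_cdfy1 Y.
  case=> M [_ MP]; exists (M + 1).
  have /MP : M < M + 1 by rewrite ltrDl.
  by rewrite /= => /ltr_normlP[_]; lra.
have mX (A : set R) : measurable A -> measurable (X @^-1` A).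
  by move=> mA; rewrite -[X in measurable X]setTI; exact: measurable_funP.
set a := fine (P (X @^-1` [set x])).
have aE : P (X @^-1` [set x]) = a%:E.
  by rewrite fineK// fin_num_measure//; apply: mX; exact: measurable_set1.
rewrite aE; congr EFin; apply/eqP; rewrite eq_le fine_ge0// andbT leNgt.
apply/negP => a0.
pose e := a * fine (cdf Y y).
have e0 : 0 < e by rewrite mulr_gt0.
have /cvgrPdist_lt/(_ _ e0) := contXY (x, y).
move=> /nbhs_ballP[h /= h0 hP].
have /hP : ball (x, y) h (x - h / 2, y).
  split; last exact: ballxx.
  by rewrite /ball /= opprB addrC subrK ger0_norm; lra.
rewrite !indepXY !fineM ?fin_num_measure// -mulrBl.
have : fine (cdf X (x - h / 2)) + a <= fine (cdf X x).
  rewrite -lee_fin EFinD -aE !fineK ?fin_num_measure//.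
  set A := X @^-1` [set x]; pose B := X @^-1` `]-oo, x - h / 2]%classic.
  have mA : measurable A by apply: mX; exact: measurable_set1.
  have mB : measurable B by apply: mX.
  apply: (@le_trans _ _ (P (B `|` A))).
    have -> : P (B `|` A) = (P B + P A)%E; last exact: lexx.
    apply: measureU => //; apply/seteqP; split => w //= [].
    by rewrite /B /A /= in_itv /= => /[swap] ->; lra.
  have mC : measurable (X @^-1` `]-oo, x]%classic) by apply: mX.
  apply: le_measure; rewrite ?inE//; first exact: measurableU.
  by move=> w []; rewrite /A /B /= !in_itv /=; [move=> Xw; lra|move=> ->].
move=> cdf_jump; rewrite ger0_norm; last by rewrite mulr_ge0// ?fine_ge0//; lra.
by rewrite /e ltr_pM2r//; lra.
Qed.

Theorem theorem2p1 (R : realType)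
  (d0 : measure_display) (T0 : measurableType d0) (P0 : probability T0 R)
  (X0 Y0 : {RV P0 >-> R})
  (indep_XY : forall x y : R,
     joint_cdf X0 Y0 (x, y) = (cdf X0 x * cdf Y0 y)%E)
  (cont_XY : continuous (fun z : R * R => fine (joint_cdf X0 Y0 z)))
  (d : measure_display) (T : measurableType d) (P : probability T R)
  (X Y : nat -> {RV P >-> R})
  (indep : mutually_independent P (fun i w => (X i w, Y i w)))
  (copies : forall i : nat,
     same_law P0 P (fun w => (X0 w, Y0 w)) (fun w => (X i w, Y i w)))
  (J : forall n : nat, T -> {ffun 'I_n -> 'I_n})
  (draws : bootstrap_draws X Y J)
  (srt bsrt : forall n : nat, T -> 'S_n)
  (srt_meas : forall n (s : 'S_n), measurable (srt n @^-1` [set s]))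
  (bsrt_meas : forall n (s : 'S_n), measurable (bsrt n @^-1` [set s]))
  (srtP : forall n w, arranges (fun i : 'I_n => X i w) (srt n w))
  (bsrtP : forall n w, arranges (@Xb R d T P X J n w) (bsrt n w))
  (q m v : nat -> T -> R)
  (* q n = E[(xi_b - xi_n)^2 | sample], m n = E[xi_b | sample],
     v n = Var[xi_b | sample] *)
  (qP : forall n, cond_exp_version P (sample X Y n)
     (fun w => (xi_b X Y J bsrt n w - xi_n Y srt n w) ^+ 2) (q n))
  (mP : forall n, cond_exp_version P (sample X Y n)
     (xi_b X Y J bsrt n) (m n))
  (vP : forall n, cond_exp_version P (sample X Y n)
     (fun w => (xi_b X Y J bsrt n w - m n w) ^+ 2) (v n)) :
  (~ cvg_in_probability P (fun n w => n%:R * q n w) (2%:R / 5%:R) /\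
   ~ cvg_in_probability P (fun n w => n%:R * v n w) (2%:R / 5%:R)) /\
  exists E : forall n : nat, set (n.-tuple (R * R)),
    [/\ forall n, measurable (E n),
        (0 < limn_einf (fun n => P (sample X Y n @^-1` E n)))%E,
        ~ cvg_in_law_given P (fun n => sample X Y n @^-1` E n)
            (fun n w => Num.sqrt n%:R *
               (xi_b X Y J bsrt n w - xi_n Y srt n w))
            (normal_prob 0 (Num.sqrt (2%:R / 5%:R))) &
        ~ cvg_in_law_given P (fun n => sample X Y n @^-1` E n)
            (fun n w => Num.sqrt n%:R * (xi_b X Y J bsrt n w - m n w))
            (normal_prob 0 (Num.sqrt (2%:R / 5%:R)))].
Proof.
have law i (A B : set R) : measurable A -> measurable B ->
    P (X i @^-1` A `&` Y i @^-1` B) = P0 (X0 @^-1` A `&` Y0 @^-1` B).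
  move=> mA mB; have mAB : measurable (A `*` B) by exact: measurableX.
  exact: copies i _ mAB.
have marg i x y : P (X i @^-1` `]-oo, x]%classic `&` Y i @^-1` `]-oo, y]%classic) =
    (cdf X0 x * cdf Y0 y)%E.
  by rewrite -indep_XY law.
have X_atomless i x : P (X i @^-1` [set x]) = 0%E.
  rewrite -(atomless_of_continuous_cdf indep_XY cont_XY x).
  have := law i _ _ (measurable_set1 x) measurableT.
  by rewrite !preimage_setT !setIT.
have Y_atomless i y : P (Y i @^-1` [set y]) = 0%E.
  have joint_swap (z : R * R) : joint_cdf Y0 X0 z = joint_cdf X0 Y0 (z.2, z.1).
    by rewrite /joint_cdf setIC.
  have indep_YX y1 x1 : joint_cdf Y0 X0 (y1, x1) = (cdf Y0 y1 * cdf X0 x1)%E.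
    by rewrite joint_swap indep_XY muleC.
  have cont_YX : continuous (fun z : R * R => fine (joint_cdf Y0 X0 z)).
    move=> z; under eq_fun do rewrite joint_swap.
    apply: (continuous_comp (f := @unstable.swap R R) (g := fun u => fine (joint_cdf X0 Y0 u))).
      exact: swap_continuous.
    exact: cont_XY.
  rewrite -(atomless_of_continuous_cdf indep_YX cont_YX y).
  have := law i _ _ measurableT (measurable_set1 y).
  by rewrite !preimage_setT !setTI.
pose k n : R := (n%:R - 1) ^+ n / n%:R ^+ n.
have mb n := measurable_xi_b draws (srt_meas n) (bsrt_meas n).
have mx n := measurable_xi_n draws (srt_meas n) (bsrt_meas n).
have mm n := measurable_cond_mean (mP n).
have k_ge : \forall n \near \oo, 357 / 1000 <= k n := missed_fraction_ge.
have b_near_k : \forall n \near \oo,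
    (\int[P]_w ((xi_b X Y J bsrt n w - k n) ^+ 2)%:E <= (399 / 1000 / n%:R)%:E)%E.
  near=> n.
  have nbig : 1000 * (1000 * (1000 * 1000)) <= n%:R :> R.
    by near: n; exact: nbhs_infty_ger.
  have n0 : (0 < n)%N by near: n; exact: nbhs_infty_gt.
  have nR : 0 < n%:R :> R by rewrite ltr0n.
  apply: le_trans (xi_b_sqdev indep marg X_atomless Y_atomless draws
    (srt_meas n) (bsrt_meas n) (bsrtP n) n0) _.
  have kn : 357 / 1000 <= k n by near: n.
  rewrite lee_fin ler_pdivlMr// -mulrA mulrC ler_pdivrMr ?exprn_gt0//.
  rewrite mulr_suml; under eq_bigr do rewrite mulrC.
  by rewrite [leRHS]mulrC; exact: sum_draw_bound nbig kn (compound_le n).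
have b_near_m : \forall n \near \oo,
    (\int[P]_w ((xi_b X Y J bsrt n w - m n w) ^+ 2)%:E <= (399 / 1000 / n%:R)%:E)%E.
  apply: filterS b_near_k => n; apply: le_trans.
  exact: (cond_mean_optimal indep X_atomless Y_atomless draws (srt_meas n)
    (bsrt_meas n) (bsrtP n) (mP n)).
have x_near0 : \forall n \near \oo,
    (\int[P]_w (xi_n Y srt n w ^+ 2)%:E <= (100 / n%:R)%:E)%E.
  near=> n.
  apply: (xi_n_sqr indep marg X_atomless Y_atomless draws (srt_meas n)
    (bsrt_meas n) (srtP n)).
  by near: n; exact: nbhs_infty_gt.
have mZ n := measurable_sample X Y n.
split; [split|].
- exact: (mean_square_not_cvg mb mx k_ge b_near_k x_near0 mZ qP).
- exact: (variance_not_cvg mb mm b_near_m mZ vP).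
have sampleT : (fun n => sample X Y n @^-1` setT) = (fun=> setT).
  by apply/funext => n; rewrite preimage_setT.
exists (fun=> setT); split => //.
- have P1 : (fun n => P (sample X Y n @^-1` setT)) @ \oo --> 1%E.
    under eq_fun do rewrite preimage_setT probability_setT.
    exact: cvg_cst.
  by rewrite (cvg_limn_einf_sup P1).1.
- rewrite sampleT; apply: (deviation_not_cvg_in_law mb mx k_ge b_near_k x_near0).
  by rewrite sqrtr_eq0 -ltNge divr_gt0.
- by rewrite sampleT; exact: (centred_not_cvg_in_law mb mm b_near_m).
Unshelve. all: by end_near. Qed.
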